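(* Let $X$ be a complex differentiable manifold with an infinitely differentiable self-map $f$. Then the natural map $$\mathbb{H}^1(\{X/f\},\mathcal{A}_\bullet^* )\longrightarrow\mathbb{H}^2(\{X/f\},\underline{\mathbb{Z}}(1)_\bullet)$$ is not, in general, an isomorphism. For example, if $X$ is a simply connected compact Kähler manifold, its kernel contains a copy of $\mathbb{C}^*$.
   Context: Abelian sheaves on $\{X/f\}$ are (identified with) pairs $(\mathcal{F},\varphi)$, where $\mathcal{F}$ is an abelian sheaf on the topological space $X$ and $\varphi:f^*\mathcal{F}\to\mathcal{F}$ is a morphism of abelian sheaves ($f^*$ the inverse image); a morphism $(\mathcal{F},\varphi)\to(\mathcal{G},\gamma)$ is $\theta:\mathcal{F}\to\mathcal{G}$ with $\theta\varphi=\gamma\circ f^*\theta$. $\mathbb{H}^i(\{X/f\},-)$ denotes sheaf cohomology, i.e. the right derived functors of global sections $(\mathcal{F},\varphi)\mapsto{\rm Hom}((\underline{\mathbb{Z}},{\rm can}),(\mathcal{F},\varphi))$, where can is the canonical isomorphism $f^*\underline{\mathbb{Z}}\cong\underline{\mathbb{Z}}$. $\mathcal{A}_X$ is the sheaf of complex-valued infinitely differentiable functions on $X$, $\mathcal{A}_X^*$ the subsheaf of $\mathbb{C}^*$-valued functions (a group under multiplication), $\underline{\mathbb{Z}}(1)=\underline{2\pi i\,\mathbb{Z}}$. Let $\mathcal{A}_\bullet=(\mathcal{A}_X,f^* )$, $\mathcal{A}_\bullet^*=(\mathcal{A}_X^*,f^* )$ with action given by the natural pullback of functions, and $\underline{\mathbb{Z}}(1)_\bullet=(\underline{\mathbb{Z}}(1),{\rm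 can})$. The natural map is the connecting homomorphism of the exponential exact sequence $0\to\underline{\mathbb{Z}}(1)_\bullet\to\mathcal{A}_\bullet\xrightarrow{\exp}\mathcal{A}_\bullet^*\to0$ on $\{X/f\}$. *)

(* Defs.v *)
From HB Require Import structures.
From mathcomp Require Import all_boot all_order all_algebra.
From mathcomp Require Import complex ring.
From mathcomp Require Import all_classical all_reals all_analysis.
Set Implicit Arguments.
Unset Strict Implicit.
Unset Printing Implicit Defensive.
Import Order.TTheory GRing.Theory Num.Theory.
Import numFieldNormedType.Exports.
Local Open Scope classical_set_scope.
Local Open Scope ring_scope.
Local Open Scope quotient_scope.

Record subgroup (V : zmodType) := Subgroup {
  in_subgroup :> V -> Prop;
  subgroup0 : in_subgroup 0;
  subgroupB : forall u v, in_subgroup u -> in_subgroup v -> in_subgroup (u - v) }.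

Definition subgroup_pred (V : zmodType) (G : subgroup V) : {pred V} :=
  fun v => `[< G v >].

Lemma subgroup_zmod_closed (V : zmodType) (G : subgroup V) :
  zmod_closed (subgroup_pred G).
Proof.
split=> [|u v /asboolP Gu /asboolP Gv]; apply/asboolP; first exact: subgroup0.
exact: subgroupB.
Qed.

HB.instance Definition _ (V : zmodType) (G : subgroup V) :=
  GRing.isZmodClosed.Build V (subgroup_pred G) (subgroup_zmod_closed G).

Record sub_elt (V : zmodType) (G : subgroup V) := SubElt {
  sub_val :> V; sub_valP : sub_val \in subgroup_pred G }.
HB.instance Definition _ V G := [isSub for @sub_val V G].
HB.instance Definition _ V G := [Choice of @sub_elt V G by <:].
HB.instance Definition _ V G := [SubChoice_isSubZmodule of @sub_elt V G by <:].

Definition quot (V : zmodType) (G : subgroup V) := Quotient.quot (subgroup_pred G).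

Lemma subgroupV (V : zmodType) (G : subgroup V) (s : sub_elt G) : G s.
Proof. by apply/asboolP; exact: sub_valP. Qed.

Definition sub_mk (V : zmodType) (G : subgroup V) (v : V) (Gv : G v) : sub_elt G :=
  SubElt (introT (asboolP (G v)) Gv).

Section DependentSections.
Variables (X : Type) (M : X -> zmodType).

Definition dsec (U : set X) := forall x, U x -> M x.

Definition dres (U V : set X) (VU : V `<=` U) (s : dsec U) : dsec V :=
  fun x h => s x (VU x h).

Lemma dsec_eqP (U : set X) (s t : dsec U) : (forall x h, s x h = t x h) -> s = t.
Proof.
move=> e; apply/functional_extensionality_dep => x.
exact/functional_extensionality_dep.
Qed.

Section Zmodule.
Variable U : set X.
Implicit Types s t u : dsec U.

Let add s t : dsec U := fun x h => s x h + t x h.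
Let opp s : dsec U := fun x h => - s x h.

Fact dsec_addA : associative add.
Proof. by move=> s t u; apply: dsec_eqP => x h; apply: addrA. Qed.
Fact dsec_addC : commutative add.
Proof. by move=> s t; apply: dsec_eqP => x h; apply: addrC. Qed.
Fact dsec_add0 : left_id (fun x h => 0) add.
Proof. by move=> s; apply: dsec_eqP => x h; apply: add0r. Qed.
Fact dsec_addN : left_inverse (fun x h => 0) opp add.
Proof. by move=> s; apply: dsec_eqP => x h; apply: addNr. Qed.

HB.instance Definition _ := gen_eqMixin (dsec U).
HB.instance Definition _ := gen_choiceMixin (dsec U).
HB.instance Definition _ :=
  GRing.isZmodule.Build (dsec U) dsec_addA dsec_addC dsec_add0 dsec_addN.
End Zmodule.

End DependentSections.

Identity Coercion fun_of_set : set >-> Funclass.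

Record opens (X : topologicalType) := Opens {
  oset :> set X; oset_open : open oset }.

Definition opens_pre (X Y : topologicalType) (f : X -> Y) (cf : continuous f)
    (U : opens Y) : opens X :=
  Opens (open_comp (fun x _ => cf x) (oset_open U)).

Definition opensI (X : topologicalType) (U V : opens X) : opens X :=
  Opens (openI (oset_open U) (oset_open V)).

Lemma opensIl (X : topologicalType) (U V : opens X) : opensI U V `<=` U.
Proof. by move=> x []. Qed.

Lemma opensIr (X : topologicalType) (U V : opens X) : opensI U V `<=` V.
Proof. by move=> x []. Qed.

Record sheaf (X : topologicalType) := Sheaf {
  sec :> opens X -> zmodType;
  res : forall U V : opens X, V `<=` U -> sec U -> sec V;
  resB : forall (U V : opens X) (VU : V `<=` U),
    {morph res VU : s t / s - t};
  res_id : forall (U : opens X) (UU : U `<=` U) s, res UU s = s;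
  res_res : forall (U V W : opens X) (VU : V `<=` U) (WV : W `<=` V)
    (WU : W `<=` U) s, res WV (res VU s) = res WU s;
  sheaf_glue : forall (U : opens X) (I : Type) (V : I -> opens X)
    (VU : forall i, V i `<=` U) (s : forall i, sec (V i)),
    (forall x, U x -> exists i, V i x) ->
    (forall i j (W : opens X) (Wi : W `<=` V i) (Wj : W `<=` V j),
       res Wi (s i) = res Wj (s j)) ->
    exists! t : sec U, forall i, res (VU i) t = s i }.

Lemma res0 (X : topologicalType) (F : sheaf X) (U V : opens X) (VU : V `<=` U) :
  @res X F U V VU 0 = 0.
Proof. by rewrite -[in LHS](subrr 0) resB subrr. Qed.

Lemma resN (X : topologicalType) (F : sheaf X) (U V : opens X) (VU : V `<=` U) :
  {morph @res X F U V VU : s / - s}.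
Proof. by move=> s; rewrite -sub0r resB res0 sub0r. Qed.

Lemma resD (X : topologicalType) (F : sheaf X) (U V : opens X) (VU : V `<=` U) :
  {morph @res X F U V VU : s t / s + t}.
Proof. by move=> s t; rewrite -[t in LHS]opprK resB resN opprK. Qed.

Record shom (X : topologicalType) (F G : sheaf X) := Shom {
  shom_fun :> forall U : opens X, F U -> G U;
  shomB : forall U : opens X, {morph @shom_fun U : s t / s - t};
  shom_res : forall (U V : opens X) (VU : V `<=` U) (s : F U),
    shom_fun (res VU s) = res VU (shom_fun s) }.
Arguments shom_fun {X F G} a U _ : rename.

Lemma shom_eqP (X : topologicalType) (F G : sheaf X) (a b : shom F G) :
  (forall U s, a U s = b U s) -> a = b.
Proof.
case: a b => [a aB ar] [b bB br] /= e.
have {e} e : a = b by do 2![apply/functional_extensionality_dep => ?]; exact: e.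
case: _ / e bB br => bB br.
by rewrite (Prop_irrelevance aB bB) (Prop_irrelevance ar br).
Qed.

Lemma shom0E (X : topologicalType) (F G : sheaf X) (a : shom F G) U : a U 0 = 0.
Proof. by rewrite -[in LHS](subrr 0) shomB subrr. Qed.

Lemma shomN (X : topologicalType) (F G : sheaf X) (a : shom F G) U :
  {morph a U : s / - s}.
Proof. by move=> s; rewrite -sub0r shomB shom0E sub0r. Qed.

Lemma shomD (X : topologicalType) (F G : sheaf X) (a : shom F G) U :
  {morph a U : s t / s + t}.
Proof. by move=> s t; rewrite -[t in LHS]opprK shomB shomN opprK. Qed.

#[local] Obligation Tactic := idtac.

Program Definition shom_comp (X : topologicalType) (F G H : sheaf X)
    (b : shom G H) (a : shom F G) : shom F H :=
  @Shom _ _ _ (fun U s => b U (a U s)) _ _.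
Next Obligation. by move=> *; move=> s t /=; rewrite !shomB. Qed.
Next Obligation. by move=> * /=; rewrite !shom_res. Qed.

Section ShomZmodule.
Variables (X : topologicalType) (F G : sheaf X).
Implicit Types a b c : shom F G.

Program Definition shom_zero : shom F G := @Shom _ _ _ (fun U s => 0) _ _.
Next Obligation. by move=> *; move=> s t /=; rewrite subr0. Qed.
Next Obligation. by move=> * /=; rewrite res0. Qed.

Program Definition shom_opp a : shom F G := @Shom _ _ _ (fun U s => - a U s) _ _.
Next Obligation. by move=> a U s t /=; rewrite shomB opprD. Qed.
Next Obligation. by move=> * /=; rewrite shom_res resN. Qed.

Program Definition shom_add a b : shom F G :=
  @Shom _ _ _ (fun U s => a U s + b U s) _ _.
Next Obligation. by move=> a b U s t /=; rewrite !shomB opprD addrACA. Qed.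
Next Obligation. by move=> * /=; rewrite !shom_res resD. Qed.

Fact shom_addA : associative shom_add.
Proof. by move=> *; apply: shom_eqP => U s; apply: addrA. Qed.
Fact shom_addC : commutative shom_add.
Proof. by move=> *; apply: shom_eqP => U s; apply: addrC. Qed.
Fact shom_add0 : left_id shom_zero shom_add.
Proof. by move=> *; apply: shom_eqP => U s; apply: add0r. Qed.
Fact shom_addN : left_inverse shom_zero shom_opp shom_add.
Proof. by move=> *; apply: shom_eqP => U s; apply: addNr. Qed.

HB.instance Definition _ := gen_eqMixin (shom F G).
HB.instance Definition _ := gen_choiceMixin (shom F G).
HB.instance Definition _ :=
  GRing.isZmodule.Build (shom F G) shom_addA shom_addC shom_add0 shom_addN.
End ShomZmodule.

Section LocalPredicate.
Variables (X : topologicalType) (M : X -> zmodType).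

(* A property of families of elements of the M x that cuts out a sheaf of
   groups: it defines a subgroup over each open set and is local. *)
Record locpred := Locpred {
  lp :> forall U : opens X, dsec M U -> Prop;
  lp0 : forall U, @lp U 0;
  lpB : forall U s t, @lp U s -> @lp U t -> @lp U (s - t);
  lp_res : forall (U V : opens X) (VU : V `<=` U) s,
    @lp U s -> @lp V (dres VU s);
  lp_loc : forall (U : opens X) (s : dsec M U),
    (forall x, U x -> exists (V : opens X) (VU : V `<=` U),
       V x /\ @lp V (dres VU s)) ->
    @lp U s }.

Variable P : locpred.

Definition lp_subgroup (U : opens X) := Subgroup (lp0 P U) (@lpB P U).

Definition lp_rest (U V : opens X) (VU : V `<=` U)
    (s : sub_elt (lp_subgroup U)) : sub_elt (lp_subgroup V) :=
  @sub_mk _ (lp_subgroup V) _ (lp_res VU (subgroupV s)).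

Lemma lp_restB (U V : opens X) (VU : V `<=` U) :
  {morph lp_rest VU : s t / s - t}.
Proof. by move=> s t; apply: val_inj. Qed.

Lemma lp_rest_id (U : opens X) (UU : U `<=` U) s : lp_rest UU s = s.
Proof.
apply: val_inj; apply: dsec_eqP => x h /=.
by rewrite /dres (Prop_irrelevance (UU x h) h).
Qed.

Lemma lp_rest_rest (U V W : opens X) (VU : V `<=` U) (WV : W `<=` V)
  (WU : W `<=` U) s : lp_rest WV (lp_rest VU s) = lp_rest WU s.
Proof.
apply: val_inj; apply: dsec_eqP => x h /=; rewrite /dres.
by rewrite (Prop_irrelevance (VU x (WV x h)) (WU x h)).
Qed.

Lemma lp_glue (U : opens X) (I : Type) (V : I -> opens X)
  (VU : forall i, V i `<=` U) (s : forall i, sub_elt (lp_subgroup (V i))) :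
  (forall x, U x -> exists i, V i x) ->
  (forall i j (W : opens X) (Wi : W `<=` V i) (Wj : W `<=` V j),
     lp_rest Wi (s i) = lp_rest Wj (s j)) ->
  exists! t : sub_elt (lp_subgroup U), forall i, lp_rest (VU i) t = s i.
Proof.
move=> cov comp.
pose ix x (h : U x) := sval (cid (cov x h)).
have ixP x (h : U x) : V (ix x h) x by rewrite /ix; case: cid.
pose t : dsec M U := fun x h => sub_val (s (ix x h)) x (ixP x h).
have tE i : dres (VU i) t = sub_val (s i).
  apply: dsec_eqP => x h; rewrite /dres /t.
  set j := ix _ _; set hj := ixP _ _.
  pose W := opensI (V j) (V i).
  have Wj : W `<=` V j by move=> y [].
  have Wi : W `<=` V i by move=> y [].
  have /(congr1 val)/= e := comp j i W Wj Wi.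
  have Wx : W x by split.
  have := congr1 (fun u : dsec M W => u x Wx) e; rewrite /dres /=.
  by rewrite (Prop_irrelevance (Wj x Wx) hj) (Prop_irrelevance (Wi x Wx) h).
have Pt : P U t.
  apply: lp_loc => x h; have [i Vix] := cov x h.
  by exists (V i), (VU i); split=> //; rewrite tE; exact: subgroupV.
exists (@sub_mk _ (lp_subgroup U) t Pt); split=> [i|t' t'E].
  by apply: val_inj; rewrite /= tE.
apply: val_inj; apply: dsec_eqP => x h /=.
have [i Vix] := cov x h.
have /(congr1 val)/= e := t'E i.
have := congr1 (fun u : dsec M (V i) => u x Vix) e.
rewrite -tE /dres.
by rewrite (Prop_irrelevance (VU i x Vix) h) => ->.
Qed.

Definition lp_sheaf : sheaf X :=
  Sheaf lp_restB lp_rest_id lp_rest_rest lp_glue.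

End LocalPredicate.

Section Stalk.
Variables (X : topologicalType) (F : sheaf X) (x : X).

Record lsec := LSec { lsec_dom : opens X; lsec_at : lsec_dom x; lsec_val : F lsec_dom }.

HB.instance Definition _ := gen_eqMixin lsec.
HB.instance Definition _ := gen_choiceMixin lsec.

Definition germ_eq (s t : lsec) : bool :=
  `[< exists (W : opens X) (Ws : W `<=` lsec_dom s) (Wt : W `<=` lsec_dom t),
        W x /\ res Ws (lsec_val s) = res Wt (lsec_val t) >].

Lemma germ_eq_equiv : equiv_class_of germ_eq.
Proof.
split=> [[U Ux s]|[U Ux s] [V Vx t]|[V Vx t] [U Ux s] [W Wx u]].
- by apply/asboolP; exists U, (@subset_refl _ _), (@subset_refl _ _).
- by apply/asboolP/asboolP => -[W [Ws [Wt [Wx e]]]]; exists W, Wt, Ws.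
- move=> /asboolP[/= A [At [As [Ax e]]]] /asboolP[/= B [Bs [Bu [Bx e']]]].
  apply/asboolP => /=; pose D := opensI A B.
  have DA : D `<=` A by move=> y [].
  have DB : D `<=` B by move=> y [].
  exists D, (subset_trans DA At), (subset_trans DB Bu); split=> //.
  rewrite -(res_res At DA) e -(res_res Bu DB) -e'.
  by rewrite (res_res As DA (subset_trans DA As)) (res_res Bs DB (subset_trans DA As)).
Qed.

Canonical germ_equiv := EquivRelPack germ_eq_equiv.

Definition stalk := {eq_quot germ_eq}.

Definition germ (U : opens X) (Ux : U x) (s : F U) : stalk := \pi_stalk (LSec Ux s).

Lemma germE (U V W : opens X) (Ux : U x) (Vx : V x) (s : F U) (t : F V)
  (WU : W `<=` U) (WV : W `<=` V) : W x ->
  res WU s = res WV t -> germ Ux s = germ Vx t.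
Proof. by move=> Wx e; apply/eqmodP/asboolP; exists W, WU, WV. Qed.
Arguments germE {U V W Ux Vx s t} WU WV _ _.

Lemma germP (U V : opens X) (Ux : U x) (Vx : V x) (s : F U) (t : F V) :
  germ Ux s = germ Vx t -> exists (W : opens X) (WU : W `<=` U) (WV : W `<=` V),
    W x /\ res WU s = res WV t.
Proof. by move/eqmodP/asboolP. Qed.

Lemma germ_res (U V : opens X) (VU : V `<=` U) (Ux : U x) (Vx : V x) (s : F U) :
  germ Vx (res VU s) = germ Ux s.
Proof.
by apply: (germE (@subset_refl _ V) VU) => //; rewrite res_id.
Qed.

Lemma germ_surj (g : stalk) : exists (U : opens X) (Ux : U x) (s : F U), g = germ Ux s.
Proof.
by exists _, (lsec_at (repr g)), (lsec_val (repr g)); rewrite /germ -[LHS]reprK; case: (repr g).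
Qed.

Lemma germ_surj2 (g g' : stalk) : exists (U : opens X) (Ux : U x) (s s' : F U),
  g = germ Ux s /\ g' = germ Ux s'.
Proof.
have [U [Ux [s ->]]] := germ_surj g; have [V [Vx [t ->]]] := germ_surj g'.
pose W := opensI U V.
have WU : W `<=` U by move=> y [].
have WV : W `<=` V by move=> y [].
exists W, (conj Ux Vx), (res WU s), (res WV t).
by rewrite !germ_res.
Qed.

Lemma germ_surj3 (g g' g'' : stalk) : exists (U : opens X) (Ux : U x) (s s' s'' : F U),
  [/\ g = germ Ux s, g' = germ Ux s' & g'' = germ Ux s''].
Proof.
have [U [Ux [s [s' [-> ->]]]]] := germ_surj2 g g'.
have [V [Vx [t ->]]] := germ_surj g''.
pose W := opensI U V.
have WU : W `<=` U by move=> y [].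
have WV : W `<=` V by move=> y [].
exists W, (conj Ux Vx), (res WU s), (res WU s'), (res WV t).
by rewrite !germ_res.
Qed.

Definition stalk_zero : stalk := germ (U := Opens openT) I 0.
Definition stalk_opp (g : stalk) : stalk :=
  germ (lsec_at (repr g)) (- lsec_val (repr g)).
Definition stalk_add (g g' : stalk) : stalk :=
  let U := lsec_dom (repr g) in let U' := lsec_dom (repr g') in
  germ (U := opensI U U') (conj (lsec_at (repr g)) (lsec_at (repr g')))
    (res (@opensIl _ U U') (lsec_val (repr g)) +
     res (@opensIr _ U U') (lsec_val (repr g'))).

Lemma germ_reprP (U : opens X) (Ux : U x) (s : F U) : let r := repr (germ Ux s) in
  exists (W : opens X) (Wr : W `<=` lsec_dom r) (WU : W `<=` U),
    W x /\ res Wr (lsec_val r) = res WU s.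
Proof.
move=> r; apply: (@germP _ _ (lsec_at r) Ux).
by rewrite /germ -[RHS]reprK -/(germ _ _) -/r; case: r.
Qed.

Lemma germN (U : opens X) (Ux : U x) (s : F U) : stalk_opp (germ Ux s) = germ Ux (- s).
Proof.
have [W [Wr [WU [Wx e]]]] := germ_reprP Ux s.
by apply: (germE Wr WU) => //; rewrite !resN e.
Qed.

Lemma germD (U : opens X) (Ux : U x) (s t : F U) :
  stalk_add (germ Ux s) (germ Ux t) = germ Ux (s + t).
Proof.
have [A [Ar [AU [Ax e]]]] := germ_reprP Ux s.
have [B [Br [BU [Bx e']]]] := germ_reprP Ux t.
rewrite /stalk_add.
pose W := opensI A B.
have WA : W `<=` A by move=> y [].
have WB : W `<=` B by move=> y [].
have WU := subset_trans WA AU.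
have Wr := subset_trans WA Ar.
have Wr' := subset_trans WB Br.
have WI : W `<=` opensI (lsec_dom (repr (germ Ux s))) (lsec_dom (repr (germ Ux t))).
  by move=> y [yA yB]; split; [exact: (Ar y yA)|exact: (Br y yB)].
apply: (germE WI WU) => //; rewrite !resD.
rewrite (res_res _ WI Wr) (res_res _ WI Wr').
rewrite -(res_res Ar WA Wr) e -(res_res Br WB Wr') e'.
by rewrite (res_res AU WA WU) (res_res BU WB WU).
Qed.

Lemma germ0 (U : opens X) (Ux : U x) : germ Ux 0 = stalk_zero.
Proof.
have UT : U `<=` Opens (@openT X) by [].
by rewrite -(res0 F UT); exact: germ_res.
Qed.

Fact stalk_addA : associative stalk_add.
Proof.
move=> g g' g''; have [U [Ux [s [s' [s'' [-> -> ->]]]]]] := germ_surj3 g g' g''.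
by rewrite !germD addrA.
Qed.
Fact stalk_addC : commutative stalk_add.
Proof.
move=> g g'; have [U [Ux [s [s' [-> ->]]]]] := germ_surj2 g g'.
by rewrite !germD addrC.
Qed.
Fact stalk_add0 : left_id stalk_zero stalk_add.
Proof.
move=> g; have [U [Ux [s ->]]] := germ_surj g.
by rewrite -(germ0 Ux) germD add0r.
Qed.
Fact stalk_addN : left_inverse stalk_zero stalk_opp stalk_add.
Proof.
move=> g; have [U [Ux [s ->]]] := germ_surj g.
by rewrite -(germ0 Ux) germN germD addNr.
Qed.

HB.instance Definition _ := Choice.on stalk.
HB.instance Definition _ :=
  GRing.isZmodule.Build stalk stalk_addA stalk_addC stalk_add0 stalk_addN.

Lemma germB (U : opens X) (Ux : U x) (s t : F U) :
  germ Ux (s - t) = germ Ux s - germ Ux t.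
Proof. by rewrite -germD -germN. Qed.

End Stalk.
Arguments germ {X F x U} Ux s.
Arguments germE {X F x U V W Ux Vx s t} WU WV _ _.

Definition stalk_map (X : topologicalType) (F G : sheaf X) (a : shom F G) (x : X)
    (g : stalk F x) : stalk G x :=
  germ (lsec_at (repr g)) (a _ (lsec_val (repr g))).

Lemma stalk_map_germ (X : topologicalType) (F G : sheaf X) (a : shom F G) (x : X)
  (U : opens X) (Ux : U x) (s : F U) : stalk_map a (germ Ux s) = germ Ux (a U s).
Proof.
have [W [Wr [WU [Wx e]]]] := germ_reprP Ux s.
by apply: (germE Wr WU) => //; rewrite -!shom_res e.
Qed.

Lemma stalk_mapB (X : topologicalType) (F G : sheaf X) (a : shom F G) (x : X) :
  {morph stalk_map a (x := x) : g h / g - h}.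
Proof.
move=> g h; have [U [Ux [s [t [-> ->]]]]] := germ_surj2 g h.
by rewrite -germB !stalk_map_germ shomB germB.
Qed.

Section InverseImage.
Variables (X Y : topologicalType) (f : X -> Y).

(* A section of the inverse image over V is a family of germs of F at the points
   f x, x in V, that is locally induced by sections of F. *)
Definition inv_image_lp (F : sheaf Y) (V : opens X)
    (s : dsec (fun x => stalk F (f x)) V) : Prop :=
  forall x, V x -> exists (N : opens X) (U : opens Y) (NV : N `<=` V)
    (NU : forall y, N y -> U (f y)) (t : F U),
    N x /\ forall y (Ny : N y), s y (NV y Ny) = germ (NU y Ny) t.

Program Definition inv_image_locpred (F : sheaf Y) :=
  @Locpred X (fun x => stalk F (f x)) (@inv_image_lp F) _ _ _ _.
Next Obligation.
move=> F V x Vx; have VT : forall y, V y -> Opens (@openT Y) (f y) by [].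
by exists V, (Opens openT), (@subset_refl _ V), VT, 0; split=> // y Vy; rewrite germ0.
Qed.
Next Obligation.
move=> F V s t Ps Pt x Vx.
have [N [U [NV [NU [u [Nx e]]]]]] := Ps x Vx.
have [N' [U' [NV' [NU' [u' [Nx' e']]]]]] := Pt x Vx.
pose O := opensI N N'; pose Q := opensI U U'.
have ON : O `<=` N by move=> y [].
have ON' : O `<=` N' by move=> y [].
have QU : Q `<=` U by move=> y [].
have QU' : Q `<=` U' by move=> y [].
have OV := subset_trans ON NV.
have OQ : forall y, O y -> Q (f y).
  by move=> y [yN yN']; split; [exact: (NU y yN)|exact: (NU' y yN')].
exists O, Q, OV, OQ, (res QU u - res QU' u'); split=> // y Oy.
rewrite germB -[LHS]/(s y (OV y Oy) - t y (OV y Oy)).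
congr (_ - _).
  by rewrite (Prop_irrelevance (OV y Oy) (NV y (ON y Oy))) e (germ_res _ (NU y (ON y Oy))).
rewrite (Prop_irrelevance (OV y Oy) (NV' y (ON' y Oy))) e'.
by rewrite (germ_res _ (NU' y (ON' y Oy))).
Qed.
Next Obligation.
move=> F U V VU s Ps x Vx.
have [N [Q [NU [NQ [t [Nx e]]]]]] := Ps x (VU x Vx).
pose O := opensI N V.
have ON : O `<=` N by move=> y [].
have OV : O `<=` V by move=> y [].
exists O, Q, OV, (fun y Oy => NQ y (ON y Oy)), t; split=> // y Oy.
rewrite /dres (Prop_irrelevance (VU y (OV y Oy)) (NU y (ON y Oy))) e.
by congr germ; exact: Prop_irrelevance.
Qed.
Next Obligation.
move=> F U s h x Ux; have [V [VU [Vx Ps]]] := h x Ux.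
have [N [Q [NV [NQ [t [Nx e]]]]]] := Ps x Vx.
exists N, Q, (subset_trans NV VU), NQ, t; split=> // y Ny.
by rewrite -e /dres; congr s; exact: Prop_irrelevance.
Qed.

Definition inv_image (F : sheaf Y) : sheaf X := lp_sheaf (inv_image_locpred F).

Section OnMorphisms.
Variables (F G : sheaf Y) (a : shom F G).

Definition inv_image_hom_fun (V : opens X) (s : inv_image F V) :
    dsec (fun x => stalk G (f x)) V :=
  fun x Vx => stalk_map a (sub_val s x Vx).

Lemma inv_image_hom_lp (V : opens X) (s : inv_image F V) :
  inv_image_lp (inv_image_hom_fun s).
Proof.
move=> x Vx; have [N [U [NV [NU [t [Nx e]]]]]] := subgroupV s x Vx.
exists N, U, NV, NU, (a U t); split=> // y Ny.
by rewrite /inv_image_hom_fun e stalk_map_germ.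
Qed.

Program Definition inv_image_hom : shom (inv_image F) (inv_image G) :=
  @Shom _ (inv_image F) (inv_image G)
    (fun V s => @sub_mk _ (lp_subgroup (inv_image_locpred G) V) _ (inv_image_hom_lp s)) _ _.
Next Obligation.
move=> V s t; apply: val_inj; apply: dsec_eqP => x Vx.
exact: stalk_mapB.
Qed.
Next Obligation. by move=> U V VU s; apply: val_inj. Qed.

End OnMorphisms.

Lemma inv_image_homB (F G : sheaf Y) (a b : shom F G) :
  inv_image_hom (a - b) = inv_image_hom a - inv_image_hom b.
Proof.
apply: shom_eqP => V s; apply: val_inj; apply: dsec_eqP => x Vx.
rewrite -[RHS]/(stalk_map a (sub_val s x Vx) - stalk_map b (sub_val s x Vx)).
rewrite -[LHS]/(stalk_map (a - b) (sub_val s x Vx)).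
have [U [Ux [t ->]]] := germ_surj (sub_val s x Vx).
by rewrite !stalk_map_germ -germB.
Qed.

Lemma inv_image_hom_comp (F G H : sheaf Y) (b : shom G H) (a : shom F G) :
  inv_image_hom (shom_comp b a) = shom_comp (inv_image_hom b) (inv_image_hom a).
Proof.
apply: shom_eqP => V s; apply: val_inj; apply: dsec_eqP => x Vx /=.
rewrite /inv_image_hom_fun /=.
rewrite -[RHS]/(stalk_map b (stalk_map a (sub_val s x Vx))).
have [U [Ux [t ->]]] := germ_surj (sub_val s x Vx).
by rewrite !stalk_map_germ.
Qed.

End InverseImage.

Section SelfMapSheaves.
Variables (X : topologicalType) (f : X -> X).

(* Abelian sheaves on {X/f}: pairs (F, phi : f^* F -> F). *)
Record fsheaf := FSheaf {
  fsheaf_sheaf :> sheaf X;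
  fsheaf_act : shom (inv_image f fsheaf_sheaf) fsheaf_sheaf }.

Definition fhom_comm (F G : fsheaf) (a : shom F G) : Prop :=
  shom_comp a (fsheaf_act F) = shom_comp (fsheaf_act G) (inv_image_hom f a).

Lemma fhom_comm0 (F G : fsheaf) : @fhom_comm F G 0.
Proof.
rewrite /fhom_comm -[X in inv_image_hom f X](subrr 0) inv_image_homB subrr.
apply: shom_eqP => U s; rewrite -[LHS]/0 -[RHS]/(fsheaf_act G U 0).
by rewrite shom0E.
Qed.

Lemma fhom_commB (F G : fsheaf) (a b : shom F G) :
  fhom_comm a -> fhom_comm b -> fhom_comm (a - b).
Proof.
rewrite /fhom_comm => ea eb; rewrite inv_image_homB.
have lB : shom_comp (a - b) (fsheaf_act F) =
    shom_comp a (fsheaf_act F) - shom_comp b (fsheaf_act F) by exact: shom_eqP.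
rewrite lB ea eb; apply: shom_eqP => U s.
by rewrite -[RHS]/(fsheaf_act G U (_ - _)) shomB.
Qed.

Definition fhom_subgroup (F G : fsheaf) : subgroup (shom F G) :=
  Subgroup (@fhom_comm0 F G) (@fhom_commB F G).

Definition fhom (F G : fsheaf) := sub_elt (fhom_subgroup F G).

Lemma fcomp_comm (F G H : fsheaf) (b : fhom G H) (a : fhom F G) :
  @fhom_comm F H (shom_comp (sub_val b) (sub_val a)).
Proof.
have /= ea := subgroupV a; have /= eb := subgroupV b.
rewrite /fhom_comm inv_image_hom_comp.
have assoc A B C D (w : shom C D) (v : shom B C) (u : shom A B) :
  shom_comp w (shom_comp v u) = shom_comp (shom_comp w v) u by exact: shom_eqP.
by rewrite -assoc ea assoc eb assoc.
Qed.

Definition fcomp (F G H : fsheaf) (b : fhom G H) (a : fhom F G) : fhom F H :=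
  @sub_mk _ (fhom_subgroup F H) _ (fcomp_comm b a).

Lemma fcompBr (F G H : fsheaf) (b : fhom G H) (a a' : fhom F G) :
  fcomp b (a - a') = fcomp b a - fcomp b a'.
Proof.
apply: val_inj; apply: shom_eqP => U s.
exact: (@shomB _ _ _ (sub_val b)).
Qed.

Lemma fcompr0 (F G H : fsheaf) (b : fhom G H) : fcomp b (0 : fhom F G) = 0.
Proof. by rewrite -[in LHS](subrr 0) fcompBr subrr. Qed.

Definition sheaf_inj (F G : sheaf X) (a : shom F G) : Prop :=
  forall U : opens X, injective (a U).

Definition locally_in_image (F G : sheaf X) (a : shom F G) (U : opens X) (t : G U) :=
  forall x, U x -> exists (V : opens X) (VU : V `<=` U) (s : F V),
    V x /\ a V s = res VU t.

Definition sheaf_surj (F G : sheaf X) (a : shom F G) : Prop :=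
  forall (U : opens X) (t : G U), locally_in_image a t.

Definition sheaf_exact (F G H : sheaf X) (a : shom F G) (b : shom G H) : Prop :=
  forall (U : opens X) (t : G U), b U t = 0 <-> locally_in_image a t.

Definition short_exact (F G H : fsheaf) (a : fhom F G) (b : fhom G H) : Prop :=
  [/\ sheaf_inj (sub_val a), sheaf_exact (sub_val a) (sub_val b) &
      sheaf_surj (sub_val b)].

(* Monomorphisms of sheaves are the maps that are injective on sections. *)
Definition injective_fsheaf (J : fsheaf) : Prop :=
  forall (A B : fsheaf) (m : fhom A B), sheaf_inj (sub_val m) ->
  forall h : fhom A J, exists k : fhom B J, fcomp k m = h.

Record inj_resolution (F : fsheaf) := InjResolution {
  ires :> nat -> fsheaf;
  iaug : fhom F (ires 0);
  idif : forall n, fhom (ires n) (ires n.+1);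
  ires_injective : forall n, injective_fsheaf (ires n);
  iaug_inj : sheaf_inj (sub_val iaug);
  iaug_exact : sheaf_exact (sub_val iaug) (sub_val (idif 0));
  idif_exact : forall n, sheaf_exact (sub_val (idif n)) (sub_val (idif n.+1)) }.

Lemma idif_idif (F : fsheaf) (J : inj_resolution F) (Z : fsheaf) n
  (a : fhom Z (J n)) : fcomp (idif J n.+1) (fcomp (idif J n) a) = 0.
Proof.
apply: val_inj; apply: shom_eqP => U s.
apply/(@idif_exact F J n) => x Ux.
by exists U, (@subset_refl _ U), (sub_val a U s); rewrite res_id.
Qed.

(* Right derived functors of Hom(Z, -), computed on an injective resolution J:
   the cohomology of the complex Hom(Z, J 0) -> Hom(Z, J 1) -> ... *)
Section RightDerived.
Variables (Z F : fsheaf) (J : inj_resolution F).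

Program Definition cocycles n : subgroup (fhom Z (J n)) :=
  @Subgroup _ (fun a => fcomp (idif J n) a = 0) _ _.
Next Obligation. by move=> n; exact: fcompr0. Qed.
Next Obligation. by move=> n u v /= eu ev; rewrite fcompBr eu ev subrr. Qed.

Definition is_coboundary n : fhom Z (J n) -> Prop :=
  match n with
  | 0 => fun a => a = 0
  | m.+1 => fun a => exists b : fhom Z (J m), fcomp (idif J m) b = a
  end.

Program Definition coboundaries n : subgroup (sub_elt (cocycles n)) :=
  @Subgroup _ (fun a => is_coboundary (sub_val a)) _ _.
Next Obligation.
by case=> [//|n]; exists 0; exact: fcompr0.
Qed.
Next Obligation.
case=> [|n] u v /=; first by move=> -> ->; rewrite subrr.
by move=> [b eb] [c ec]; exists (b - c); apply: etrans (fcompBr _ _ _) _; rewrite eb ec.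
Qed.

Definition derived_hom n := quot (coboundaries n).

Definition hclass n (a : sub_elt (cocycles n)) : derived_hom n :=
  \pi_(derived_hom n) a.

End RightDerived.

(* A short exact sequence of injective resolutions of A, B, C lifting the
   sequence A -> B -> C. *)
Record ses_resolution (A B C : fsheaf) (i : fhom A B) (p : fhom B C) :=
  SesResolution {
  sesA : inj_resolution A;
  sesB : inj_resolution B;
  sesC : inj_resolution C;
  ses_i : forall n, fhom (sesA n) (sesB n);
  ses_p : forall n, fhom (sesB n) (sesC n);
  ses_exact : forall n, short_exact (ses_i n) (ses_p n);
  ses_i_aug : fcomp (ses_i 0) (iaug sesA) = fcomp (iaug sesB) i;
  ses_p_aug : fcomp (ses_p 0) (iaug sesB) = fcomp (iaug sesC) p;
  ses_i_dif : forall n,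
    fcomp (ses_i n.+1) (idif sesA n) = fcomp (idif sesB n) (ses_i n);
  ses_p_dif : forall n,
    fcomp (ses_p n.+1) (idif sesB n) = fcomp (idif sesC n) (ses_p n) }.

Section Connecting.
Variables (Z A B C : fsheaf) (i : fhom A B) (p : fhom B C).
Variable S : ses_resolution i p.

(* snake h k: k is obtained from h by lifting a cocycle c of h through p, applying
   the differential and pulling back through i.  The objects sesA n being
   injective, this relation is the graph of a homomorphism. *)
Definition snake n (h : derived_hom Z (sesC S) n) (k : derived_hom Z (sesA S) n.+1) :=
  exists (c : sub_elt (cocycles Z (sesC S) n)) (b : fhom Z (sesB S n))
         (a : sub_elt (cocycles Z (sesA S) n.+1)),
    [/\ h = hclass c, fcomp (ses_p S n) b = sub_val c,
        fcomp (ses_i S n.+1) (sub_val a) = fcomp (idif (sesB S) n) b &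
        k = hclass a].

(* xget 0 selects the k with snake h k. *)
Definition connecting n (h : derived_hom Z (sesC S) n) :
  derived_hom Z (sesA S) n.+1 := xget 0 (snake h).

End Connecting.

End SelfMapSheaves.

Section Calculus.
Variable R : realType.

(* C^k on an open set: for k > 0, Frechet differentiable with all directional
   derivatives of class C^(k-1). *)
Fixpoint Ck (V : normedModType R) (k : nat) (U : set V) (g : V -> R) : Prop :=
  match k with
  | 0 => forall x, U x -> {for x, continuous g}
  | k'.+1 => (forall x, U x -> differentiable g x) /\
             (forall v, Ck k' U ('D_v g))
  end.

Definition smooth (V : normedModType R) (U : set V) (g : V -> R) : Prop :=
  forall k, Ck k U g.

Lemma near_differentiable (V W : normedModType R) (g h : V -> W) (x : V) :
  (\forall y \near x, g y = h y) -> differentiable g x -> differentiable h x.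
Proof.
move=> gh dg; have gxhx : g x = h x by exact: (nbhs_singleton gh).
have [cdg /eqaddoP og] := proj1 (diff_locallyP _ _) dg.
have oh : h \o shift x = cst (h x) + 'd g x +o_ 0 id.
  apply/eqaddoP => e e0; have := og e e0.
  have gh0 : \forall y \near (0 : V), g (y + x) = h (y + x).
    by have := gh; rewrite (near_shift 0); apply: filterS => y; rewrite /= subr0.
  apply: filterS2 gh0 => y ghy; rewrite /= !fctE /= -gxhx.
  by rewrite [h _]/= -ghy.
have dE := diff_unique cdg oh.
apply/diff_locallyP; rewrite dE; split=> //.
Qed.

Section V.
Variable V : normedModType R.
Implicit Types (U : set V) (g h : V -> R).

Lemma Ck_sub k U U' g : U' `<=` U -> Ck k U g -> Ck k U' g.
Proof.
move=> UU; elim: k g => [|k IH] g /=; first by move=> H x /UU /H.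
move=> [d H]; split=> [x Ux|v]; last exact: IH.
exact: (d x (UU x Ux)).
Qed.

Lemma CkW k U g : Ck k.+1 U g -> Ck k U g.
Proof.
elim: k g => [|k IH] g [d H]; last by split=> // v; apply: IH; exact: (H v).
by move=> x Ux; apply: differentiable_continuous; exact: d.
Qed.

Lemma Ck_leq j k U g :
  (j <= k)%N -> Ck k U g -> Ck j U g.
Proof.
elim: k => [|k IH]; first by rewrite leqn0 => /eqP->.
by rewrite leq_eqVlt => /orP[/eqP->//|jk] /CkW; exact: IH.
Qed.

Lemma Ck_local k U g :
  (forall x, U x -> exists B : set V, B x /\ Ck k B g) -> Ck k U g.
Proof.
elim: k g => [|k IH] g H /=.
  by move=> x Ux; have [B [Bx c]] := H x Ux; exact: c.
split=> [x Ux|v]; first by have [B [Bx [d _]]] := H x Ux; exact: d.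
by apply: IH => x Ux; have [B [Bx [_ d]]] := H x Ux; exists B; split=> //; exact: d.
Qed.

Lemma Ck_ext k U g h : open U -> {in U, g =1 h} -> Ck k U g -> Ck k U h.
Proof.
move=> oU; elim: k g h => [|k IH] g h e /=.
  move=> c x Ux; have gx := c x Ux.
  have e' : \forall y \near x, g y = h y.
    by apply: filterS (open_nbhs_nbhs (conj oU Ux)) => y Uy; apply: e; rewrite inE.
  have hx : g x = h x by exact: e (mem_set Ux).
  rewrite /prop_for /continuous_at in gx *; rewrite -hx.
  by apply: cvg_trans gx; exact: near_eq_cvg.
move=> [d D]; have e' x : U x -> \forall y \near x, g y = h y.
  by move=> Ux; apply: filterS (open_nbhs_nbhs (conj oU Ux)) => y Uy; apply: e; rewrite inE.
split=> [x Ux|v]; first exact: near_differentiable (e' x Ux) (d x Ux).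
apply: (IH ('D_v g)) => // x; rewrite inE => Ux.
by have [->] := (near_eq_derive v (e' x Ux), tt).
Qed.

Lemma Ck_cst k U (a : R) : Ck k U (cst a).
Proof.
elim: k a => [|k IH] a /=; first by move=> x _; exact: cst_continuous.
split=> [x _|v]; first exact: differentiable_cst.
rewrite (_ : 'D_v (cst a) = cst 0); first exact: IH.
by apply/funext => x; rewrite derive_cst.
Qed.

Lemma CkD k U g h : open U -> Ck k U g -> Ck k U h -> Ck k U (fun x => g x + h x).
Proof.
move=> oU; elim: k g h => [|k IH] g h /=.
  by move=> cg ch x Ux; apply: continuousD; [exact: cg|exact: ch].
move=> [dg Dg] [dh Dh]; split=> [x Ux|v].
  by apply: differentiableD; [exact: dg|exact: dh].
apply: (Ck_ext oU) (IH _ _ (Dg v) (Dh v)) => x; rewrite inE => Ux.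
by rewrite /= -deriveD //; apply: diff_derivable; [exact: dg|exact: dh].
Qed.

Lemma CkM k U g h : open U -> Ck k U g -> Ck k U h -> Ck k U (fun x => g x * h x).
Proof.
move=> oU; elim: k g h => [|k IH] g h /=.
  by move=> cg ch x Ux; apply: continuousM; [exact: cg|exact: ch].
move=> [dg Dg] [dh Dh]; split=> [x Ux|v].
  by apply: differentiableM; [exact: dg|exact: dh].
have Cg : Ck k U g by apply: CkW; split.
have Ch : Ck k U h by apply: CkW; split.
apply: (Ck_ext oU) (CkD oU (IH _ _ Cg (Dh v)) (IH _ _ Ch (Dg v))) => x; rewrite inE => Ux.
by rewrite deriveM //; apply: diff_derivable; [exact: dg|exact: dh].
Qed.

Lemma CkN k U g : open U -> Ck k U g -> Ck k U (fun x => - g x).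
Proof.
move=> oU Cg; apply: (Ck_ext oU) (CkM oU (Ck_cst k U (-1)) Cg) => x _.
by rewrite /= mulN1r.
Qed.

Lemma CkV k U g : open U -> (forall x, U x -> g x != 0) ->
  Ck k U g -> Ck k U (fun x => (g x)^-1).
Proof.
move=> oU g0; elim: k => [|k IH] /=.
  by move=> cg x Ux; apply: continuousV; [exact: g0|exact: cg].
move=> [dg Dg]; split=> [x Ux|v].
  by apply: differentiableV; [exact: dg|exact: g0].
have Cg : Ck k U (fun x => (g x)^-1) by apply: IH; apply: CkW; split.
apply: (Ck_ext oU) (CkN oU (CkM oU (CkM oU Cg Cg) (Dg v))) => x; rewrite inE => Ux.
rewrite deriveV ?g0 //; last by apply: diff_derivable; exact: dg.
by rewrite scaleNr /= -exprVn expr2.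
Qed.

Lemma Ck_comp1 k U g (F F' : R -> R) : open U ->
  (forall y : R, is_derive y (1 : R) F (F' y)) ->
  (forall j, (j < k)%N -> Ck j U (F' \o g)) ->
  Ck k U g -> Ck k U (F \o g).
Proof.
move=> oU dF; case: k => [|k] HF' /=.
  move=> cg x Ux; apply: continuous_comp; first exact: cg.
  apply: differentiable_continuous; apply/derivable1_diffP.
  by have [] := dF (g x).
move=> [dg Dg].
have dFx (y : R) : differentiable F y by apply/derivable1_diffP; have [] := dF y.
split=> [x Ux|v]; first by apply: differentiable_comp; [exact: dg|exact: dFx].
apply: (Ck_ext oU) (CkM oU (HF' k _) (Dg v)) => // x; rewrite inE => Ux.
have dgx := dg x Ux.
rewrite [RHS]deriveE; last by apply: differentiable_comp.
rewrite diff_comp // /= -[X in 'd F _ X]deriveE // deriv1E; last by have [] := dF (g x).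
by rewrite derive1E derive_val mulrC.
Qed.

Lemma Ck_expR k U g : open U -> Ck k U g -> Ck k U (expR \o g).
Proof.
move=> oU; elim/ltn_ind: k g => k IH g Cg.
apply: (Ck_comp1 (F' := expR)) => // j jk; apply: IH => //.
exact: Ck_leq (ltnW jk) Cg.
Qed.

End V.

Lemma Ck_sin_cos (V : normedModType R) k (U : set V) (g : V -> R) : open U -> Ck k U g ->
  Ck k U (sin \o g) /\ Ck k U (cos \o g).
Proof.
move=> oU; elim/ltn_ind: k => k IH Cg; split.
  apply: (Ck_comp1 (F' := cos)) => // j jk.
  by have [] := IH j jk (Ck_leq (ltnW jk) Cg).
apply: (Ck_comp1 (F' := fun x => - sin x)) => // j jk.
have [Cs _] := IH j jk (Ck_leq (ltnW jk) Cg).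
exact: CkN Cs.
Qed.

Lemma Ck_comp (V : normedModType R) p k (U : set V) (W : set 'rV[R]_p)
  (g : 'rV[R]_p -> R) (h : V -> 'rV[R]_p) : open U -> open W ->
  (forall x, U x -> W (h x)) ->
  (forall j, Ck k U (fun x => h x 0 j)) -> Ck k W g -> Ck k U (g \o h).
Proof.
move=> oU oW UW; elim: k g => [|k IH] g Ch Cg /=.
  move=> x Ux; apply: continuous_comp; last by apply: Cg; exact: UW.
  have -> : h = fun y => \sum_j h y 0 j *: delta_mx 0 j.
    by apply/funext => y; rewrite [LHS]row_sum_delta.
  by apply: cvg_big => // [|j _]; [exact: add_continuous|apply: cvgZr_tmp; exact: Ch].
have dh x : U x -> differentiable h x.
  move=> Ux.
  have -> : h = \sum_j (fun y => h y 0 j *: (delta_mx 0 j : 'rV[R]_p)).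
    by apply/funext => y; rewrite fct_sumE [LHS]row_sum_delta.
  by apply: differentiable_sum => j; apply: differentiableZl; exact: (Ch j).1.
case: Cg => dg Dg; split=> [x Ux|v].
  by apply: differentiable_comp; [exact: dh|apply: dg; exact: UW].
pose D x := \sum_j 'D_v (fun y => h y 0 j) x * 'D_(delta_mx 0 j) g (h x).
suff : Ck k U D.
  apply: Ck_ext => // x; rewrite inE => Ux.
  have dhx := dh x Ux; have dgx := dg _ (UW x Ux).
  rewrite [RHS]deriveE; last exact: differentiable_comp.
  rewrite diff_comp // /= -[X in 'd g _ X]deriveE // derive_mx; last exact: diff_derivable.
  rewrite [X in 'd g _ X]row_sum_delta linear_sum; apply: eq_bigr => j _.
  by rewrite linearZ /= mxE [X in _ * X]deriveE.
rewrite /D; elim: (index_enum _) => [|j s IHs].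
  by under eq_fun do rewrite big_nil; exact: Ck_cst.
under eq_fun do rewrite big_cons; apply: CkD => //; apply: CkM => //.
  exact: (Ch j).2.
by apply: (IH ('D_(delta_mx 0 j) g)); [move=> i; apply: CkW; exact: Ch|exact: Dg].
Qed.

End Calculus.

Section FunctionSheaves.
Variables (X : topologicalType) (f : X -> X) (cf : continuous f).

(* A sheaf of M-valued functions that is stable under pullback by f. *)
Record funpred (M : zmodType) := Funpred {
  fp_lp :> locpred (fun _ : X => M);
  fp_pull : forall (U : opens X) (s : dsec (fun _ => M) U), fp_lp U s ->
    fp_lp (opens_pre cf U) (fun x h => s (f x) h) }.

Section OneSheaf.
Variables (M : zmodType) (P : funpred M).

Definition germ_value (y : X) (g : stalk (lp_sheaf P) y) : M :=
  sub_val (lsec_val (repr g)) y (lsec_at (repr g)).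

Lemma germ_value_germ (y : X) (U : opens X) (Uy : U y) (s : lp_sheaf P U) :
  germ_value (germ Uy s) = sub_val s y Uy.
Proof.
have [W [Wr [WU [Wy /(congr1 val)/= e]]]] := germ_reprP Uy s.
have := congr1 (fun u : dsec (fun _ : X => M) W => u y Wy) e; rewrite /dres /=.
rewrite /germ_value (Prop_irrelevance (Wr y Wy) (lsec_at _)) => ->.
by congr (sub_val s y); exact: Prop_irrelevance.
Qed.

Lemma germ_valueB (y : X) : {morph @germ_value y : g h / g - h}.
Proof.
move=> g h; have [U [Uy [s [t [-> ->]]]]] := germ_surj2 g h.
by rewrite -germB !germ_value_germ.
Qed.

(* The natural pullback of functions, s |-> s \o f, on sections of f^* P. *)
Definition pullback_fun (V : opens X) (s : inv_image f (lp_sheaf P) V) :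
    dsec (fun _ => M) V :=
  fun x Vx => germ_value (sub_val s x Vx).

Lemma pullback_fun_lp (V : opens X) (s : inv_image f (lp_sheaf P) V) :
  P V (pullback_fun s).
Proof.
apply: lp_loc => x Vx; have [N [U [NV [NU [t [Nx e]]]]]] := subgroupV s x Vx.
exists N, NV; split=> //.
rewrite (_ : dres NV _ = dres (V := N) (NU : N `<=` opens_pre cf U)
  (fun y h => sub_val t (f y) h : M)).
  by apply: lp_res; apply: fp_pull; exact: subgroupV.
by apply: dsec_eqP => y Ny; rewrite /dres /pullback_fun e germ_value_germ.
Qed.

Program Definition pullback_hom : shom (inv_image f (lp_sheaf P)) (lp_sheaf P) :=
  @Shom _ (inv_image f (lp_sheaf P)) (lp_sheaf P)
    (fun V s => @sub_mk _ (lp_subgroup P V) _ (pullback_fun_lp s)) _ _.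
Next Obligation.
move=> V s t; apply: val_inj; apply: dsec_eqP => x Vx; exact: germ_valueB.
Qed.
Next Obligation. by move=> U V VU s; apply: val_inj. Qed.

Definition fun_fsheaf : fsheaf f := FSheaf pullback_hom.

End OneSheaf.

Section Morphism.
Variables (M N : zmodType) (P : funpred M) (Q : funpred N) (phi : M -> N).
Hypothesis phiB : {morph phi : a b / a - b}.
Hypothesis PQ : forall (U : opens X) (s : dsec (fun _ => M) U),
  P U s -> Q U (fun x h => phi (s x h)).

Program Definition fun_shom : shom (lp_sheaf P) (lp_sheaf Q) :=
  @Shom _ (lp_sheaf P) (lp_sheaf Q)
    (fun U s => @sub_mk _ (lp_subgroup Q U) _ (PQ (subgroupV s))) _ _.
Next Obligation.
move=> U s t; apply: val_inj; apply: dsec_eqP => x Ux; exact: phiB.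
Qed.
Next Obligation. by move=> U V VU s; apply: val_inj. Qed.

Lemma fun_shom_comm : @fhom_comm X f (fun_fsheaf P) (fun_fsheaf Q) fun_shom.
Proof.
apply: shom_eqP => V s; apply: val_inj; apply: dsec_eqP => x Vx.
rewrite -[LHS]/(phi (germ_value (sub_val s x Vx))).
rewrite -[RHS]/(germ_value (stalk_map fun_shom (sub_val s x Vx))).
have [U [Ux [t ->]]] := germ_surj (sub_val s x Vx).
by rewrite stalk_map_germ !germ_value_germ.
Qed.

Definition fun_fhom : fhom (fun_fsheaf P) (fun_fsheaf Q) :=
  @sub_mk _ (fhom_subgroup (fun_fsheaf P) (fun_fsheaf Q)) _ fun_shom_comm.

End Morphism.

Section Constant.
Variable M : zmodType.

Definition locally_constant (U : opens X) (s : dsec (fun _ : X => M) U) : Prop :=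
  forall x (Ux : U x), exists (V : opens X) (VU : V `<=` U),
    V x /\ forall y (Vy : V y), s y (VU y Vy) = s x Ux.

Program Definition const_locpred := @Locpred X _ locally_constant _ _ _ _.
Next Obligation. by move=> U x Ux; exists U, (@subset_refl _ U). Qed.
Next Obligation.
move=> U s t cs ct x Ux.
have [V [VU [Vx e]]] := cs x Ux; have [W [WU [Wx e']]] := ct x Ux.
exists (opensI V W), (subset_trans (@opensIl _ V W) VU); split=> // y [Vy Wy].
rewrite -[LHS]/(s y _ - t y _) -[RHS]/(s x Ux - t x Ux) -(e y Vy) -(e' y Wy).
by congr (s y _ - t y _); exact: Prop_irrelevance.
Qed.
Next Obligation.
move=> U V VU s cs x Vx; have [W [WU [Wx e]]] := cs x (VU x Vx).
exists (opensI W V), (@opensIr _ W V); split=> // y [Wy Vy].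
by rewrite /dres -(e y Wy); congr s; exact: Prop_irrelevance.
Qed.
Next Obligation.
move=> U s h x Ux; have [V [VU [Vx cs]]] := h x Ux.
have [W [WV [Wx e]]] := cs x Vx.
exists W, (subset_trans WV VU); split=> // y Wy.
have := e y Wy; rewrite /dres (Prop_irrelevance (VU x Vx) Ux) => <-.
by congr s; exact: Prop_irrelevance.
Qed.

Program Definition const_funpred := @Funpred M const_locpred _.
Next Obligation.
move=> U s cs x Ux; have [V [VU [Vx e]]] := cs (f x) Ux.
by exists (opens_pre cf V), (fun y => VU (f y)); split=> // y Vy; exact: e.
Qed.

(* Pullback of locally constant functions is the canonical isomorphism
   f^* M = M of constant sheaves. *)
Definition const_fsheaf : fsheaf f := fun_fsheaf const_funpred.

End Constant.

(* H^n({X/f}, F): the right derived functor of (F, phi) |-> Hom((Z, can), (F, phi)). *)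
Definition cohomology (F : fsheaf f) (J : inj_resolution F) (n : nat) : zmodType :=
  derived_hom (const_fsheaf int) J n.

(* The connecting homomorphism H^n({X/f}, C) -> H^(n+1)({X/f}, A). *)
Definition coh_connecting (A B C : fsheaf f) (i : fhom A B) (p : fhom B C)
    (S : ses_resolution i p) (n : nat) :
    cohomology (sesC S) n -> cohomology (sesA S) n.+1 :=
  @connecting X f (const_fsheaf int) A B C i p S n.

End FunctionSheaves.
Arguments coh_connecting {X f} cf {A B C i p} S n _.

Section ComplexManifolds.
Variable R : realType.

(* R[i] as a numFieldType, which gives C^n its norm and topology. *)
Definition CC : numFieldType := R[i].

(* The identification R^(2n) = C^n, (x, y) |-> x + i y. *)
Definition to_C n (r : 'rV[R]_(n + n)) : 'rV[CC]_n :=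
  \row_j (r 0 (lshift n j) +i* r 0 (rshift n j))%C.
Definition of_C n (z : 'rV[CC]_n) : 'rV[R]_(n + n) :=
  row_mx (map_mx (@complex.Re R) z) (map_mx (@complex.Im R) z).

(* Charts take values in R^(2n), read as C^n through to_C; cmap and cinv matter
   only on cdom and cimg. *)
Record chart (n : nat) (X : topologicalType) := Chart {
  cdom : set X;
  cmap : X -> 'rV[R]_(n + n);
  cinv : 'rV[R]_(n + n) -> X;
  cimg := cmap @` cdom;
  cdom_open : open cdom;
  cimg_open : open cimg;
  cmapK : forall x, cdom x -> cinv (cmap x) = x;
  cmap_continuous : forall x, cdom x -> {for x, continuous cmap};
  cinv_continuous : forall r, cimg r -> {for r, continuous cinv} }.

Definition transition n (X : topologicalType) (c c' : chart n X)
  (r : 'rV[R]_(n + n)) : 'rV[R]_(n + n) := cmap c' (cinv c r).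

Record complex_manifold := ComplexManifold {
  mspace :> topologicalType;
  mdim : nat;
  atlas : set (chart mdim mspace);
  mspace_hausdorff : hausdorff_space mspace;
  mspace_second_countable : second_countable (T := mspace);
  atlas_cover : forall x : mspace, exists c, atlas c /\ cdom c x;
  atlas_holomorphic : forall c c', atlas c -> atlas c' ->
    forall r, cimg c r -> cdom c' (cinv c r) ->
    differentiable (fun z : 'rV[CC]_mdim => to_C (transition c c' (of_C z)))
      (to_C r) }.

Definition smooth_map (X : complex_manifold) (f : X -> X) : Prop :=
  continuous f /\
  forall c c', atlas c -> atlas c' -> forall j,
    smooth [set r | cimg c r /\ cdom c' (f (cinv c r))]
      (fun r => cmap c' (f (cinv c r)) 0 j).

(* Multiplication by i on tangent vectors. *)
Definition tangent_i n (u : 'rV[R]_(n + n)) : 'rV[R]_(n + n) :=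
  of_C ((0 +i* 1)%C *: to_C u).

(* A closed positive real (1,1)-form, given in each chart c as a field
   kform c r of bilinear forms on the tangent space R^(2n).  kform_closed is
   d kform (u, v, w) = 0 for constant vector fields u, v, w. *)
Record kahler_form (X : complex_manifold) := KahlerForm {
  kform : chart (mdim X) X -> 'rV[R]_(mdim X + mdim X) ->
    'rV[R]_(mdim X + mdim X) -> 'rV[R]_(mdim X + mdim X) -> R;
  kform_linear : forall c r, atlas c -> cimg c r -> forall a u u' v,
    kform c r (a *: u + u') v = a * kform c r u v + kform c r u' v;
  kform_alternating : forall c r, atlas c -> cimg c r -> forall u v,
    kform c r u v = - kform c r v u;
  kform_smooth : forall c, atlas c -> forall u v,
    smooth (cimg c) (fun r => kform c r u v);
  kform_transition : forall c c', atlas c -> atlas c' ->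
    forall r, cimg c r -> cdom c' (cinv c r) -> forall u v,
    kform c r u v =
      kform c' (transition c c' r)
        ('d (transition c c') r u) ('d (transition c c') r v);
  kform_11 : forall c r, atlas c -> cimg c r -> forall u v,
    kform c r (tangent_i u) (tangent_i v) = kform c r u v;
  kform_positive : forall c r, atlas c -> cimg c r -> forall u, u != 0 ->
    0 < kform c r u (tangent_i u);
  kform_closed : forall c r, atlas c -> cimg c r -> forall u v w,
    'D_u (fun s => kform c s v w) r - 'D_v (fun s => kform c s u w) r
      + 'D_w (fun s => kform c s u v) r = 0 }.

Definition kahler (X : complex_manifold) : Prop := inhabited (kahler_form X).

Definition simply_connected (X : topologicalType) : Prop :=
  [/\ exists x : X, True,
      forall x y : X, exists g : R -> X,
        [/\ {within `[0, 1], continuous g}, g 0 = x & g 1 = y] &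
      forall g : R -> X, {within `[0, 1], continuous g} -> g 0 = g 1 ->
        exists H : R * R -> X,
          [/\ {within `[0, 1] `*` `[0, 1], continuous H},
              forall t, t \in `[0, 1] -> H (0, t) = g t,
              forall t, t \in `[0, 1] -> H (1, t) = g 0 &
              forall s, s \in `[0, 1] -> H (s, 0) = g 0 /\ H (s, 1) = g 0]].

(* The group C^*, written additively. *)
Record cstar := CStar { cval :> R[i]; cval_neq0 : cval != 0 }.
HB.instance Definition _ := [isSub for cval].
HB.instance Definition _ := [Choice of cstar by <:].

Definition cstar_one := CStar (oner_neq0 R[i]).
Definition cstar_mul (a b : cstar) := CStar (mulf_neq0 (cval_neq0 a) (cval_neq0 b)).
Definition cstar_inv (a : cstar) : cstar.
Proof. by exists (cval a)^-1; rewrite invr_eq0 cval_neq0. Defined.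

Fact cstar_mulA : associative cstar_mul.
Proof. by move=> a b c; apply: val_inj; rewrite /= mulrA. Qed.
Fact cstar_mulC : commutative cstar_mul.
Proof. by move=> a b; apply: val_inj; rewrite /= mulrC. Qed.
Fact cstar_mul1 : left_id cstar_one cstar_mul.
Proof. by move=> a; apply: val_inj; rewrite /= mul1r. Qed.
Fact cstar_mulV : left_inverse cstar_one cstar_inv cstar_mul.
Proof. by move=> a; apply: val_inj; rewrite /= mulVf ?cval_neq0. Qed.
HB.instance Definition _ :=
  GRing.isZmodule.Build cstar cstar_mulA cstar_mulC cstar_mul1 cstar_mulV.

Definition cexp (z : R[i]) : R[i] :=
  let: (a +i* b)%C := z in ((expR a * cos b) +i* (expR a * sin b))%C.

Lemma cexpD z w : cexp (z + w) = cexp z * cexp w.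
Proof.
case: z w => [a b] [c d]; rewrite /cexp /= expRD cosD sinD.
by apply/eqP; rewrite eq_complex /=; apply/andP; split; apply/eqP; ring.
Qed.

Lemma cexp0 : cexp 0 = 1.
Proof. by rewrite /cexp /= expR0 cos0 sin0 mulr1 mulr0. Qed.

Lemma cexp_neq0 z : cexp z != 0.
Proof.
apply/negP => /eqP e; have := cexpD z (- z).
by rewrite subrr cexp0 e mul0r; apply/eqP; rewrite oner_eq0.
Qed.

Definition cexp_star (z : R[i]) : cstar := CStar (cexp_neq0 z).

Lemma cexp_starB : {morph cexp_star : z w / z - w}.
Proof.
move=> z w; apply: val_inj => /=; apply: (mulIf (cexp_neq0 w)).
by rewrite -cexpD subrK mulrVK // unitfE cexp_neq0.
Qed.

Program Definition twopiiZ : subgroup R[i] :=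
  @Subgroup _ (fun z => exists k : int, z = (0 +i* (2 * pi))%C *~ k) _ _.
Next Obligation. by exists 0; rewrite mulr0z. Qed.
Next Obligation. by move=> u v [k ->] [l ->]; exists (k - l); rewrite mulrzBr. Qed.

Definition Z1 : zmodType := sub_elt twopiiZ.

End ComplexManifolds.

Section SmoothFunctions.
Variables (R : realType) (X : complex_manifold R).

(* Extension by 0 of a function on U, to express a section in charts. *)
Definition ext0 (U : opens X) (u : dsec (fun _ => R[i]) U) (x : X) : R[i] :=
  if pselect (U x) is left h then u x h else 0.

Definition chart_set (c : chart R (mdim X) X) (U : opens X) : set 'rV[R]_(mdim X + mdim X) :=
  [set r | cimg c r /\ U (cinv c r)].

Definition smooth_fun (U : opens X) (u : dsec (fun _ => R[i]) U) : Prop :=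
  forall c, atlas c ->
    smooth (chart_set c U) (fun r => complex.Re (ext0 u (cinv c r))) /\
    smooth (chart_set c U) (fun r => complex.Im (ext0 u (cinv c r))).

Lemma ext0E (U : opens X) (u : dsec (fun _ => R[i]) U) x (Ux : U x) : ext0 u x = u x Ux.
Proof.
by rewrite /ext0; case: pselect => // h; congr u; exact: Prop_irrelevance.
Qed.

Lemma open_preimage_within (S T : topologicalType) (A : set S) (g : S -> T) (B : set T) :
  open A -> (forall x, A x -> {for x, continuous g}) -> open B ->
  open [set x | A x /\ B (g x)].
Proof.
move=> oA cg oB; rewrite openE => x [Ax Bgx].
have nA : nbhs x A by exact: open_nbhs_nbhs.
have nB : nbhs x (g @^-1` B) by apply: (cg x Ax); exact: open_nbhs_nbhs.
by apply: filterS2 nA nB => y Ay By; split.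
Qed.

Lemma chart_set_open c U : open (chart_set c U).
Proof.
apply: open_preimage_within; [exact: cimg_open|exact: cinv_continuous|exact: oset_open].
Qed.
Arguments chart_set_open : clear implicits.

Lemma smooth_fun_ext (U : opens X) (u : dsec (fun _ => R[i]) U) :
  (forall c, atlas c -> exists a b : 'rV[R]_(mdim X + mdim X) -> R,
     [/\ smooth (chart_set c U) a, smooth (chart_set c U) b &
      forall r, cimg c r -> forall h : U (cinv c r), u _ h = (a r +i* b r)%C]) ->
  smooth_fun u.
Proof.
move=> H c ac; have [a [b [sa sb e]]] := H c ac; split=> k.
  apply: (Ck_ext (chart_set_open c U)) (sa k) => r; rewrite inE => -[cr Ur].
  by rewrite (ext0E _ Ur) e.
apply: (Ck_ext (chart_set_open c U)) (sb k) => r; rewrite inE => -[cr Ur].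
by rewrite (ext0E _ Ur) e.
Qed.

Lemma smooth_funP (U : opens X) (u : dsec (fun _ => R[i]) U) : smooth_fun u ->
  forall c, atlas c -> exists a b : 'rV[R]_(mdim X + mdim X) -> R,
     [/\ smooth (chart_set c U) a, smooth (chart_set c U) b &
      forall r, cimg c r -> forall h : U (cinv c r), u _ h = (a r +i* b r)%C].
Proof.
move=> su c ac; have [sR sI] := su c ac.
exists (fun r => complex.Re (ext0 u (cinv c r))), (fun r => complex.Im (ext0 u (cinv c r))).
by split=> // r cr h; rewrite (ext0E _ h); case: (u _ h).
Qed.

Lemma smooth_fun_cst (U : opens X) (z : R[i]) : smooth_fun (fun x (_ : U x) => z).
Proof.
apply: smooth_fun_ext => c ac; exists (cst (complex.Re z)), (cst (complex.Im z)).
by split=> [k|k|r _ _]; [exact: Ck_cst|exact: Ck_cst|case: z].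
Qed.

Lemma smooth_funB (U : opens X) (u v : dsec (fun _ => R[i]) U) :
  smooth_fun u -> smooth_fun v -> smooth_fun (u - v).
Proof.
move=> su sv; apply: smooth_fun_ext => c ac.
have oU := chart_set_open c U.
have [a [b [sa sb e]]] := smooth_funP su ac.
have [a' [b' [sa' sb' e']]] := smooth_funP sv ac.
exists (fun r => a r + - a' r), (fun r => b r + - b' r).
split=> [k|k|r cr h]; [by apply: CkD (CkN _ _)..|].
by rewrite -[LHS]/(u _ h - v _ h) e // e'.
Qed.

Lemma smooth_funM (U : opens X) (u v : dsec (fun _ => R[i]) U) :
  smooth_fun u -> smooth_fun v -> smooth_fun (fun x h => u x h * v x h).
Proof.
move=> su sv; apply: smooth_fun_ext => c ac.
have oU := chart_set_open c U.
have [a [b [sa sb e]]] := smooth_funP su ac.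
have [a' [b' [sa' sb' e']]] := smooth_funP sv ac.
exists (fun r => a r * a' r + - (b r * b' r)), (fun r => a r * b' r + b r * a' r).
split=> [k|k|r cr h].
- by apply: CkD => //; [exact: CkM|apply: CkN => //; exact: CkM].
- by apply: CkD => //; exact: CkM.
- by rewrite e // e'.
Qed.

Lemma smooth_funV (U : opens X) (u : dsec (fun _ => R[i]) U) :
  (forall x h, u x h != 0) ->
  smooth_fun u -> smooth_fun (fun x h => (u x h)^-1).
Proof.
move=> u0 su; apply: smooth_fun_ext => c ac.
have oU := chart_set_open c U.
have [a [b [sa sb e]]] := smooth_funP su ac.
pose n r := a r * a r + b r * b r.
have n0 r : chart_set c U r -> n r != 0.
  move=> [cr Ur]; have := u0 _ Ur; rewrite e // eq_complex /= negb_and => ab.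
  rewrite /n -!expr2 paddr_eq0 ?sqr_ge0 // !sqrf_eq0 negb_and //.
have Cn k : Ck k (chart_set c U) (fun r => (n r)^-1).
  by apply: CkV => //; apply: CkD => //; apply: CkM.
exists (fun r => a r * (n r)^-1), (fun r => - (b r * (n r)^-1)).
split=> [k|k|r cr h].
- exact: CkM.
- by apply: CkN => //; exact: CkM.
- by rewrite e // /n -!expr2 -mulNr.
Qed.

Lemma smooth_fun_res (U V : opens X) (VU : V `<=` U) (u : dsec (fun _ => R[i]) U) :
  smooth_fun u -> smooth_fun (dres VU u).
Proof.
move=> su; apply: smooth_fun_ext => c ac.
have [a [b [sa sb e]]] := smooth_funP su ac.
have sub : chart_set c V `<=` chart_set c U by move=> r [cr Vr]; split=> //; exact: VU.
exists a, b; split=> [k|k|r cr h]; [exact: Ck_sub (sa k)|exact: Ck_sub (sb k)|exact: e].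
Qed.

Lemma smooth_fun_loc (U : opens X) (u : dsec (fun _ => R[i]) U) :
  (forall x, U x -> exists (V : opens X) (VU : V `<=` U), V x /\ smooth_fun (dres VU u)) ->
  smooth_fun u.
Proof.
move=> H c ac.
have loc r : chart_set c U r -> exists (V : opens X) (VU : V `<=` U),
  chart_set c V r /\ smooth_fun (dres VU u).
  by move=> [cr Ur]; have [V [VU [Vr s]]] := H _ Ur; exists V, VU.
have eE (V : opens X) (VU : V `<=` U) s : V (cinv c s) ->
    ext0 (dres VU u) (cinv c s) = ext0 u (cinv c s).
  by move=> Vs; rewrite (ext0E _ Vs) (ext0E _ (VU _ Vs)).
split=> k; apply: Ck_local => r /loc[V [VU [Vr s]]]; exists (chart_set c V); split=> //.
  have /(_ k) := (s c ac).1; apply: Ck_ext; first exact: chart_set_open.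
  by move=> t; rewrite inE => -[ct Vt]; rewrite eE.
have /(_ k) := (s c ac).2; apply: Ck_ext; first exact: chart_set_open.
by move=> t; rewrite inE => -[ct Vt]; rewrite eE.
Qed.

Lemma smooth_fun_exp (U : opens X) (u : dsec (fun _ => R[i]) U) :
  smooth_fun u -> smooth_fun (fun x h => cexp (u x h)).
Proof.
move=> su; apply: smooth_fun_ext => c ac.
have oU := chart_set_open c U.
have [a [b [sa sb e]]] := smooth_funP su ac.
exists (fun r => expR (a r) * cos (b r)), (fun r => expR (a r) * sin (b r)).
split=> [k|k|r cr h]; last by rewrite e.
  by apply: CkM => //; [exact: (Ck_expR (g := a))|exact: (Ck_sin_cos _ (sb k)).2].
by apply: CkM => //; [exact: (Ck_expR (g := a))|exact: (Ck_sin_cos _ (sb k)).1].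
Qed.

Lemma smooth_fun_const (U : opens X) (u : dsec (fun _ => R[i]) U) :
  locally_constant u -> smooth_fun u.
Proof.
move=> lc; apply: smooth_fun_loc => x Ux; have [V [VU [Vx e]]] := lc x Ux.
exists V, VU; split=> //.
rewrite (_ : dres VU u = fun y _ => u x Ux); first exact: smooth_fun_cst.
by apply: dsec_eqP => y Vy; exact: e.
Qed.

Variables (f : X -> X) (sf : smooth_map f).

Lemma smooth_map_continuous : continuous f. Proof. by case: sf. Qed.
Let cf := smooth_map_continuous.

Lemma smooth_fun_pull (U : opens X) (u : dsec (fun _ => R[i]) U) : smooth_fun u ->
  smooth_fun (U := opens_pre cf U) (fun x h => u (f x) h).
Proof.
move=> su c ac; pose u' : dsec (fun _ => R[i]) (opens_pre cf U) := fun x h => u (f x) h.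
have loc r : chart_set c (opens_pre cf U) r -> exists2 c', atlas c' &
    exists B : set 'rV[R]_(mdim X + mdim X), [/\ open B, B r,
      forall j k, Ck k B (fun s => cmap c' (f (cinv c s)) 0 j),
      forall s, B s -> chart_set c' U (cmap c' (f (cinv c s))) &
      forall s, B s -> ext0 u' (cinv c s) = ext0 u (cinv c' (cmap c' (f (cinv c s))))].
  move=> [cr Ur]; have [c' [ac' c'r]] := atlas_cover (f (cinv c r)); exists c' => //.
  pose D := Opens (cdom_open c').
  exists (chart_set c (opens_pre cf (opensI D U))); split=> //.
  - exact: chart_set_open.
  - move=> j k; apply: Ck_sub (sf.2 c c' ac ac' j k) => s [cs [Ds Us]]; split=> //.
  - move=> s [cs [Ds Us]]; split; first by exists (f (cinv c s)).
    by rewrite cmapK.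
  - by move=> s [cs [Ds Us]]; rewrite cmapK // (ext0E u' Us) (ext0E u Us).
split=> k; apply: Ck_local => r /loc[c' ac' [B [oB Br CB hB eB]]]; exists B; split=> //.
  have := Ck_comp oB (chart_set_open c' U) hB (fun j => CB j k) ((su c' ac').1 k).
  by apply: Ck_ext => // s; rewrite inE => Bs; rewrite /= eB.
have := Ck_comp oB (chart_set_open c' U) hB (fun j => CB j k) ((su c' ac').2 k).
by apply: Ck_ext => // s; rewrite inE => Bs; rewrite /= eB.
Qed.

Program Definition A_locpred := @Locpred X (fun _ => R[i]) smooth_fun _ _ _ _.
Next Obligation. by move=> U; exact: smooth_fun_cst. Qed.
Next Obligation. exact: smooth_funB. Qed.
Next Obligation. exact: smooth_fun_res. Qed.
Next Obligation. exact: smooth_fun_loc. Qed.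

Definition Astar_smooth (U : opens X) (u : dsec (fun _ => cstar R) U) : Prop :=
  smooth_fun (fun x h => cval (u x h)).

Program Definition Astar_locpred := @Locpred X (fun _ => cstar R) Astar_smooth _ _ _ _.
Next Obligation. by move=> U; exact: smooth_fun_cst. Qed.
Next Obligation.
move=> U s t ss st; rewrite /Astar_smooth.
apply: (@smooth_funM U (fun x h => cval (s x h)) (fun x h => (cval (t x h))^-1)) => //.
by apply: smooth_funV => // x h; exact: cval_neq0.
Qed.
Next Obligation.
by move=> U V VU s; exact: (@smooth_fun_res U V VU (fun x h => cval (s x h))).
Qed.
Next Obligation. by move=> U s H; apply: smooth_fun_loc. Qed.

Definition A_funpred : funpred cf R[i] := @Funpred _ _ cf _ A_locpred smooth_fun_pull.

Program Definition Astar_funpred : funpred cf (cstar R) :=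
  @Funpred _ _ cf _ Astar_locpred _.
Next Obligation.
by move=> U s; exact: (@smooth_fun_pull U (fun x h => cval (s x h))).
Qed.

Definition A_bullet : fsheaf f := fun_fsheaf A_funpred.
Definition Astar_bullet : fsheaf f := fun_fsheaf Astar_funpred.

(* Z(1) = 2 pi i Z. *)
Definition Z1_bullet : fsheaf f := const_fsheaf cf (Z1 R).

Lemma Z1_val_smooth (U : opens X) (s : dsec (fun _ => Z1 R) U) :
  const_funpred cf (Z1 R) U s -> A_funpred U (fun x h => sub_val (s x h)).
Proof.
move=> cs; apply: smooth_fun_const => x Ux; have [V [VU [Vx e]]] := cs x Ux.
by exists V, VU; split=> // y Vy; rewrite e.
Qed.

Lemma Z1_valB : {morph @sub_val _ (twopiiZ R) : a b / a - b}.
Proof. by []. Qed.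

Definition Z1_to_A : fhom Z1_bullet A_bullet :=
  fun_fhom (P := const_funpred cf (Z1 R)) (Q := A_funpred) Z1_valB Z1_val_smooth.

Definition exp_A : fhom A_bullet Astar_bullet :=
  fun_fhom (P := A_funpred) (Q := Astar_funpred) (@cexp_starB R) smooth_fun_exp.

End SmoothFunctions.

(* Main.v *)
(* A morphism gam : Z -> F, for instance the one given by an invariant section of
   F, makes F (+) Z an extension of Z by F with action (s, z) |-> (phi s + gam z, z).
   Injectivity of J^0 extends the augmentation F -> J^0 to it; the component
   k : Z -> J^0 need not be equivariant, but its differential is an equivariant
   1-cocycle, whose class vanishes only if gam = f^*g - g for some g.

   A constant c in C^* thus gives a class in H^1(A^* ), which vanishes only if
   g o f = c g for some smooth g : X -> C^*.  It dies in H^2(Z(1)), being the image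
   of the class of log c in H^1(A).  On a compact simply connected X one can write
   g = exp u; then u o f - u is constant, hence 0 since u is bounded, and c = 1.

   For X a point and f = id the equation says c = 1 at once, so the map is not
   injective once a resolution is exhibited.  There, sheaves on {X/f} are
   Z[T]-modules, and Hom(Z[T], M), the sequences in M with the shift, is injective
   for divisible M; Z(1), C and C^* have explicit resolutions of this form. *)

Require Import Defs.
From HB Require Import structures.
From mathcomp Require Import all_boot all_order all_algebra.
From mathcomp Require Import complex ring lra.
From mathcomp Require Import all_classical all_reals all_analysis.
Set Implicit Arguments.
Unset Strict Implicit.
Unset Printing Implicit Defensive.
Import Order.TTheory GRing.Theory Num.Theory.
Import numFieldNormedType.Exports.
Local Open Scope classical_set_scope.
Local Open Scope ring_scope.
Local Open Scope quotient_scope.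

(** * Sections pulled back along f *)

(** An action is a morphism out of [f^*F], whose sections are families of germs; by the adjunction
    between [f^*] and [f_*] it is traded for maps [F U -> F (f^-1 U)], so that equivariance can be
    tested on sections of [F]. The connecting map is a choice from the relation [snake], in an
    arbitrary resolution of the exponential sequence. It can be evaluated once this relation is
    known to be single-valued, which rests on lifting equivariant maps from [Z] through sequences
    with injective kernel. That the classes are nonzero is topological: the argument of [g] is built
    from arcsine increments along paths. The counterexample has to be an actual short exact sequence
    of injective resolutions, because bijectivity is refuted by evaluating it on one; hence the
    mapping cone and the horseshoe, whose terms are built from divisible groups. *)

Section Sheaves.
Variable X : topologicalType.
Implicit Types F G H : sheaf X.

Lemma shomBE F G (a b : shom F G) (U : opens X) (s : F U) : (a - b) U s = a U s - b U s.
Proof. by []. Qed.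

(** [s] and [t] glue the same family, the restrictions of [s] to the opens on which both agree, and
    gluings are unique. *)
Lemma sheaf_sep F (U : opens X) (s t : F U) :
  (forall x, U x -> exists (V : opens X) (VU : V `<=` U), V x /\ res VU s = res VU t) ->
  s = t.
Proof.
move=> loc.
pose I := {V : opens X | exists VU : V `<=` U, res VU s = res VU t}.
have VU (i : I) : sval i `<=` U by case: i => V [].
have e (i : I) : res (VU i) t = res (VU i) s.
  by case: i (VU i) => V [h e] h'; rewrite (Prop_irrelevance h' h).
have [|i j W Wi Wj|r [_ r1]] := @sheaf_glue X F U I (fun i => sval i) VU (fun i => res (VU i) s).
- move=> x Ux; have [V [VU' [Vx e']]] := loc x Ux.
  by exists (exist _ V (ex_intro _ VU' e')).
- by rewrite !(res_res _ _ (subset_trans Wi (VU i))).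
by rewrite -(r1 s) // -(r1 t).
Qed.

(** Injectivity makes local preimages agree on overlaps, so they glue. *)
Lemma shom_inj_lift F G (a : shom F G) (U : opens X) (t : G U) :
  sheaf_inj a -> locally_in_image a t -> exists s, a U s = t.
Proof.
move=> ai loc.
pose I := {V : opens X & {VU : V `<=` U & {s : F V | a V s = res VU t}}}.
pose D (i : I) := projT1 i.
have DU (i : I) : D i `<=` U by case: i => V [].
pose S (i : I) : F (D i) := sval (projT2 (projT2 i)).
have SE (i : I) : a _ (S i) = res (DU i) t.
  case: i @S (DU _) => V [VU [s e]] /= h.
  by rewrite /= e (Prop_irrelevance h VU).
have [|i j W Wi Wj|r [rE _]] := @sheaf_glue X F U I D DU S.
- move=> x Ux; have [V [VU [s [Vx e]]]] := loc x Ux.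
  by exists (existT _ V (existT _ VU (exist _ s e))).
- apply: ai; rewrite !shom_res !SE.
  by rewrite !(res_res _ _ (subset_trans Wi (DU i))).
exists r; apply: sheaf_sep => x Ux; have [V [VU [s [Vx e]]]] := loc x Ux.
exists V, VU; split=> //; rewrite -e -shom_res; congr (a V _).
have := rE (existT _ V (existT _ VU (exist _ s e))).
by rewrite /S /=; set h := DU _; rewrite (Prop_irrelevance h VU).
Qed.

Lemma shom_lift F G H (a : shom F G) (b : shom H G) : sheaf_inj a ->
  (forall U s, locally_in_image a (b U s)) -> exists c : shom H F, shom_comp a c = b.
Proof.
move=> ai loc.
have [c cE] : {c : forall U, H U -> F U | forall U s, a U (c U s) = b U s}.
  exists (fun U s => sval (cid (shom_inj_lift ai (loc U s)))) => U s.
  exact: (svalP (cid (shom_inj_lift ai (loc U s)))).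
have cB U : {morph c U : s t / s - t}.
  by move=> s t; apply: ai; rewrite shomB !cE shomB.
have cr (U V : opens X) (VU : V `<=` U) s : c V (res VU s) = res VU (c U s).
  by apply: ai; rewrite shom_res !cE shom_res.
exists (Shom cB cr); apply: shom_eqP => U s /=; exact: cE.
Qed.

End Sheaves.

Section PulledSections.
Variables (X : topologicalType) (f : X -> X) (cf : continuous f).

Section OneSheaf.
Variable F : sheaf X.

(** Unit of the adjunction between [f^*] and [f_*]: a section over [U] seen in [f^*F] over
    [f^-1 U]. *)
Definition ipull_dsec (U : opens X) (s : F U) :
    dsec (fun x => stalk F (f x)) (opens_pre cf U) :=
  fun x Ux => germ (U := U) (x := f x) Ux s.

Lemma ipull_lp (U : opens X) (s : F U) : inv_image_lp (ipull_dsec s).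
Proof.
move=> x Ux; exists (opens_pre cf U), U, (@subset_refl _ _), (fun y Uy => Uy), s.
split=> // y Uy; rewrite /ipull_dsec; congr germ; exact: Prop_irrelevance.
Qed.

Definition ipull (U : opens X) (s : F U) : inv_image f F (opens_pre cf U) :=
  @sub_mk _ (lp_subgroup (inv_image_locpred f F) (opens_pre cf U)) _ (ipull_lp s).

Lemma ipull_res (U V : opens X) (VU : V `<=` U) (s : F U)
  (h : opens_pre cf V `<=` opens_pre cf U) : ipull (res VU s) = res h (ipull s).
Proof. by apply: val_inj; apply: dsec_eqP => x Vx; exact: germ_res. Qed.

Lemma ipullB (U : opens X) : {morph @ipull U : s t / s - t}.
Proof. by move=> s t; apply: val_inj; apply: dsec_eqP => x Ux; exact: germB. Qed.

(** Sections of [f^*F] are locally restrictions of sections [ipull t], so these determine a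
    morphism; this is injectivity of the adjunction map [Hom(f^*F, G) -> Hom(F, f_*G)]. *)
Lemma inv_image_hom_ext (G : sheaf X) (a b : shom (inv_image f F) G) :
  (forall U (s : F U), a _ (ipull s) = b _ (ipull s)) -> a = b.
Proof.
move=> e; apply: shom_eqP => V s; apply: sheaf_sep => x Vx.
have [N [U [NV [NU [t [Nx st]]]]]] := subgroupV s x Vx.
exists N, NV; split=> //; rewrite -!shom_res.
have -> : res NV s = res (s0 := inv_image f F) (NU : N `<=` opens_pre cf U) (ipull t).
  by apply: val_inj; apply: dsec_eqP => y Ny; exact: st.
by rewrite !shom_res e.
Qed.

End OneSheaf.

Lemma inv_image_hom_ipull (F G : sheaf X) (a : shom F G) (U : opens X) (s : F U) :
  inv_image_hom f a _ (ipull s) = ipull (a U s).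
Proof.
apply: val_inj; apply: dsec_eqP => x Ux; exact: stalk_map_germ.
Qed.

(** The adjoint [F -> f_*F] of the action. *)
Definition pull (F : fsheaf f) (U : opens X) (s : F U) : F (opens_pre cf U) :=
  fsheaf_act F _ (ipull s).

Lemma pull_res (F : fsheaf f) (U V : opens X) (VU : V `<=` U) (s : F U)
  (h : opens_pre cf V `<=` opens_pre cf U) : pull (res VU s) = res h (pull s).
Proof. by rewrite /pull (ipull_res _ _ h) shom_res. Qed.

Lemma pullB (F : fsheaf f) (U : opens X) : {morph @pull F U : s t / s - t}.
Proof. by move=> s t; rewrite /pull ipullB shomB. Qed.

Lemma fhom_commP (F G : fsheaf f) (a : shom F G) :
  fhom_comm a <-> forall U (s : F U), a _ (pull s) = pull (a U s).
Proof.
split=> [e U s|e].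
  have /(congr1 (fun b : shom _ _ => b _ (ipull s))) := e.
  by rewrite /pull -inv_image_hom_ipull.
apply: inv_image_hom_ext => U s; apply: etrans (e U s) _.
by rewrite /pull -inv_image_hom_ipull.
Qed.

Lemma fhom_pull (F G : fsheaf f) (a : fhom F G) U (s : F U) :
  sub_val a _ (pull s) = pull (sub_val a U s).
Proof. exact: ((fhom_commP (sub_val a)).1 (subgroupV a)). Qed.

End PulledSections.

Section DirectSum.
Variables (X : topologicalType) (F G : sheaf X).

#[local] Obligation Tactic := idtac.

Program Definition sheaf_sum : sheaf X :=
  @Sheaf X (fun U => (F U * G U)%type)
    (fun U V VU s => (res VU s.1, res VU s.2)) _ _ _ _.
Next Obligation. by move=> U V VU s t /=; rewrite !resB. Qed.
Next Obligation. by move=> U UU [s t] /=; rewrite !res_id. Qed.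
Next Obligation. by move=> U V W VU WV WU [s t] /=; rewrite !(res_res _ _ WU). Qed.
Next Obligation.
move=> U I V VU s cov e.
have [|s1 [s1E s1u]] := @sheaf_glue X F U I V VU (fun i => (s i).1) cov.
  by move=> i j W Wi Wj; have [] := e i j W Wi Wj.
have [|s2 [s2E s2u]] := @sheaf_glue X G U I V VU (fun i => (s i).2) cov.
  by move=> i j W Wi Wj; have [] := e i j W Wi Wj.
exists (s1, s2); split=> [i|[t1 t2] tE] /=; first by rewrite s1E s2E; case: (s i).
by congr pair; [apply: s1u|apply: s2u] => i; have /= := congr1 _ (tE i); rewrite -(tE i).
Qed.

Program Definition sum_in1 : shom F sheaf_sum := @Shom X F sheaf_sum (fun U s => (s, 0)) _ _.
Next Obligation. by move=> U s t; congr pair; rewrite /= subr0. Qed.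
Next Obligation. by move=> U V VU s; rewrite /= res0. Qed.

Program Definition sum_in2 : shom G sheaf_sum := @Shom X G sheaf_sum (fun U s => (0, s)) _ _.
Next Obligation. by move=> U s t; congr pair; rewrite /= subr0. Qed.
Next Obligation. by move=> U V VU s; rewrite /= res0. Qed.

Program Definition sum_pr1 : shom sheaf_sum F := @Shom X sheaf_sum F (fun U s => s.1) _ _.
Next Obligation. by []. Qed.
Next Obligation. by []. Qed.

Program Definition sum_pr2 : shom sheaf_sum G := @Shom X sheaf_sum G (fun U s => s.2) _ _.
Next Obligation. by []. Qed.
Next Obligation. by []. Qed.

End DirectSum.

(** * Degree 1 classes attached to morphisms [Z -> F] *)

Section TwistClass.
Variables (X : topologicalType) (f : X -> X) (cf : continuous f).

(** For equivariant [m], the condition under which [(s, z) |-> m s + k z] is equivariant on the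
    extension of [Z] by [F] defined by [gam]. *)
Definition twist_cochain (Z F J : fsheaf f) (m : fhom F J) (gam : fhom Z F)
    (k : shom Z J) : Prop :=
  forall U (s : Z U), pull cf (k U s) - k _ (pull cf s)
    = sub_val m _ (sub_val gam _ (pull cf s)).

Section Extension.
Variables (Z F : fsheaf f) (gam : fhom Z F).

(* The action (s, z) |-> (phi_F s + gam (phi_Z z), phi_Z z) on F (+) Z; a morphism
   to J extending m : F -> J restricts on Z to a twist cochain. *)
Definition ext_act : shom (inv_image f (sheaf_sum F Z)) (sheaf_sum F Z) :=
  let p2 := shom_comp (fsheaf_act Z) (inv_image_hom f (sum_pr2 F Z)) in
  shom_comp (sum_in1 F Z) (shom_comp (fsheaf_act F) (inv_image_hom f (sum_pr1 F Z))
    + shom_comp (sub_val gam) p2) + shom_comp (sum_in2 F Z) p2.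

Definition ext_fsheaf : fsheaf f := FSheaf ext_act.

Lemma ext_pull U (s : ext_fsheaf U) : pull cf s =
  (pull cf s.1 + sub_val gam _ (pull cf s.2), pull cf s.2).
Proof.
rewrite {1}/pull /=; set t := ipull cf s.
have e1 : inv_image_hom f (sum_pr1 F Z) _ t = ipull cf s.1 by exact: inv_image_hom_ipull.
have e2 : inv_image_hom f (sum_pr2 F Z) _ t = ipull cf s.2 by exact: inv_image_hom_ipull.
rewrite /ext_act /=.
rewrite -[LHS]/(fsheaf_act F _ (inv_image_hom f (sum_pr1 F Z) _ t) +
   sub_val gam _ (fsheaf_act Z _ (inv_image_hom f (sum_pr2 F Z) _ t)) + 0,
   0 + fsheaf_act Z _ (inv_image_hom f (sum_pr2 F Z) _ t)).
by rewrite e1 e2 addr0 add0r.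
Qed.

Lemma pull0 (G : fsheaf f) U : pull cf (0 : G U) = 0.
Proof. by rewrite -[in LHS](subrr (0 : G U)) pullB subrr. Qed.

Lemma ext_in1_comm : @fhom_comm X f F ext_fsheaf (sum_in1 F Z).
Proof. by apply/(fhom_commP cf) => U s; rewrite ext_pull /= pull0 shom0E addr0. Qed.

Definition ext_in1 : fhom F ext_fsheaf :=
  @sub_mk _ (fhom_subgroup F ext_fsheaf) _ ext_in1_comm.

Lemma twist_cochain_exists (J : fsheaf f) (m : fhom F J) : injective_fsheaf J ->
  exists k : shom Z J, twist_cochain m gam k.
Proof.
move=> inj; have [U s t [->]//|k km] := inj F ext_fsheaf ext_in1 _ m.
exists (shom_comp (sub_val k) (sum_in2 F Z)) => U s /=.
rewrite -(fhom_pull cf k) -shomB ext_pull /= pull0 add0r -km /=; congr (sub_val k _ _).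
by apply/eqP; rewrite -subr_eq0; apply/eqP; congr pair; rewrite /= ?subrr ?subr0 ?subrr.
Qed.

End Extension.

Variables (Z F : fsheaf f) (J : inj_resolution F).
Let aug := iaug J.
Implicit Types (gam : fhom Z F) (k : shom Z (J 0)).

Lemma aug_dif U (s : F U) : sub_val (idif J 0) U (sub_val aug U s) = 0.
Proof.
apply/(@iaug_exact _ _ _ J) => x Ux; exists U, (@subset_refl _ _), s.
by rewrite res_id.
Qed.

Lemma twist_cochainB gam gam' k k' : twist_cochain aug gam k ->
  twist_cochain aug gam' k' -> twist_cochain aug (gam - gam') (k - k').
Proof.
move=> e e' U s; rewrite -[sub_val (gam - gam') _ _]/(_ - _) shomB -e -e' !shomBE pullB.
by rewrite !opprD !opprK addrACA.
Qed.

(** The defect of equivariance of [k] lies in the image of the augmentation, which the differential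
    kills. *)
Lemma twist_cochain_dif_comm gam k : twist_cochain aug gam k ->
  @fhom_comm X f Z (J 1) (shom_comp (sub_val (idif J 0)) k).
Proof.
move=> e; apply/(fhom_commP cf) => U s; rewrite /= -fhom_pull.
by apply/esym/eqP; rewrite -subr_eq0 -shomB e aug_dif.
Qed.

Definition twist_dif gam k (e : twist_cochain aug gam k) : fhom Z (J 1) :=
  @sub_mk _ (fhom_subgroup Z (J 1)) _ (twist_cochain_dif_comm e).

Lemma twist_dif_cocycle gam k (e : twist_cochain aug gam k) :
  cocycles Z J 1 (twist_dif e).
Proof.
apply: val_inj; apply: shom_eqP => U s.
apply/(@idif_exact _ _ _ J 0) => x Ux.
by exists U, (@subset_refl _ U), (k U s); rewrite res_id.
Qed.

Definition twist_cocycle gam k (e : twist_cochain aug gam k) : sub_elt (cocycles Z J 1) :=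
  sub_mk (twist_dif_cocycle e).

Lemma hclassB (n : nat) : {morph @hclass X f Z F J n : a b / a - b}.
Proof. by move=> a b; rewrite /hclass raddfB. Qed.

Lemma hclass_eq0 (n : nat) (a : sub_elt (cocycles Z J n)) :
  hclass a = 0 <-> is_coboundary (sub_val a).
Proof.
rewrite /hclass -[RHS](raddf0 (\pi_(derived_hom Z J n))).
rewrite (rwP eqP) -Quotient.idealrBE subr0; split; first by move/asboolP.
by move=> ha; apply/asboolP.
Qed.

(** Two cochains for the same [gam] differ by an equivariant map, whose differential is a
    coboundary. *)
Lemma twist_class_uniq gam k k' (e : twist_cochain aug gam k) (e' : twist_cochain aug gam k') :
  hclass (twist_cocycle e) = hclass (twist_cocycle e').
Proof.
apply/eqP; rewrite -subr_eq0 -hclassB; apply/eqP/hclass_eq0.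
have bc : @fhom_comm X f Z (J 0) (k - k').
  apply/(fhom_commP cf) => U s; apply/esym/eqP; rewrite -subr_eq0.
  have := twist_cochainB e e' s; rewrite subrr => ->.
  by apply/eqP; exact: shom0E.
exists (@sub_mk _ (fhom_subgroup Z (J 0)) _ bc).
apply: val_inj; apply: shom_eqP => U s.
exact: (@shomB _ _ _ (sub_val (idif J 0)) U (k U s) (k' U s)).
Qed.

Lemma twist_exists gam : exists k, twist_cochain aug gam k.
Proof. exact/twist_cochain_exists/ires_injective. Qed.

(** Up to sign convention, the class in [Ext^1(Z, F)] of the extension [ext_fsheaf gam]. *)
Definition twist_class gam : derived_hom Z J 1 :=
  hclass (twist_cocycle (svalP (cid (twist_exists gam)))).

Lemma twist_classE gam k (e : twist_cochain aug gam k) :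
  twist_class gam = hclass (twist_cocycle e).
Proof. exact: twist_class_uniq. Qed.

Lemma twist_classB : {morph twist_class : a b / a - b}.
Proof.
move=> a b; have [ka ea] := twist_exists a; have [kb eb] := twist_exists b.
rewrite (twist_classE ea) (twist_classE eb) (twist_classE (twist_cochainB ea eb)).
rewrite -hclassB; congr hclass; apply: val_inj; apply: val_inj; apply: shom_eqP => U s.
exact: (@shomB _ _ _ (sub_val (idif J 0)) U (ka U s) (kb U s)).
Qed.

(** If [b] is an equivariant primitive of the cocycle, [k - b] is killed by the differential and
    factors through the augmentation as [g]. Since [b] is equivariant, [g] inherits the defect of
    [k], read in [F]. *)
Lemma twist_class_eq0 gam : twist_class gam = 0 ->
  exists g : shom Z F, forall U (s : Z U),
    pull cf (g U s) - g _ (pull cf s) = sub_val gam _ (pull cf s).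
Proof.
have [k ek] := twist_exists gam; rewrite (twist_classE ek) => /hclass_eq0[b bE].
have [U s|g gE] := @shom_lift _ _ _ _ (sub_val aug) (k - sub_val b) (@iaug_inj _ _ _ J).
  apply/(@iaug_exact _ _ _ J).
  have /= := congr1 (fun a : fhom Z (J 1) => sub_val a U s) bE.
  by move=> e; apply: etrans (@shomB _ _ _ (sub_val (idif J 0)) U _ _) _; rewrite e subrr.
have gE' U s : sub_val aug U (g U s) = k U s - sub_val b U s.
  by have /(congr1 (fun a : shom _ _ => a U s)) := gE.
exists g => U s; apply: (@iaug_inj _ _ _ J); rewrite -/aug.
rewrite shomB fhom_pull !gE' pullB -ek fhom_pull opprB addrA subrK //.
Qed.

End TwistClass.

(** * Lifting through short exact sequences, and the connecting map *)

Section ConnectingMap.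
Variables (X : topologicalType) (f : X -> X) (cf : continuous f).

#[local] Obligation Tactic := idtac.

Program Definition shom_id (F : sheaf X) : shom F F := @Shom X F F (fun U s => s) _ _.
Next Obligation. by []. Qed.
Next Obligation. by []. Qed.

Lemma shom_id_comm (F : fsheaf f) : @fhom_comm X f F F (shom_id F).
Proof. by apply/(fhom_commP cf) => U s. Qed.

Definition fid (F : fsheaf f) : fhom F F :=
  @sub_mk _ (fhom_subgroup F F) _ (shom_id_comm F).

Program Definition sum_pair (F G H : sheaf X) (a : shom H F) (b : shom H G) :
    shom H (sheaf_sum F G) :=
  @Shom X H (sheaf_sum F G) (fun U s => (a U s, b U s)) _ _.
Next Obligation. by move=> F G H a b U s t; congr pair; exact: shomB. Qed.
Next Obligation. by move=> F G H a b U V VU s; congr pair; exact: shom_res. Qed.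

(* A short exact sequence with injective kernel has a retraction r : B -> A, and
   (p, r) : B -> C (+) A is then an isomorphism. *)
Lemma short_exact_lift (Z A B C : fsheaf f) (i : fhom A B) (p : fhom B C) :
  short_exact i p -> injective_fsheaf A ->
  forall e : fhom Z C, exists e' : fhom Z B, fcomp p e' = e.
Proof.
move=> [i_inj ip_ex p_surj] injA e.
have [r rE] := injA _ _ i i_inj (fid A).
have {}rE U s : sub_val r U (sub_val i U s) = s.
  by have := congr1 (fun a : fhom A A => sub_val a U s) rE.
have pi0 U s : sub_val p U (sub_val i U s) = 0.
  by apply/ip_ex => x Ux; exists U, (@subset_refl _ U), s; rewrite res_id.
have joint_inj U (s t : B U) : sub_val p U s = sub_val p U t ->
    sub_val r U s = sub_val r U t -> s = t.
  move=> /eqP; rewrite -subr_eq0 -shomB => /eqP/ip_ex/(shom_inj_lift i_inj)[a aE].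
  move=> /eqP; rewrite -subr_eq0 -shomB -aE rE => /eqP a0.
  by apply/eqP; rewrite -subr_eq0 -aE a0 shom0E.
pose pr := sum_pair (sub_val p) (sub_val r).
have pr_inj : sheaf_inj pr by move=> U s t [ps rs]; exact: joint_inj.
(* The lift [c] is singled out by [r c = 0]: this uniqueness makes local lifts glue and the result
   equivariant. *)
have [U s|c cE] := @shom_lift _ _ _ _ pr (shom_comp (sum_in1 C A) (sub_val e)) pr_inj.
  move=> x Ux; have [V [VU [b [Vx pb]]]] := p_surj U (sub_val e U s) x Ux.
  (* Subtracting [i (r b)] from a local lift [b] keeps its image under [p] and makes its image under
     [r] vanish. *)
  exists V, VU, (b - sub_val i V (sub_val r V b)); split=> //=.
  by congr pair; rewrite shomB ?pi0 ?rE ?subrr ?res0 // subr0.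
have {}cE U s : sub_val p U (c U s) = sub_val e U s /\ sub_val r U (c U s) = 0.
  by have [] := congr1 (fun a : shom _ _ => a U s) cE.
have cc : @fhom_comm X f Z B c.
  apply/(fhom_commP cf) => U s; have [pc rc] := cE U s.
  have [pc' rc'] := cE _ (pull cf s).
  apply: joint_inj; first by rewrite pc' !fhom_pull pc.
  by rewrite rc' fhom_pull rc pull0.
exists (@sub_mk _ (fhom_subgroup Z B) _ cc).
by apply: val_inj; apply: shom_eqP => U s; have [] := cE U s.
Qed.

Section Snake.
Variables (Z A B C : fsheaf f) (i : fhom A B) (p : fhom B C).
Variable S : ses_resolution i p.

Lemma ses_lift n (e : fhom Z (sesC S n)) :
  exists e' : fhom Z (sesB S n), fcomp (ses_p S n) e' = e.
Proof. by apply: (short_exact_lift (ses_exact S n)); exact: ires_injective. Qed.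

Lemma ses_i_lift n (b : fhom Z (sesB S n)) : fcomp (ses_p S n) b = 0 ->
  exists a : fhom Z (sesA S n), fcomp (ses_i S n) a = b.
Proof.
move=> pb0; have [i_inj ip_ex _] := ses_exact S n.
have [U s|a aE] := @shom_lift _ _ _ _ (sub_val (ses_i S n)) (sub_val b) i_inj.
  by apply/ip_ex; have := congr1 (fun a : fhom Z (sesC S n) => sub_val a U s) pb0.
have {}aE U s : sub_val (ses_i S n) U (a U s) = sub_val b U s.
  by have := congr1 (fun a : shom _ _ => a U s) aE.
have ac : @fhom_comm X f Z (sesA S n) a.
  by apply/(fhom_commP cf) => U s; apply: i_inj; rewrite aE !fhom_pull aE.
exists (@sub_mk _ (fhom_subgroup Z (sesA S n)) _ ac).
by apply: val_inj; apply: shom_eqP => U s; exact: aE.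
Qed.

Lemma fcompA (F G H K : fsheaf f) (c : fhom H K) (b : fhom G H) (a : fhom F G) :
  fcomp c (fcomp b a) = fcomp (fcomp c b) a.
Proof. by apply: val_inj; apply: shom_eqP. Qed.

Lemma ses_i_cancel n (a a' : fhom Z (sesA S n)) :
  fcomp (ses_i S n) a = fcomp (ses_i S n) a' -> a = a'.
Proof.
move=> e; apply: val_inj; apply: shom_eqP => U s; have [i_inj _ _] := ses_exact S n.
by apply: i_inj; have := congr1 (fun a : fhom Z (sesB S n) => sub_val a U s) e.
Qed.

(** With [snakeB] this makes [snake] single-valued. A primitive [e] of the cocycle lifts to [e'];
    correcting [b] by the differential of [e'] puts it in the kernel of [p], and its preimage under
    [i] is a primitive of [a]. *)
Lemma snake0 n (k : derived_hom Z (sesA S) n.+2) :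
  snake (n := n.+1) (0 : derived_hom Z (sesC S) n.+1) k -> k = 0.
Proof.
case=> c [b [a [c0 pb ia ->]]]; apply/hclass_eq0.
have /hclass_eq0[/= e eE] := esym c0.
have [e' e'E] := ses_lift e.
have [|a' a'E] := ses_i_lift (b := b - fcomp (idif (sesB S) n) e').
  by rewrite fcompBr pb fcompA ses_p_dif -fcompA e'E eE subrr.
exists a'; apply: ses_i_cancel.
by rewrite ia fcompA ses_i_dif -fcompA a'E fcompBr idif_idif subr0.
Qed.

Lemma snakeB n (h h' : derived_hom Z (sesC S) n) (k k' : derived_hom Z (sesA S) n.+1) :
  snake h k -> snake h' k' -> snake (h - h') (k - k').
Proof.
case=> c [b [a [-> pb ia ->]]] [c' [b' [a' [-> pb' ia' ->]]]].
exists (c - c'), (b - b'), (a - a'); rewrite !hclassB; split=> //.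
  by rewrite fcompBr pb pb'.
by rewrite -[X in fcomp _ X]/(sub_val a - sub_val a') !fcompBr ia ia'.
Qed.

(** Any explicit witness computes the value chosen by [xget], since the difference of two values is
    related to 0. *)
Lemma connecting_snake n (h : derived_hom Z (sesC S) n.+1) k :
  snake h k -> connecting h = k.
Proof.
move=> hk; rewrite /connecting; case: xgetP => [k' _ hk'|/(_ k)//].
apply/eqP; rewrite -subr_eq0; apply/eqP; apply: snake0.
by rewrite -(subrr h); exact: snakeB.
Qed.

(** A cochain [k] for [l] in the resolution of [B] maps to one for [fcomp p l]. The cocycle so
    obtained lifts to [twist_dif ek], which is itself a cocycle, so the snake ends at 0. *)
Lemma connecting_twist_class (l : fhom Z B) :
  connecting (twist_class cf (sesC S) (fcomp p l)) = 0.
Proof.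
have [k ek] := twist_exists cf (sesB S) l.
have ek' : twist_cochain cf (iaug (sesC S)) (fcomp p l) (shom_comp (sub_val (ses_p S 0)) k).
  move=> U s; rewrite /= -fhom_pull -shomB ek.
  have := congr1 (fun a : fhom B _ => sub_val a _ (sub_val l _ (pull cf s))) (ses_p_aug S).
  by [].
apply: connecting_snake; rewrite (twist_classE ek').
exists (twist_cocycle ek'), (twist_dif ek), 0; split=> //.
- apply: val_inj; apply: shom_eqP => U s.
  by have /= := congr1 (fun a : fhom _ _ => sub_val a _ (k U s)) (ses_p_dif S 0).
- rewrite -[X in fcomp _ X]/0 fcompr0; apply/esym; exact: (twist_dif_cocycle ek).
- by rewrite /hclass raddf0.
Qed.

End Snake.

End ConnectingMap.

(** * Circle-valued functions *)

Section Circle.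
Variable R : realType.

Definition on_circle (a b : R) := a ^+ 2 + b ^+ 2 = 1.

(** For unit vectors less than a right angle apart, the signed angle from [(a, b)] to [(a', b')]:
    the cross product is its sine. *)
Definition angle_step (a b a' b' : R) : R := asin (a * b' - b * a').

(** Lagrange's identity: the squares of the cross and inner products add up to 1. The bounds are
    strict because [asin] is to be continuous there. *)
Lemma cross_bound (a b a' b' : R) : on_circle a b -> on_circle a' b' ->
  0 < a * a' + b * b' -> -1 < a * b' - b * a' < 1.
Proof.
rewrite /on_circle => e e' d.
have : (a * b' - b * a') ^+ 2 + (a * a' + b * b') ^+ 2 = 1.
  transitivity ((a ^+ 2 + b ^+ 2) * (a' ^+ 2 + b' ^+ 2)); last by rewrite e e' mulr1.
  by ring.
have := exprn_gt0 2 d; move: (_ ^+ 2) => D D0; move: (_ - _) => C CD.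
by apply/andP; split; nra.
Qed.

(** Positivity makes the inner product the cosine of the step, rather than the opposite of that
    cosine. *)
Lemma angle_stepP (a b a' b' t : R) : on_circle a b -> on_circle a' b' ->
  0 < a * a' + b * b' -> cos t = a -> sin t = b ->
  cos (t + angle_step a b a' b') = a' /\ sin (t + angle_step a b a' b') = b'.
Proof.
move=> e e' d ca sa; have /andP[c1 c2] := cross_bound e e' d.
have cb : -1 <= a * b' - b * a' <= 1 by rewrite !ltW.
rewrite cosD sinD ca sa /angle_step asinK ?in_itv //= cos_asin //.
have -> : 1 - (a * b' - b * a') ^+ 2 = (a * a' + b * b') ^+ 2.
  rewrite /on_circle in e e'.
  transitivity ((a ^+ 2 + b ^+ 2) * (a' ^+ 2 + b' ^+ 2) - (a * b' - b * a') ^+ 2).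
    by rewrite e e' mulr1.
  by ring.
rewrite sqrtr_sqr gtr0_norm //; rewrite /on_circle in e.
split; [transitivity (a' * (a ^+ 2 + b ^+ 2)); last by rewrite e mulr1|
  transitivity (b' * (a ^+ 2 + b ^+ 2)); last by rewrite e mulr1]; ring.
Qed.

Lemma circle_angle (a b : R) : on_circle a b -> exists t, cos t = a /\ sin t = b.
Proof.
rewrite /on_circle => e.
have ab : -1 <= a <= 1 by apply/andP; split; nra.
have s : sin (acos a) = `|b|.
  by rewrite sin_acos // -e addrC addKr sqrtr_sqr.
have [b0|b0] := leP 0 b.
  by exists (acos a); rewrite acosK ?in_itv // s ger0_norm.
by exists (- acos a); rewrite cosN sinN acosK ?in_itv // s ltr0_norm ?opprK.
Qed.

Lemma asin0 : asin (0 : R) = 0.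
Proof.
have /sinK : (0 : R) \in `[(- (pi / 2)), (pi / 2)].
  by rewrite in_itv /= oppr_le0 andbb divr_ge0 ?pi_ge0.
by rewrite sin0.
Qed.

Section HomotopyLift.
Variables (T : topologicalType) (K : set T) (A B : R * T -> R) (t0 : R).
Hypotheses (cK : compact K) (cA : continuous A) (cB : continuous B).
Hypothesis AB1 : forall z, on_circle (A z) (B z).
Hypothesis AB0 : forall p, K p -> cos t0 = A (0, p) /\ sin t0 = B (0, p).

(** For step 0 the expression is [A^2 + B^2 = 1]. Compactness of [[0, 1] x K] turns positivity for
    small steps near each point into one step size valid everywhere. *)
Lemma homotopy_fine : exists n : nat, forall t p, 0 <= t <= 1 -> K p ->
  0 < A (t, p) * A (t + n.+1%:R^-1, p) + B (t, p) * B (t + n.+1%:R^-1, p).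
Proof.
pose P (n : nat) (z : R * T) :=
  0 < A z * A (z.1 + n.+1%:R^-1, z.2) + B z * B (z.1 + n.+1%:R^-1, z.2).
have /compact_near_coveringP/(_ nat \oo P _) := compact_setX (@segment_compact R 0 1) cK.
case=> [z _|n _ Hn]; last first.
  exists n => t p t01 Kp; apply: (Hn n (leqnn n) (t, p)).
  by split=> //=; rewrite in_itv.
pose g (x : (R * T) * R) := A x.1 * A (x.1.1 + x.2, x.1.2) + B x.1 * B (x.1.1 + x.2, x.1.2).
have cs : continuous (fun x : (R * T) * R => (x.1.1 + x.2, x.1.2)).
  move=> x; have h1 : (fun x : (R * T) * R => x.1.1 + x.2) @ x --> x.1.1 + x.2.
    by apply: cvgD; [apply: (cvg_comp fst fst (F := nbhs x)); exact: cvg_fst|exact: cvg_snd].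
  have h2 : (fun x : (R * T) * R => x.1.2) @ x --> x.1.2.
    by apply: (cvg_comp fst snd (F := nbhs x)); [exact: cvg_fst|exact: cvg_snd].
  exact: (cvg_pair h1 h2).
have cg : continuous g.
  have c1 (F : R * T -> R) : continuous F -> forall x : (R * T) * R, F y.1 @[y --> x] --> F x.1.
    by move=> cF x; apply: (@continuous_comp _ _ _ fst F); [exact: cvg_fst|exact: cF].
  have c2 (F : R * T -> R) : continuous F ->
      forall x : (R * T) * R, F (y.1.1 + y.2, y.1.2) @[y --> x] --> F (x.1.1 + x.2, x.1.2).
    by move=> cF x; apply: (continuous_comp (cs x)); exact: cF.
  by move=> x; apply: cvgD; apply: cvgM; [exact: c1|exact: c2|exact: c1|exact: c2].
have g0 : 0 < g (z, 0).
  by rewrite /g /= addr0 -surjective_pairing -!expr2 AB1.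
have [[U V] /= [Uz V0] UV] : \forall x \near (z, 0 : R), 0 < g x.
  by apply: (cvgr_gt _ (cg (z, 0))).
(* [harmonic] is the sequence [1 / (n + 1)] of step sizes, which eventually enters [V]. *)
exists (U, harmonic @^-1` V); first by split=> //=; exact: cvg_harmonic.
by move=> [z' n] /= [Uz' Vn]; exact: (UV (z', n.+1%:R^-1)).
Qed.

(** The angle at time 1 is [t0] plus the steps along a fine subdivision of time, a finite sum of
    functions continuous in [p]. Where the homotopy is stationary every step is [asin 0], whence the
    last clause. *)
Lemma homotopy_lift : exists th : T -> R,
  [/\ forall p, K p -> {for p, continuous th},
      forall p, K p -> cos (th p) = A (1, p) /\ sin (th p) = B (1, p) &
      forall p, K p ->
        (forall t, 0 <= t <= 1 -> A (t, p) = A (0, p) /\ B (t, p) = B (0, p)) ->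
        th p = t0].
Proof.
have [n fine] := homotopy_fine.
pose s k : R := k%:R * n.+1%:R^-1.
have sS k : s k.+1 = s k + n.+1%:R^-1 by rewrite /s -[in LHS]natr1 mulrDl mul1r.
have s01 k : (k <= n.+1)%N -> 0 <= s k <= 1.
  move=> kn; rewrite /s mulr_ge0 ?invr_ge0 ?ler0n //=.
  by rewrite ler_pdivrMr ?ltr0n // mul1r ler_nat.
pose step k p := angle_step (A (s k, p)) (B (s k, p)) (A (s k.+1, p)) (B (s k.+1, p)).
have stepP k p : (k <= n)%N -> K p ->
    0 < A (s k, p) * A (s k.+1, p) + B (s k, p) * B (s k.+1, p).
  by move=> kn Kp; rewrite sS; apply: fine => //; apply: s01; exact: leqW.
pose th k p := t0 + \sum_(i < k) step i p.
have thS k p : th k.+1 p = th k p + step k p by rewrite /th big_ord_recr addrA.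
have sn1 : s n.+1 = 1 by rewrite /s divff // pnatr_eq0.
have cst k (p : T) : {for p, continuous (fun p' => (s k, p'))}.
  have h1 : (fun=> s k) @ p --> s k by exact: cvg_cst.
  have h2 : id @ p --> p by exact: cvg_id.
  exact: (cvg_pair h1 h2).
have cAk k (p : T) : {for p, continuous (fun p' => A (s k, p'))}.
  by apply: (continuous_comp (cst k p)); exact: cA.
have cBk k (p : T) : {for p, continuous (fun p' => B (s k, p'))}.
  by apply: (continuous_comp (cst k p)); exact: cB.
exists (th n.+1); split=> [p Kp|p Kp|p Kp const].
- suff: forall k, (k <= n.+1)%N -> {for p, continuous (th k)} by exact.
  elim=> [_|k IH kn].
    by rewrite (_ : th 0%N = fun=> t0); [exact: cvg_cst|apply/funext => q; rewrite /th big_ord0 addr0].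
  rewrite (_ : th k.+1 = fun q => th k q + step k q); last by apply/funext => q; rewrite thS.
  apply: continuousD; first exact: IH (ltnW kn).
  apply: continuous_comp; first by apply: continuousB; apply: continuousM; [exact: cAk|exact: cBk|exact: cBk|exact: cAk].
  by apply: continuous_asin; apply: cross_bound => //; exact: stepP.
- rewrite -sn1.
  suff: forall k, (k <= n.+1)%N -> cos (th k p) = A (s k, p) /\ sin (th k p) = B (s k, p).
    exact.
  elim=> [_|k IH kn].
    by rewrite /th big_ord0 addr0 /s mul0r; exact: AB0.
  have [ck sk] := IH (ltnW kn).
  by rewrite thS; apply: angle_stepP => //; exact: stepP.
- rewrite /th big1 ?addr0 // => -[k kn] _ /=.
  have [e1 e2] := const _ (s01 k (ltnW kn)).
  have [e3 e4] : A (s k.+1, p) = A (0, p) /\ B (s k.+1, p) = B (0, p).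
    by apply: const; exact: s01.
  by rewrite /step /angle_step e1 e2 e3 e4 mulrC subrr asin0.
Qed.

End HomotopyLift.
End Circle.

Lemma continuous_within_comp (T U Y : topologicalType) (D : set U) (g : T -> U) (h : U -> Y) :
  {within D, continuous h} -> continuous g -> (forall t, D (g t)) -> continuous (h \o g).
Proof.
move=> /subspace_continuousP ch cg Dg t.
apply: cvg_comp (ch (g t) (Dg t)).
move=> W wW; have gW : nbhs t (g @^-1` (fun u => D u -> W u)) by exact: (cg t _ wW).
by apply: filterS gW => s; apply.
Qed.

Lemma continuous_glue (R : realType) (Y : topologicalType) (a b : R -> Y) (c : R) :
  continuous a -> continuous b -> a c = b c ->
  continuous (fun t => if t <= c then a t else b t).
Proof.
move=> ca cb ab t W /=.
have [tc|ct|->] := ltgtP t c.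
- move=> aW; have lt : \forall s \near t, s < c by exact: lt_nbhsl.
  by apply: filterS2 lt (ca t _ aW) => s /ltW /= ->.
- move=> bW; have lt : \forall s \near t, c < s by exact: lt_nbhsr.
  by apply: filterS2 lt (cb t _ bW) => s; rewrite /= ltNge => /negbTE ->.
- move=> aW; have bW := aW; rewrite ab in bW.
  have h1 : nbhs c (a @^-1` W) by exact: (ca c _ aW).
  have h2 : nbhs c (b @^-1` W) by exact: (cb c _ bW).
  by apply: filterS2 h1 h2 => s /=; case: ifP.
Qed.

Section Clamp.
Variable R : realType.

(** The retraction of the line onto [[0, 1]]; composing with it makes paths and homotopies given on
    [[0, 1]] continuous everywhere. *)
Definition clamp (t : R) : R := Num.max 0 (Num.min 1 t).

Lemma clamp_itv t : 0 <= clamp t <= 1.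
Proof. by rewrite /clamp le_max lexx /= ge_max ler01 /= ge_min lexx. Qed.

Lemma clamp_id t : 0 <= t <= 1 -> clamp t = t.
Proof.
by move=> /andP[t0 t1]; rewrite /clamp min_r // max_r.
Qed.

Lemma clamp_continuous : continuous clamp.
Proof.
move=> t; apply: continuous_max; first exact: cvg_cst.
by apply: continuous_min; [exact: cvg_cst|exact: cvg_id].
Qed.

(** If [D 1] and [D 0] differed, the intermediate value theorem would make [|D t - D 0|] reach a
    level in []0, pi]], where the cosine is not 1. *)
Lemma no_jump (D : R -> R) :
  (forall t, 0 <= t <= 1 -> {for t, continuous D}) ->
  (forall t, 0 <= t <= 1 -> cos (D t - D 0) = 1) -> D 1 = D 0.
Proof.
move=> cD D1; apply/eqP; rewrite -subr_eq0 -normr_eq0; apply/negPn/negP => n0.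
pose E t := `|D t - D 0|; have E1 : 0 < E 1 by rewrite lt_def n0 normr_ge0.
have cE : {within `[0, 1], continuous E}.
  apply: continuous_in_subspaceT => t; rewrite inE /= in_itv /= => t01.
  apply: (@continuous_comp _ _ _ (fun t => D t - D 0) Num.norm); last exact: norm_continuous.
  by apply: cvgB; [exact: cD|exact: cvg_cst].
have E0 : E 0 = 0 by rewrite /E subrr normr0.
pose v := Num.min (E 1) pi.
have v0 : 0 < v by rewrite lt_min E1 pi_gt0.
have [|c c01 Ec] := IVT ler01 cE (v := v).
  by rewrite E0 min_l ?max_r ?(ltW E1) // ltW // ge_min lexx.
have cosv : cos v = cos 0.
  rewrite -Ec cos0 -(D1 c); last by move: c01; rewrite in_itv.
  by rewrite /E; case: ger0P => _; rewrite ?cosN.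
have /cos_inj : v \in `[0, pi] by rewrite in_itv /= ltW //= ge_min lexx orbT.
move=> /(_ 0); rewrite in_itv /= lexx pi_ge0 => /(_ isT cosv) e.
by move: v0; rewrite e ltxx.
Qed.
End Clamp.

(** * Turning of a circle-valued map along a path *)

Section Turning.
Variables (R : realType) (X : topologicalType) (A B : X -> R).
Hypotheses (cA : continuous A) (cB : continuous B).
Hypothesis AB1 : forall x, on_circle (A x) (B x).

Definition path_lift (p : R -> X) (th : R -> R) :=
  forall t, 0 <= t <= 1 ->
    [/\ {for t, continuous th}, cos (th t) = A (p t) & sin (th t) = B (p t)].

Definition turn (p : R -> X) (d : R) := exists2 th, path_lift p th & th 1 - th 0 = d.

Let i0 : 0 <= (0 : R) <= 1. Proof. by rewrite lexx ler01. Qed.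
Let i1 : 0 <= (1 : R) <= 1. Proof. by rewrite lexx ler01. Qed.

Lemma turn_exists (p : R -> X) : continuous p -> exists d, turn p d.
Proof.
move=> cp; have [t0 [ct0 st0]] := circle_angle (AB1 (p 0)).
(* A homotopy from the constant path at [p 0] to [p]; its lift at time 1 is a lift of [p]. *)
pose q (z : R * R) := p (z.1 * z.2).
have cq : continuous q.
  move=> z; apply: (@continuous_comp _ _ _ (fun z : R * R => z.1 * z.2) p); last exact: cp.
  by apply: cvgM; [exact: cvg_fst|exact: cvg_snd].
have cAq : continuous (A \o q) by move=> z; apply: continuous_comp; [exact: cq|exact: cA].
have cBq : continuous (B \o q) by move=> z; apply: continuous_comp; [exact: cq|exact: cB].
have q0 s : `[0, 1]%classic s -> cos t0 = A (q (0, s)) /\ sin t0 = B (q (0, s)).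
  by rewrite /q /= mul0r.
have [th [cth thE _]] :=
  homotopy_lift (@segment_compact R 0 1) cAq cBq (fun z => AB1 (q z)) q0.
exists (th 1 - th 0), th => // t t01.
have [|ct st] := thE t; first by rewrite /= in_itv.
by move: ct st; rewrite /q /= mul1r; split=> //; apply: cth; rewrite /= in_itv.
Qed.

(** Two lifts differ by multiples of [2 pi], and a continuous difference cannot jump. *)
Lemma turn_uniq (p : R -> X) (d d' : R) : turn p d -> turn p d' -> d = d'.
Proof.
move=> [th l <-] [th' l' <-].
have D01 t : 0 <= t <= 1 -> cos (th t - th' t) = 1 /\ sin (th t - th' t) = 0.
  move=> t01; have [_ c s] := l t t01; have [_ c' s'] := l' t t01.
  by rewrite cosB sinB c s c' s' -!expr2 AB1 mulrC subrr.
have [c0 s0] := D01 0 i0.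
suff : th 1 - th' 1 = th 0 - th' 0 by move=> e; lra.
apply: (@no_jump R (fun t => th t - th' t)) => t t01.
- by have [? _ _] := l t t01; have [? _ _] := l' t t01; exact: cvgB.
- by have [c s] := D01 t t01; rewrite cosB c0 s0 c s mulr1 mulr0 addr0.
Qed.

(** Both end points stay fixed during the null-homotopy, so both end angles equal the initial angle
    [t0]. *)
Lemma turn_loop (p : R -> X) : simply_connected R X -> continuous p -> p 0 = p 1 -> turn p 0.
Proof.
move=> [_ _ sc] cp p01.
have [|H [cH H0 H1 Hend]] := sc p _ p01; first exact: continuous_subspaceT.
have [t0 [ct0 st0]] := circle_angle (AB1 (p 0)).
(* The null-homotopy is run backwards, so that it starts at a constant loop, along which the single
   angle [t0] serves. *)
pose q (z : R * R) := H (clamp (1 - z.1), clamp z.2).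
have cq : continuous q.
  apply: (@continuous_within_comp _ _ _ _ (fun z : R * R => (clamp (1 - z.1), clamp z.2)) H cH).
    move=> z; have h1 : (fun z : R * R => clamp (1 - z.1)) @ z --> clamp (1 - z.1).
      apply: (@continuous_comp _ _ _ (fun z : R * R => 1 - z.1) (@clamp R)); last exact: clamp_continuous.
      by apply: cvgB; [exact: cvg_cst|exact: cvg_fst].
    have h2 : (fun z : R * R => clamp z.2) @ z --> clamp z.2.
      by apply: (@continuous_comp _ _ _ snd (@clamp R)); [exact: cvg_snd|exact: clamp_continuous].
    exact: (cvg_pair h1 h2).
  by move=> z; split; rewrite /= in_itv /= clamp_itv.
have cAq : continuous (A \o q) by move=> z; apply: continuous_comp; [exact: cq|exact: cA].
have cBq : continuous (B \o q) by move=> z; apply: continuous_comp; [exact: cq|exact: cB].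
have q0 s : q (0, s) = p 0.
  by rewrite /q /= subr0 (clamp_id i1) H1 // in_itv /= clamp_itv.
have q1 s : 0 <= s <= 1 -> q (1, s) = p s.
  by move=> s01; rewrite /q /= subrr (clamp_id i0) (clamp_id s01) H0 // in_itv.
have q0' s : `[0, 1]%classic s -> cos t0 = A (q (0, s)) /\ sin t0 = B (q (0, s)).
  by rewrite q0.
have [th [cth thE thc]] :=
  homotopy_lift (@segment_compact R 0 1) cAq cBq (fun z => AB1 (q z)) q0'.
exists th => [t t01|].
  have [|ct st] := thE t; first by rewrite /= in_itv.
  by rewrite /= (q1 _ t01) in ct st; split=> //; apply: cth; rewrite /= in_itv.
have cl s : clamp (1 - s) \in `[(0 : R), 1] by rewrite in_itv /= clamp_itv.
rewrite !thc ?subrr //= ?in_itv //= => s _; rewrite q0 /q /= ?(clamp_id i0) ?(clamp_id i1).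
  by have [-> _] := Hend _ (cl s).
by have [_ ->] := Hend _ (cl s).
Qed.

Definition path_cat (p q : R -> X) (t : R) := if t <= 2^-1 then p (2 * t) else q (2 * t - 1).

Lemma path_cat_continuous (p q : R -> X) : continuous p -> continuous q ->
  p 1 = q 0 -> continuous (path_cat p q).
Proof.
move=> cp cq pq.
apply: (@continuous_glue R X (fun t => p (2 * t)) (fun t => q (2 * t - 1)) 2^-1).
- move=> t; apply: (@continuous_comp _ _ _ (fun t : R => 2 * t) p); last exact: cp.
  by apply: cvgM; [exact: cvg_cst|exact: cvg_id].
- move=> t; apply: (@continuous_comp _ _ _ (fun t : R => 2 * t - 1) q); last exact: cq.
  by apply: cvgB; [apply: cvgM; [exact: cvg_cst|exact: cvg_id]|exact: cvg_cst].
- by rewrite divff ?pnatr_eq0 // subrr.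
Qed.

(** Instead of gluing lifts, a lift of the concatenation is cut into its two halves, whose turns are
    [d] and [e] by uniqueness. *)
Lemma turn_cat (p q : R -> X) d e : continuous p -> continuous q -> p 1 = q 0 ->
  turn p d -> turn q e -> turn (path_cat p q) (d + e).
Proof.
move=> cp cq pq tp tq.
have [w [th l thw]] := turn_exists (path_cat_continuous cp cq pq).
have comp (g : R -> R) t : {for t, continuous g} -> 0 <= g t <= 1 ->
    {for t, continuous (th \o g)}.
  by move=> cg g01; apply: continuous_comp => //; have [] := l _ g01.
have tp' : turn p (th 2^-1 - th 0).
  exists (fun t => th (t / 2)); last by rewrite mul0r mul1r.
  move=> t t01; have g01 : 0 <= t / 2 <= 1 by lra.
  have [_ c s] := l _ g01; rewrite c s /path_cat ifT; last by lra.
  rewrite mulrCA divff ?pnatr_eq0 // mulr1; split=> //.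
  by apply: (comp (fun t => t / 2)) => //; apply: cvgM; [exact: cvg_id|exact: cvg_cst].
have tq' : turn q (th 1 - th 2^-1).
  exists (fun t => th ((t + 1) / 2)); last by congr (th _ - th _); lra.
  move=> t t01; have g01 : 0 <= (t + 1) / 2 <= 1 by lra.
  have [_ c s] := l _ g01.
  have cat : path_cat p q ((t + 1) / 2) = q t.
    rewrite /path_cat; case: ifP => h.
      have -> : t = 0 by lra.
      by rewrite add0r mul1r divff ?pnatr_eq0.
    by congr q; lra.
  rewrite c s cat; split=> //.
  apply: (comp (fun t => (t + 1) / 2)) => //; apply: cvgM; last exact: cvg_cst.
  by apply: cvgD; [exact: cvg_id|exact: cvg_cst].
exists th => //; rewrite (turn_uniq tp tp') (turn_uniq tq tq'); lra.
Qed.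

End Turning.

(** * Continuous arguments and multipliers on simply connected spaces *)

Section SimplyConnectedLift.
Variables (R : realType) (X : topologicalType).
Hypothesis sc : simply_connected R X.

Lemma simply_connected_path (x y : X) :
  exists p : R -> X, [/\ continuous p, p 0 = x & p 1 = y].
Proof.
have [_ /(_ x y)[g [cg g0 g1]] _] := sc; exists (g \o @clamp R); split.
- apply: (continuous_within_comp cg (@clamp_continuous R)) => t.
  by rewrite /= in_itv /= clamp_itv.
- by rewrite /= clamp_id ?lexx ?ler01.
- by rewrite /= clamp_id ?lexx ?ler01.
Qed.

(** Path-connectedness im kleinen at every point, the form in which continuity of the lift uses
    it. *)
Definition locally_path_connected := forall (x : X) (N : set X), nbhs x N ->
  \forall y \near x, exists p : R -> X,
    [/\ continuous p, p 0 = x, p 1 = y & forall t, N (p t)].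

Hypothesis lpc : locally_path_connected.

(** The value [u x] is a base angle at [x0] plus the turn along any path from [x0] to [x]. *)
Lemma circle_valued_lift (A B : X -> R) : continuous A -> continuous B ->
  (forall x, on_circle (A x) (B x)) ->
  exists2 u : X -> R, continuous u & forall x, cos (u x) = A x /\ sin (u x) = B x.
Proof.
move=> cA cB AB1; have [[x0 _] _ _] := sc.
have [t0 [ct0 st0]] := circle_angle (AB1 x0).
(* Closing both paths by the same return path [r] gives loops of turn 0, so both turns are minus
   that of [r]. *)
have ends (p q : R -> X) d e : continuous p -> continuous q -> p 0 = q 0 -> p 1 = q 1 ->
    turn A B p d -> turn A B q e -> d = e.
  move=> cp cq pq0 pq1 tp tq.
  have [r [cr r0 r1]] := simply_connected_path (p 1) (p 0).
  have [w tr] := turn_exists cA cB AB1 cr.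
  have loop (s : R -> X) c : continuous s -> s 0 = p 0 -> s 1 = p 1 ->
      turn A B s c -> c + w = 0.
    move=> cs s0 s1 ts; have sr : s 1 = r 0 by rewrite s1 r0.
    have c' := path_cat_continuous cs cr sr.
    apply: (turn_uniq AB1 (turn_cat cA cB AB1 cs cr sr ts tr)).
    apply: (turn_loop cA cB AB1 sc c').
    rewrite /path_cat ifT ?invr_ge0 ?ler0n // mulr0 s0 ifF; last by apply/negbTE; lra.
    by rewrite -r1; congr r; lra.
  have := loop p d cp erefl erefl tp; have := loop q e cq (esym pq0) (esym pq1) tq.
  by move=> <- /addIr.
have [u uE] : {u : X -> R | forall (p : R -> X) d, continuous p -> p 0 = x0 ->
    turn A B p d -> u (p 1) = t0 + d}.
  have h x : {d | exists p : R -> X, [/\ continuous p, p 0 = x0, p 1 = x & turn A B p d]}.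
    apply: cid; have [p [cp p0 p1]] := simply_connected_path x0 x.
    by have [d tp] := turn_exists cA cB AB1 cp; exists d, p.
  exists (fun x => t0 + sval (h x)) => p d cp p0 tp; congr (_ + _).
  have [q [cq q0 q1 tq]] := svalP (h (p 1)).
  by apply: (ends q p) => //; rewrite q0 p0.
have uD (p : R -> X) d : continuous p -> turn A B p d -> u (p 1) = u (p 0) + d.
  move=> cp tp; have [q [cq q0 q1]] := simply_connected_path x0 (p 0).
  have [e tq] := turn_exists cA cB AB1 cq.
  rewrite -q1 (uE q e cq q0 tq) -addrA.
  have <- : path_cat q p 1 = p 1.
    by rewrite /path_cat ifF; [congr p; lra|apply/negbTE; lra].
  apply: uE; first exact: path_cat_continuous.
    by rewrite /path_cat ifT ?invr_ge0 ?ler0n // mulr0.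
  exact: turn_cat.
have uAB x : cos (u x) = A x /\ sin (u x) = B x.
  have [p [cp p0 p1]] := simply_connected_path x0 x.
  have [d tp] := turn_exists cA cB AB1 cp; rewrite -p1 (uE p d cp p0 tp).
  have [th l <-] := tp.
  have i0 : 0 <= (0 : R) <= 1 by rewrite lexx ler01.
  have i1 : 0 <= (1 : R) <= 1 by rewrite lexx ler01.
  have [_ c0 s0] := l 0 i0; have [_ <- <-] := l 1 i1.
  (* [t0] and [th 0] are both arguments at [x0], so shifting by their difference changes neither
     cosine nor sine. *)
  have ct : cos (t0 - th 0) = 1 by rewrite cosB ct0 st0 c0 s0 p0 -!expr2 AB1.
  have st : sin (t0 - th 0) = 0 by rewrite sinB ct0 st0 c0 s0 p0 mulrC subrr.
  have -> : t0 + (th 1 - th 0) = th 1 + (t0 - th 0) by ring.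
  by rewrite cosD (sinD (th 1)) ct st !mulr1 !mulr0 subr0 addr0.
exists u => // x.
pose N := [set y | 0 < A x * A y + B x * B y].
have cN : {for x, continuous (fun y => A x * A y + B x * B y)}.
  by apply: cvgD; apply: cvgM; [exact: cvg_cst|exact: cA|exact: cvg_cst|exact: cB].
have nN : nbhs x N.
  by apply: (cvgr_gt _ cN); rewrite -!expr2 AB1.
(* Along a path from [x] to [y] inside [N] the turn is a single arcsine step, which is continuous in
   [y]. *)
pose st y := angle_step (A x) (B x) (A y) (B y).
have cst y : N y -> {for y, continuous st}.
  move=> Ny; apply: (@continuous_comp _ _ _ (fun y => A x * B y - B x * A y)).
    by apply: cvgB; apply: cvgM; [exact: cvg_cst|exact: cB|exact: cvg_cst|exact: cA].
  by apply: continuous_asin; exact: cross_bound.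
have st0' : st x = 0 by rewrite /st /angle_step mulrC subrr asin0.
have near_u : \forall y \near x, u x + st y = u y.
  apply: filterS (lpc nN) => y [p [cp p0 p1 Np]].
  have tp : turn A B p (st y).
    exists (fun t => u x + st (p t)); last by rewrite p0 p1 st0'; ring.
    move=> t _; have [cu su] := uAB x.
    have [c s] := angle_stepP (AB1 x) (AB1 (p t)) (Np t) cu su.
    split=> //; apply: cvgD; first exact: cvg_cst.
    by apply: (continuous_comp (cp t)); exact: cst.
  by rewrite -p1 (uD p (st y) cp tp) p0 p1.
have cux : (fun y => u x + st y) @ x --> u x.
  by rewrite -[X in _ --> X]addr0 -st0'; apply: cvgD; [exact: cvg_cst|apply: cst; exact: nbhs_singleton nN].
rewrite /prop_for /continuous_at; apply: cvg_trans cux.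
exact: near_eq_cvg near_u.
Qed.

Hypothesis cX : compact [set: X].

(** At a maximum of [v] the shift gives [d <= 0], at a minimum [d >= 0]. *)
Lemma compact_shift_eq0 (f : X -> X) (v : X -> R) (d : R) : continuous v ->
  (forall x, v (f x) = v x + d) -> d = 0.
Proof.
move=> cv vf; have [[x0 _] _ _] := sc.
have T0 : [set: X] !=set0 by exists x0.
have cvT : {within [set: X], continuous v} by exact: continuous_subspaceT.
have [x _ /(_ (f x) (in_setT _))] := compact_EVT_max T0 cX cvT.
have [y _ /(_ (f y) (in_setT _))] := compact_EVT_min T0 cX cvT.
by rewrite !vf; lra.
Qed.

(* f shifts the continuous argument of A + i B by a constant, which is 0 because
   the argument is bounded. *)
Lemma unit_multiplier_trivial (f : X -> X) (A B : X -> R) (a b : R) : continuous f ->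
  continuous A -> continuous B -> (forall x, on_circle (A x) (B x)) ->
  (forall x, A (f x) = a * A x - b * B x /\ B (f x) = a * B x + b * A x) ->
  a = 1 /\ b = 0.
Proof.
move=> cf cA cB AB1 rot; have [u cu uAB] := circle_valued_lift cA cB AB1.
have Dab x : cos (u (f x) - u x) = a /\ sin (u (f x) - u x) = b.
  have [c s] := uAB x; have [cf' sf'] := uAB (f x); have [e e'] := rot x.
  have n := AB1 x; rewrite /on_circle in n.
  by rewrite cosB sinB c s cf' sf' e e'; split; rewrite -[RHS]mulr1 -n; ring.
have [[x0 _] _ _] := sc.
have D0 : u (f x0) - u x0 = 0.
  apply: (@compact_shift_eq0 f u) => // x.
  have [p [cp p0 p1]] := simply_connected_path x0 x.
  suff : u (f (p 1)) - u (p 1) = u (f (p 0)) - u (p 0) by rewrite p0 p1; lra.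
  apply: (@no_jump R (fun t => u (f (p t)) - u (p t))) => t _.
    apply: cvgB; last by apply: (continuous_comp (cp t)); exact: cu.
    by apply: (continuous_comp (continuous_comp (cp t) (cf _))); exact: cu.
  have [c s] := Dab (p t); have [c0 s0] := Dab (p 0).
  by rewrite cosB c s c0 s0 -c0 -s0 -!expr2 cos2Dsin2.
by have [<- <-] := Dab x0; rewrite D0 cos0 sin0.
Qed.

(** Modulus and argument are treated separately: [f] shifts [ln |G|^2] by [ln |c|^2], which is
    therefore 0, and then [G / |G|] is a circle-valued map that [f] multiplies by [c]. *)
Lemma multiplier_trivial (f : X -> X) (G : X -> R[i]) (c : R[i]) : continuous f ->
  continuous (fun x => complex.Re (G x)) -> continuous (fun x => complex.Im (G x)) ->
  (forall x, G x != 0) -> (forall x, G (f x) = c * G x) -> c = 1.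
Proof.
move=> cf cRe cIm G0 Gf; have [[x0 _] _ _] := sc.
pose n2 x := complex.Re (G x) ^+ 2 + complex.Im (G x) ^+ 2.
have n2_gt0 x : 0 < n2 x.
  have := G0 x; rewrite /n2; case: (G x) => p q /=.
  rewrite eq_complex /= negb_and.
  by case/orP=> h; [rewrite ltr_pwDl|rewrite ltr_wpDl]; rewrite ?sqr_ge0 // exprn_even_gt0.
case: c Gf => a b Gf.
pose m := a ^+ 2 + b ^+ 2.
have n2f x : n2 (f x) = m * n2 x.
  by rewrite /n2 Gf /m; case: (G x) => p q /=; ring.
have cn2 : continuous n2.
  by move=> x; apply: cvgD; apply: cvgM; [exact: cRe|exact: cRe|exact: cIm|exact: cIm].
have m1 : m = 1.
  have m0 : 0 < m by have := n2_gt0 (f x0); rewrite n2f pmulr_lgt0.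
  apply/eqP; rewrite -ln_eq0 //; apply/eqP.
  apply: (@compact_shift_eq0 f (fun x => ln (n2 x))) => [x|x].
    by apply: (continuous_comp (cn2 x)); exact: continuous_ln.
  by rewrite n2f lnM ?posrE // addrC.
pose n x := Num.sqrt (n2 x).
have n_gt0 x : 0 < n x by rewrite sqrtr_gt0.
have nf x : n (f x) = n x by rewrite /n n2f m1 mul1r.
have cn : continuous n by move=> x; apply: (continuous_comp (cn2 x)); exact: sqrt_continuous.
have cdiv (F : X -> R) : continuous F -> continuous (fun x => F x / n x).
  by move=> cF x; apply: cvgM; [exact: cF|apply: cvgV; [rewrite gt_eqF|exact: cn]].
have [x|x|a1 b0] := unit_multiplier_trivial (a := a) (b := b) cf (cdiv _ cRe) (cdiv _ cIm).
- rewrite /on_circle !expr_div_n -mulrDl sqr_sqrtr ?(ltW (n2_gt0 x)) // divff // gt_eqF //; exact: n2_gt0.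
- by rewrite /= nf Gf; case: (G x) => p q /=; split; ring.
- by rewrite a1 b0.
Qed.

End SimplyConnectedLift.

(** * Multipliers *)

Section ComplexExponential.
Variable R : realType.

HB.instance Definition _ :=
  GRing.isZmodMorphism.Build R[i] (cstar R) (@cexp_star R) (@cexp_starB R).

Lemma cexp_star_surj (c : cstar R) : exists z, cexp_star z = c.
Proof.
have := cval_neq0 c; case e : (cval c) => [a b].
rewrite eq_complex /= negb_and => ab0.
pose n2 := a ^+ 2 + b ^+ 2.
have n2_gt0 : 0 < n2.
  by case/orP: ab0 => h; [rewrite ltr_pwDl|rewrite ltr_wpDl]; rewrite ?sqr_ge0 // exprn_even_gt0.
pose r := Num.sqrt n2; have r_gt0 : 0 < r by rewrite sqrtr_gt0.
have [|t [ct st]] := @circle_angle R (a / r) (b / r).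
  by rewrite /on_circle !expr_div_n -mulrDl sqr_sqrtr ?(ltW n2_gt0) // divff // gt_eqF.
exists (ln r +i* t)%C; apply: val_inj => /=; rewrite e lnK ?posrE // ct st.
by rewrite ![r * _]mulrC !divfK ?gt_eqF.
Qed.

End ComplexExponential.

Section Manifold.
Variables (R : realType) (X : complex_manifold R).

(** Balls are convex, so the paths are segments drawn in a chart. *)
Lemma manifold_locally_path_connected : locally_path_connected R X.
Proof.
move=> x N nN; have [c [ac cx]] := atlas_cover x.
pose r0 := cmap c x.
have r0c : cimg c r0 by exists x.
have h1 : nbhs r0 (cimg c) by apply: open_nbhs_nbhs; split=> //; exact: cimg_open.
have h2 : nbhs r0 (cinv c @^-1` N).
  by apply: (cinv_continuous r0c); rewrite cmapK.
have [e /= e0 he] : nbhs_ball r0 (cimg c `&` cinv c @^-1` N).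
  by apply/nbhs_ballP; exact: filterI.
have h3 : nbhs x (cdom c) by apply: open_nbhs_nbhs; split=> //; exact: cdom_open.
have h4 : nbhs x (cmap c @^-1` ball r0 e).
  by apply: (cmap_continuous cx); exact: nbhsx_ballx.
apply: filterS2 h3 h4 => y cy /= ye.
pose q t := r0 + clamp t *: (cmap c y - r0).
have qe t : ball r0 e (q t).
  move: ye; rewrite -!ball_normE /= /q opprD addNKr normrN normrZ distrC.
  apply: le_lt_trans; rewrite ler_piMl // ger0_norm; by case/andP: (clamp_itv t).
have cq : continuous q.
  move=> t; apply: cvgD; first exact: cvg_cst.
  by apply: cvgZl; exact: clamp_continuous.
exists (cinv c \o q); split=> [t| | |t].
- by apply: (continuous_comp (cq t)); apply: cinv_continuous; have [] := he _ (qe t).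
- by rewrite /= /q clamp_id ?lexx ?ler01 // scale0r addr0 cmapK.
- by rewrite /= /q clamp_id ?lexx ?ler01 // scale1r addrC subrK cmapK.
- by have [] := he _ (qe t).
Qed.

Lemma smooth_fun_continuous (u : dsec (fun _ : X => R[i]) (Opens openT)) : smooth_fun u ->
  continuous (fun x => complex.Re (u x I)) /\ continuous (fun x => complex.Im (u x I)).
Proof.
move=> su.
have gen (F : R[i] -> R) :
    (forall c, atlas c -> smooth (chart_set c (Opens openT)) (fun r => F (ext0 u (cinv c r)))) ->
    continuous (fun x => F (u x I)).
  move=> sF x; have [c [ac cx]] := atlas_cover x.
  have cr : chart_set c (Opens openT) (cmap c x) by split=> //; exists x.
  have h := sF c ac 0%N _ cr.
  have := continuous_comp (cmap_continuous cx) h.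
  rewrite /prop_for /continuous_at /= cmapK // (ext0E _ (I : (Opens openT : opens X) x)).
  apply: cvg_trans; apply: near_eq_cvg.
  apply: filterS (open_nbhs_nbhs (conj (cdom_open c) cx)) => y cy.
  by rewrite /= cmapK // (ext0E _ (I : (Opens openT : opens X) y)).
by split; apply: gen => c ac; have [] := su c ac.
Qed.

Variables (f : X -> X) (sf : smooth_map f).
Let cf := smooth_map_continuous sf.

Lemma smooth_fun_of_const (M : zmodType) (phi : M -> R[i]) (U : opens X)
    (s : dsec (fun _ => M) U) :
  locally_constant s -> smooth_fun (fun x h => phi (s x h)).
Proof.
move=> cs; apply: smooth_fun_const => x Ux; have [V [VU [Vx e]]] := cs x Ux.
by exists V, VU; split=> // y Vy; rewrite e.
Qed.

Definition const_A_hom (z : R[i]) : fhom (const_fsheaf cf int) (A_bullet sf) :=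
  fun_fhom (P := const_funpred cf int) (Q := A_funpred sf)
    (mulrzBr z) (@smooth_fun_of_const int (fun n => z *~ n)).

(** As [cstar] is written additively, [c *~ n] is the power [c^n]; the section 1 goes to the
    constant function [c]. *)
Definition const_Astar_hom (c : cstar R) : fhom (const_fsheaf cf int) (Astar_bullet sf) :=
  fun_fhom (P := const_funpred cf int) (Q := Astar_funpred sf)
    (mulrzBr c) (@smooth_fun_of_const int (fun n => cval (c *~ n))).

Lemma const_Astar_homB : {morph const_Astar_hom : c d / c - d}.
Proof.
move=> c d; apply: val_inj; apply: shom_eqP => U s; apply: val_inj.
by apply: dsec_eqP => x Ux; exact: mulrzBl.
Qed.

Lemma exp_const_A_hom (z : R[i]) :
  fcomp (exp_A sf) (const_A_hom z) = const_Astar_hom (cexp_star z).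
Proof.
apply: val_inj; apply: shom_eqP => U s; apply: val_inj.
by apply: dsec_eqP => x Ux; exact: (raddfMz (@cexp_star R)).
Qed.

Section Multiplier.
Variable J : inj_resolution (Astar_bullet sf).

Definition multiplier_class (c : cstar R) : cohomology cf J 1 :=
  twist_class cf J (const_Astar_hom c).

Lemma multiplier_classB : {morph multiplier_class : c d / c - d}.
Proof. by move=> c d; rewrite /multiplier_class const_Astar_homB twist_classB. Qed.

(** Multiplicatively the last equation is [G o f = c G]. The function [G] is the value of [g] at the
    global section 1, which pullback fixes. *)
Lemma multiplier_class_eq0 (c : cstar R) : multiplier_class c = 0 ->
  exists G : X -> cstar R, [/\ continuous (fun x => complex.Re (cval (G x))),
    continuous (fun x => complex.Im (cval (G x))) & forall x, G (f x) = c + G x].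
Proof.
move=> /twist_class_eq0[g gE].
pose T : opens X := Opens openT.
have lc1 : locally_constant (fun x (_ : T x) => 1 : int).
  by move=> x Tx; exists T, (@subset_refl _ T).
pose one : const_fsheaf cf int T := @sub_mk _ (lp_subgroup (const_funpred cf int) T) _ lc1.
pose G x := sub_val (g T one) x I.
have [cR cI] := smooth_fun_continuous (subgroupV (g T one)).
exists G; split=> // x.
pose TT : opens_pre cf T `<=` T := fun y _ => I.
have pull1 : pull cf one = res TT one.
  by apply: val_inj; apply: dsec_eqP => y Ty; exact: germ_value_germ.
have := gE T one; rewrite pull1 shom_res => /(congr1 val).
move=> /(congr1 (fun u : dsec (fun _ : X => cstar R) (opens_pre cf T) => u x I)).
move=> e; have {}e : sub_val (pull cf (g T one)) x I - G x = c by exact: e.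
have -> : G (f x) = sub_val (pull cf (g T one)) x I by exact/esym/germ_value_germ.
by rewrite -e subrK.
Qed.

End Multiplier.

End Manifold.

Section MultiplierKernel.
Variables (R : realType) (X : complex_manifold R) (f : X -> X) (sf : smooth_map f).
Let cf := smooth_map_continuous sf.

Lemma connecting_multiplier_class (S : ses_resolution (Z1_to_A sf) (exp_A sf)) (c : cstar R) :
  coh_connecting cf S 1 (multiplier_class (sesC S) c) = 0.
Proof.
have [z <-] := cexp_star_surj c; rewrite /multiplier_class -exp_const_A_hom.
exact: (connecting_twist_class cf S).
Qed.

Lemma multiplier_class_inj (J : inj_resolution (Astar_bullet sf)) :
  compact [set: X] -> simply_connected R X -> injective (multiplier_class J).
Proof.
move=> cX sc c d cd; apply/eqP; rewrite -subr_eq0; apply/eqP.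
have [|G [cRe cIm Gf]] := multiplier_class_eq0 (J := J) (c := c - d).
  by rewrite multiplier_classB cd subrr.
apply: val_inj; apply: (multiplier_trivial sc (@manifold_locally_path_connected R X) cX
  (G := fun x => cval (G x)) cf cRe cIm) => x; first exact: cval_neq0.
by rewrite Gf.
Qed.

End MultiplierKernel.

(** * Coinduced sheaves over a point *)

Definition divisible (M : zmodType) := forall (n : nat) (y : M),
  (0 < n)%N -> exists z, z *+ n = y.

(** * Divisible groups are injective *)

Section DivisibleExtension.
Variables (A B M : zmodType) (m : A -> B) (h : A -> M).
Hypotheses (mB : {morph m : x y / x - y}) (hB : {morph h : x y / x - y}).
Hypotheses (m_inj : injective m) (divM : divisible M).

(* Graphs of homomorphisms from subgroups of B to M extending h along m; the
   empty graph is allowed so that unions of empty chains qualify. *)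
Let ext_graph (G : set (B * M)) :=
  [/\ forall u v, G u -> G v -> G (u - v), forall y, G (0, y) -> y = 0 &
      G !=set0 -> forall a, G (m a, h a)].

Let m0 : m 0 = 0. Proof. by rewrite -[in LHS](subrr 0) mB subrr. Qed.
Let h0 : h 0 = 0. Proof. by rewrite -[in LHS](subrr 0) hB subrr. Qed.

Let graph0 : ext_graph [set u | exists a, u = (m a, h a)].
Proof.
split=> [u v [a ->] [b ->]|y [a [ma ->]]|_ a]; last by exists a.
  by exists (a - b); rewrite mB hB.
by have -> : a = 0 by apply: m_inj; rewrite m0.
Qed.

Section Closure.
Variable G : set (B * M).
Hypotheses (GB : forall u v, G u -> G v -> G (u - v)) (G0 : G 0).

Let GN u : G u -> G (- u). Proof. by move=> Gu; rewrite -sub0r; exact: GB. Qed.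
Let GD u v : G u -> G v -> G (u + v).
Proof. by move=> Gu Gv; rewrite -[v]opprK; apply: GB => //; exact: GN. Qed.

Lemma graph_mulz u (n : int) : G u -> G (u *~ n).
Proof.
move=> Gu; have Gn k : G (u *+ k).
  by elim: k => [|k IH]; [rewrite mulr0n|rewrite mulrS; exact: GD].
by case: n => k; [exact: Gn|rewrite NegzE mulrNz; apply: GN; exact: Gn].
Qed.

Hypothesis Gfun : forall y, G (0, y) -> y = 0.

(** The value that [b] may receive: if [d] is the least positive integer with [d b] in the domain of
    [G], then [c] is a [d]-th part of the value at [d b]. Division with remainder shows that [d]
    divides every [n] with [n b] in the domain. *)
Lemma graph_multiple (b : B) :
  exists c : M, forall (n : int) y, G (b *~ n, y) -> y = c *~ n.
Proof.
pose Q (n : nat) := (0 < n)%N && `[< exists y, G (b *+ n, y) >].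
have [exQ|nQ] := pselect (exists n, Q n).
  case: (ex_minnP exQ) => d /andP[d0 /asboolP[y Gy]] dmin.
  have [c cE] := divM y d0; exists c => n z Gz.
  have dn0 : (d%:Z != 0) by rewrite eqz_nat -lt0n.
  have Gr : G (b *~ (n %% d)%Z, z - y *~ (n %/ d)%Z).
    have := GB Gz (graph_mulz (n %/ d)%Z Gy).
    rewrite (_ : _ - _ = (b *~ (n %% d)%Z, z - y *~ (n %/ d)%Z)) //.
    rewrite -[LHS]/(b *~ n - ((b *+ d, y) *~ (n %/ d)%Z).1, z - ((b *+ d, y) *~ (n %/ d)%Z).2).
    rewrite !(raddfMz fst, raddfMz snd) /=; congr pair.
    by rewrite {1}(divz_eq n d) mulrzDr pmulrn mulrzA_C addrC addKr.
  have r0 : (n %% d)%Z = 0.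
    have := ltz_pmod n (d := d); have := modz_ge0 n dn0.
    case: (n %% d)%Z Gr => // r Gr _ /(_ d0) rd.
    case: (posnP r) => [->//|r0].
    have /dmin : Q r by rewrite /Q r0; apply/asboolP; exists (z - y *~ (n %/ d)%Z).
    by rewrite leqNgt -ltz_nat rd.
  move: Gr; rewrite r0 mulr0z => /Gfun/eqP; rewrite subr_eq0 => /eqP ->.
  by rewrite [in RHS](divz_eq n d) r0 addr0 -cE pmulrn mulrzA_C.
(* No nonzero multiple of [b] lies in the domain here, so [b] can be given any value. *)
exists 0 => n y Gy; rewrite mul0rz.
case: (ltrgt0P n) Gy => [n0|n0|->]; last by rewrite mulr0z => /Gfun.
  case: n n0 => // k k0 Gy; case: nQ; exists k; rewrite /Q -ltz_nat k0.
  by apply/asboolP; exists y.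
case: n n0 => // k _ /GN Gy; case: nQ; exists k.+1; apply/asboolP; exists (- y).
by move: Gy; rewrite NegzE mulrNz -[- _]/(- - _, - y) opprK.
Qed.

End Closure.

(** Zorn's lemma: a maximal graph is total, for otherwise a missing [b] could be adjoined with the
    value from [graph_multiple]. *)
Lemma divisible_extension :
  exists2 k : B -> M, {morph k : x y / x - y} & forall a, k (m a) = h a.
Proof.
have [|G [[GB Gfun Gh] Gmax]] := @Zorn_bigcup (B * M)%type ext_graph.
  move=> F FP Ftot; split.
  - move=> u v [G FG Gu] [G' FG' Gv].
    have [GG'|G'G] := Ftot _ _ FG FG'.
      by exists G' => //; have [sub _ _] := FP _ FG'; apply: sub => //; exact: GG'.
    by exists G => //; have [sub _ _] := FP _ FG; apply: sub => //; exact: G'G.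
  - by move=> y [G FG Gy]; have [_ fn _] := FP _ FG; exact: fn.
  - move=> [u [G FG Gu]] a; exists G => //; have [_ _ hh] := FP _ FG.
    by apply: hh; exists u.
(* The empty graph is not maximal, being strictly contained in the graph of [h] on the image of
   [m]. *)
have Gne : G !=set0.
  apply: contrapT => Gempty; apply: (Gmax _ _ graph0); split=> [u Gu|sub].
    by case: Gempty; exists u.
  by apply: Gempty; exists (m 0, h 0); apply: sub; exists 0.
have G0 : G 0 by case: Gne => u Gu; rewrite -(subrr u); exact: GB.
have total b : exists y, G (b, y).
  have [c cE] := graph_multiple GB G0 Gfun b.
  pose G' : set (B * M) := [set u | exists v (n : int), G v /\ u = v + (b, c) *~ n].
  apply: contrapT => nb; apply: (Gmax G').
    split=> [u Gu|sub]; first by exists u, 0; rewrite mulr0z addr0.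
    by apply: nb; exists c; apply: sub; exists 0, 1; rewrite mulr1z add0r.
  split.
  - move=> _ _ [v [n [Gv ->]]] [v' [n' [Gv' ->]]]; exists (v - v'), (n - n').
    by split; [exact: GB|rewrite mulrzBr opprD addrACA].
  - move=> y [[v w] [n [Gv e]]].
    have : (v + b *~ n, w + c *~ n) = (0, y).
      by rewrite e -[RHS]/(v + ((b, c) *~ n).1, w + ((b, c) *~ n).2)
           !(raddfMz fst, raddfMz snd).
    case=> /eqP; rewrite addr_eq0 -mulrNz => /eqP vE <-.
    by rewrite vE in Gv; rewrite (cE _ _ Gv) mulrNz addNr.
  - by move=> _ a; exists (m a, h a), 0; rewrite mulr0z addr0; split=> //; exact: Gh.
have [k kG] : {k : B -> M | forall b, G (b, k b)}.
  by exists (fun b => sval (cid (total b))) => b; exact: (svalP (cid (total b))).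
have kE b y : G (b, y) -> k b = y.
  move=> Gy; apply/eqP; rewrite -subr_eq0; apply/eqP; apply: Gfun.
  by rewrite -(subrr b); exact: (GB _ _ (kG b) Gy).
exists k => [x y|a]; last by apply: kE; exact: Gh.
by apply: kE; exact: (GB _ _ (kG x) (kG y)).
Qed.

End DivisibleExtension.

(** * Sheaves of arbitrary functions, and coinduced sheaves *)

Section AllFunctions.
Variables (X : topologicalType) (f : X -> X) (cf : continuous f).

Section Predicate.
Variable V : zmodType.

Program Definition all_locpred : locpred (fun _ : X => V) :=
  @Locpred X _ (fun U s => True) _ _ _ _.
Solve All Obligations with by [].

Definition all_funpred : funpred cf V := @Funpred X f cf V all_locpred (fun _ _ _ => I).

End Predicate.

Section Twisted.
Variables (V : zmodType) (t : V -> V) (tB : {morph t : x y / x - y}).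

(** The action [s |-> t \o s \o f]; over a point this is the [Z[T]]-module [V] on which [T] acts by
    [t]. *)
Definition tw_act : shom (inv_image f (lp_sheaf (all_funpred V))) (lp_sheaf (all_funpred V)) :=
  shom_comp (fun_shom (P := all_funpred V) (Q := all_funpred V) tB (fun _ _ _ => I))
    (pullback_hom (all_funpred V)).

Definition tw_fsheaf : fsheaf f := FSheaf tw_act.

Lemma pull_tw (U : opens X) (s : tw_fsheaf U) x (Ux : U (f x)) :
  sub_val (pull cf s) x Ux = t (sub_val s (f x) Ux).
Proof. by congr t; exact: germ_value_germ. Qed.

Lemma fun_tw_comm (M : zmodType) (P : funpred cf M) (phi : M -> V)
    (phiB : {morph phi : x y / x - y}) (tphi : forall z, t (phi z) = phi z) :
  @fhom_comm X f (fun_fsheaf P) tw_fsheaf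
    (fun_shom (P := P) (Q := all_funpred V) phiB (fun _ _ _ => I)).
Proof.
apply/(fhom_commP cf) => U s; apply: val_inj; apply: dsec_eqP => x Ux.
apply: etrans _ (esym (pull_tw _ _)); rewrite /= tphi.
by congr phi; exact: germ_value_germ.
Qed.

Definition fun_tw_hom (M : zmodType) (P : funpred cf M) (phi : M -> V)
    (phiB : {morph phi : x y / x - y}) (tphi : forall z, t (phi z) = phi z) :
  fhom (fun_fsheaf P) tw_fsheaf :=
  @sub_mk _ (fhom_subgroup (fun_fsheaf P) tw_fsheaf) _ (fun_tw_comm P phiB tphi).

End Twisted.

Section Morphism.
Variables (V W : zmodType) (t : V -> V) (tB : {morph t : x y / x - y}).
Variables (t' : W -> W) (tB' : {morph t' : x y / x - y}).
Variables (phi : V -> W) (phiB : {morph phi : x y / x - y}).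
Hypothesis tphi : forall v, phi (t v) = t' (phi v).

Lemma tw_comm : @fhom_comm X f (tw_fsheaf tB) (tw_fsheaf tB')
  (fun_shom (P := all_funpred V) (Q := all_funpred W) phiB (fun _ _ _ => I)).
Proof.
apply/(fhom_commP cf) => U s; apply: val_inj; apply: dsec_eqP => x Ux.
apply: etrans _ (esym (pull_tw _ _)); rewrite /= -tphi.
by congr phi; exact: pull_tw.
Qed.

Definition tw_hom : fhom (tw_fsheaf tB) (tw_fsheaf tB') :=
  @sub_mk _ (fhom_subgroup (tw_fsheaf tB) (tw_fsheaf tB')) _ tw_comm.

Lemma tw_hom_inj : injective phi -> sheaf_inj (sub_val tw_hom).
Proof.
move=> phi_inj U s s' /(congr1 val)/= e; apply: val_inj; apply: dsec_eqP => x Ux.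
by apply: phi_inj; have := congr1 (fun u : dsec (fun _ : X => W) U => u x Ux) e.
Qed.

Lemma tw_hom_surj : (forall w, exists v, phi v = w) -> sheaf_surj (sub_val tw_hom).
Proof.
move=> phi_surj U s x Ux; exists U, (@subset_refl _ U).
pose g (y : X) (Uy : U y) := sval (cid (phi_surj (sub_val s y Uy))).
exists (@sub_mk _ (lp_subgroup (all_funpred V) U) g I); split=> //.
rewrite res_id; apply: val_inj; apply: dsec_eqP => y Uy.
exact: (svalP (cid (phi_surj (sub_val s y Uy)))).
Qed.

End Morphism.

Lemma tw_exact (V1 V2 V3 : zmodType) (t1 : V1 -> V1) (t2 : V2 -> V2) (t3 : V3 -> V3)
    (tB1 : {morph t1 : x y / x - y}) (tB2 : {morph t2 : x y / x - y})
    (tB3 : {morph t3 : x y / x - y}) (phi : V1 -> V2) (psi : V2 -> V3)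
    (phiB : {morph phi : x y / x - y}) (psiB : {morph psi : x y / x - y})
    (tphi : forall v, phi (t1 v) = t2 (phi v)) (tpsi : forall v, psi (t2 v) = t3 (psi v)) :
  (forall v, psi v = 0 <-> exists u, phi u = v) ->
  sheaf_exact (sub_val (tw_hom tB1 tB2 phiB tphi)) (sub_val (tw_hom tB2 tB3 psiB tpsi)).
Proof.
move=> ex U s; split=> [/(congr1 val)/= e|loc].
  have e' x (Ux : U x) : exists u, phi u = sub_val s x Ux.
    by apply/ex; have := congr1 (fun u : dsec (fun _ : X => V3) U => u x Ux) e.
  move=> x Ux; exists U, (@subset_refl _ U).
  exists (@sub_mk _ (lp_subgroup (all_funpred V1) U) (fun y Uy => sval (cid (e' y Uy))) I).
  split=> //; rewrite res_id; apply: val_inj; apply: dsec_eqP => y Uy.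
  exact: (svalP (cid (e' y Uy))).
apply: val_inj; apply: dsec_eqP => x Ux.
have [V [VU [u [Vx /(congr1 val)/= e]]]] := loc x Ux.
rewrite /=; apply/ex; exists (sub_val u x Vx).
have := congr1 (fun u : dsec (fun _ : X => V2) V => u x Vx) e.
by rewrite /= /dres => ->; congr (sub_val s x); exact: Prop_irrelevance.
Qed.

Section OnePoint.
Hypothesis X1 : forall x y : X, x = y.

Lemma fun_tw_inj (V : zmodType) (t : V -> V) (tB : {morph t : x y / x - y})
    (M : zmodType) (P : funpred cf M) (phi : M -> V)
    (phiB : {morph phi : x y / x - y}) (tphi : forall z, t (phi z) = phi z) :
  injective phi -> sheaf_inj (sub_val (fun_tw_hom tB P phiB tphi)).
Proof.
move=> phi_inj U s s' /(congr1 val)/= e; apply: val_inj; apply: dsec_eqP => x Ux.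
by apply: phi_inj; have := congr1 (fun u : dsec (fun _ : X => V) U => u x Ux) e.
Qed.

Lemma fun_tw_exact (V W : zmodType) (t : V -> V) (tB : {morph t : x y / x - y})
    (t' : W -> W) (tB' : {morph t' : x y / x - y})
    (M : zmodType) (P : funpred cf M) (phi : M -> V)
    (phiB : {morph phi : x y / x - y}) (tphi : forall z, t (phi z) = phi z)
    (psi : V -> W) (psiB : {morph psi : x y / x - y})
    (tpsi : forall v, psi (t v) = t' (psi v)) :
  (forall (U : opens X) (z : M), P U (fun _ _ => z)) ->
  (forall v, psi v = 0 <-> exists z, phi z = v) ->
  sheaf_exact (sub_val (fun_tw_hom tB P phiB tphi)) (sub_val (tw_hom tB tB' psiB tpsi)).
Proof.
move=> Pcst ex U s; split=> [/(congr1 val)/= e x Ux|loc].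
  have [z zE] : exists z, phi z = sub_val s x Ux.
    by apply/ex; have := congr1 (fun u : dsec (fun _ : X => W) U => u x Ux) e.
  exists U, (@subset_refl _ U), (@sub_mk _ (lp_subgroup P U) _ (Pcst U z)); split=> //.
  rewrite res_id; apply: val_inj; apply: dsec_eqP => y; rewrite (X1 y x) /= => Uy.
  by rewrite zE; congr (sub_val s x); exact: Prop_irrelevance.
apply: val_inj; apply: dsec_eqP => x Ux.
have [V' [VU [u [Vx /(congr1 val)/= e]]]] := loc x Ux.
rewrite /=; apply/ex; exists (sub_val u x Vx).
have := congr1 (fun u : dsec (fun _ : X => V) V' => u x Vx) e.
by rewrite /= /dres => ->; congr (sub_val s x); exact: Prop_irrelevance.
Qed.

End OnePoint.

Section Coinduced.

Definition shift (M : Type) (u : nat -> M) : nat -> M := fun n => u n.+1.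

Lemma shiftB (M : zmodType) : {morph @shift M : u v / u - v}.
Proof. by []. Qed.

Definition coind (M : zmodType) : fsheaf f := tw_fsheaf (@shiftB M).

(** Such maps commute with the shift. Two consecutive terms suffice for shift minus identity, and so
    for all the differentials that occur. *)
Definition rec_map (M N : Type) (a : M -> M -> N) (u : nat -> M) : nat -> N :=
  fun n => a (u n) (u n.+1).

Section Maps.
Variables (M N : zmodType) (a : M -> M -> N).
Hypothesis aB : forall x x' y y', a (x - x') (y - y') = a x y - a x' y'.

Lemma rec_mapB : {morph rec_map a : u v / u - v}.
Proof. by move=> u v; apply/funext => n; exact: aB. Qed.

Definition coind_hom : fhom (coind M) (coind N) :=
  tw_hom (@shiftB M) (@shiftB N) rec_mapB (fun _ => erefl).

End Maps.

Section Augmentation.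
Variables (M N : zmodType) (P : funpred cf M) (phi : M -> N).
Hypothesis phiB : {morph phi : x y / x - y}.

Lemma cst_mapB : {morph (fun z => (fun=> phi z) : nat -> N) : x y / x - y}.
Proof. by move=> x y; apply/funext => n; exact: phiB. Qed.

(** Constant sequences are fixed by the shift, as equivariance demands of the image of a sheaf whose
    action is pure pullback. *)
Definition coind_aug : fhom (fun_fsheaf P) (coind N) :=
  fun_tw_hom (@shiftB N) P cst_mapB (fun _ => erefl).

End Augmentation.

Section Injective.
Hypothesis X1 : forall x y : X, x = y.
Variables (x0 : X) (M : zmodType).
Hypothesis divM : divisible M.

Let T : opens X := Opens openT.
Let TT : T `<=` opens_pre cf T := fun y _ => I.

Lemma point_sub (U : opens X) x : U x -> T `<=` U.
Proof. by move=> Ux y _; rewrite (X1 y x). Qed.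

(** Multiplication by the variable of [Z[T]] on global sections. *)
Let global_act (F : fsheaf f) (s : F T) : F T := res TT (pull cf s).

Let global_actB (F : fsheaf f) n : {morph iter n (@global_act F) : s t / s - t}.
Proof.
by elim: n => [|n IH] s t //=; rewrite IH /global_act pullB resB.
Qed.

Let global_act_hom (F G : fsheaf f) (a : fhom F G) n (s : F T) :
  sub_val a T (iter n (@global_act F) s) = iter n (@global_act G) (sub_val a T s).
Proof. by elim: n => [|n IH] //=; rewrite /global_act shom_res fhom_pull IH. Qed.

Let coind_iter n (s : coind M T) k :
  sub_val (iter n (@global_act (coind M)) s) x0 I k = sub_val s x0 I (n + k)%N.
Proof.
elim: n k => [|n IH] k //=; rewrite addSnnS -IH.
rewrite -[LHS]/(sub_val (pull cf (iter n (@global_act (coind M)) s)) x0 (TT I) k).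
by rewrite pull_tw (X1 (f x0) x0) /shift.
Qed.

(* Over a point, a map to coind M amounts to a group homomorphism to M, the
   degree 0 component of its value on global sections. *)
Lemma coind_injective : injective_fsheaf (coind M).
Proof.
move=> A B m m_inj h.
pose h0 (a : A T) : M := sub_val (sub_val h T a) x0 I 0%N.
have h0B : {morph h0 : x y / x - y} by move=> x y; rewrite /h0 shomB.
have [k0 k0B k0E] := divisible_extension (@shomB _ _ _ (sub_val m) T) h0B (m_inj T) divM.
(* Equivariance forces the [n]-th term: it is the degree 0 component after [n] applications of the
   action. *)
pose k_fun (U : opens X) (b : B U) : dsec (fun _ => nat -> M) U :=
  fun x Ux n => k0 (iter n (@global_act B) (res (point_sub Ux) b)).
pose k_sec (U : opens X) (b : B U) : coind M U :=
  @sub_mk _ (lp_subgroup (all_funpred (nat -> M)) U) (k_fun U b) I.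
have kB (U : opens X) : {morph k_sec U : s t / s - t}.
  move=> s t; apply: val_inj; apply: dsec_eqP => x Ux; apply/funext => n.
  by rewrite /= /k_fun resB global_actB k0B.
have kr (U V : opens X) (VU : V `<=` U) (s : B U) : k_sec V (res VU s) = res VU (k_sec U s).
  apply: val_inj; apply: dsec_eqP => x Vx; apply/funext => n.
  by rewrite /= /k_fun /dres (res_res _ _ (point_sub (VU x Vx))).
have kc : @fhom_comm X f B (coind M) (Shom kB kr).
  apply/(fhom_commP cf) => U s; apply: val_inj; apply: dsec_eqP => x Ux.
  apply/funext => n; rewrite [RHS](congr1 (fun u => u n) (pull_tw _ _)).
  rewrite /= /shift /k_fun iterSr; congr (k0 (iter n _ _)).
  have TfU : opens_pre cf T `<=` opens_pre cf U by move=> y _; rewrite /= (X1 (f y) (f x)).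
  by rewrite /global_act (pull_res _ _ TfU) (res_res _ _ (point_sub (U := opens_pre cf U) Ux)).
exists (@sub_mk _ (fhom_subgroup B (coind M)) _ kc).
apply: val_inj; apply: shom_eqP => U a; apply: val_inj; apply: dsec_eqP => x Ux.
apply/funext => n; rewrite /= /k_fun -shom_res -global_act_hom k0E /h0 global_act_hom.
rewrite coind_iter addn0 shom_res /=.
have hx y (Uy : U y) : sub_val (sub_val h U a) y Uy = sub_val (sub_val h U a) x Ux.
  by case: _ / (X1 x y) Uy => Uy; rewrite (Prop_irrelevance Uy Ux).
exact: (congr1 (fun u : nat -> M => u n) (hx x0 _)).
Qed.

End Injective.
End Coinduced.
End AllFunctions.

(** * The point *)

Section KernelOfExponential.
Variable R : realType.

Lemma cos_eq1_small (b : R) : 0 <= b < 2 * pi -> cos b = 1 -> b = 0.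
Proof.
move=> /andP[b0 b2] cb; have p0 := pi_gt0 R.
have [bp|pb] := leP b pi.
  by apply: cos_inj; rewrite ?in_itv /= ?b0 ?bp ?lexx ?(ltW p0) ?cos0.
have : 2 * pi - b = 0; last by lra.
apply: cos_inj; rewrite ?in_itv /= ?lexx ?(ltW p0) ?cos0 //.
  by apply/andP; split; lra.
by rewrite (mulr_natl pi 2) -[_ - b]addrC cosD2pi cosN.
Qed.

Lemma cexp_star_eq0 (z : R[i]) : cexp_star z = 0 <-> twopiiZ R z.
Proof.
have w0 : cexp_star (0 +i* (2 * pi))%C = 0 :> cstar R.
  apply: val_inj => /=.
  by rewrite expR0 !mul1r (mulr_natl pi 2) cos2pi sin2pi.
split=> [|[k ->]]; last first.
  by rewrite raddfMz /= w0 mul0rz.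
move=> ez; pose p : R := 2 * pi; have p0 : 0 < p by rewrite mulr_gt0 ?pi_gt0.
(* Subtracting [k] periods brings the imaginary part into [[0, 2 pi[], where cosine 1 forces the
   value 0. *)
pose k := Num.floor (complex.Im z / p); exists k.
apply/eqP; rewrite -subr_eq0; apply/eqP.
have : cexp_star (z - (0 +i* p)%C *~ k) = 0.
  by rewrite raddfB raddfMz /= ez w0 mul0rz subrr.
move=> /(congr1 (@cval R)).
have -> : z - (0 +i* p)%C *~ k = (complex.Re z +i* (complex.Im z - p * k%:~R))%C.
  have -> : (0 +i* p)%C *~ k = (0 +i* (p * k%:~R))%C.
    rewrite -mulrzr.
    have -> : (k%:~R : R[i]) = (k%:~R)%:C%C by rewrite rmorph_int.
    move: (k%:~R) => q; apply/eqP; rewrite eq_complex /=; apply/andP; split; apply/eqP; ring.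
  by move: (p * _) => q; case: (z) => a b; apply/eqP; rewrite eq_complex /= subr0 !eqxx.
move: (complex.Re z) => a; set b := complex.Im z - _ => /= -[e1 e2].
have b01 : 0 <= b < p.
  have := floor_itv (complex.Im z / p); rewrite -/k => /andP[l u].
  rewrite ler_pdivlMr // in l; rewrite ltr_pdivrMr // intrD mulrDl mul1r in u.
  by rewrite /b (mulrC p); apply/andP; split; lra.
have ea : expR a = 1.
  have ea2 : expR a ^+ 2 = 1.
    transitivity (expR a ^+ 2 * (cos b ^+ 2 + sin b ^+ 2)).
      by rewrite cos2Dsin2 mulr1.
    transitivity ((expR a * cos b) ^+ 2 + (expR a * sin b) ^+ 2); first by ring.
    by rewrite e1 e2; ring.
  by apply/eqP; rewrite -(@eqrXn2 _ 2) // ?expR_ge0 // ea2 expr1n.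
have a0 : a = 0 by apply: expR_inj; rewrite ea expR0.
have -> : b = 0 by apply: cos_eq1_small => //; move: e1; rewrite ea mul1r.
by rewrite a0.
Qed.

End KernelOfExponential.

Section DivisibleGroups.
Variable R : realType.

Lemma divisible_C : divisible R[i].
Proof. by move=> n y n0; exists (y / n%:R); rewrite -[LHS]mulr_natr divfK // pnatr_eq0 -lt0n. Qed.

Lemma divisible_cstar : divisible (cstar R).
Proof.
move=> n c n0; have [z <-] := cexp_star_surj c; have [w <-] := divisible_C z n0.
by exists (cexp_star w); rewrite raddfMn.
Qed.

Lemma divisible_pair (M N : zmodType) : divisible M -> divisible N -> divisible (M * N)%type.
Proof.
move=> dM dN n [x y] n0; have [x' <-] := dM n x n0; have [y' <-] := dN n y n0.
exists (x', y'); by rewrite [LHS]surjective_pairing !(raddfMn fst, raddfMn snd).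
Qed.

Lemma divisible_trivial (M : zmodType) : (forall x : M, x = 0) -> divisible M.
Proof. by move=> M0 n y _; exists 0; rewrite (M0 y) mul0rn. Qed.

End DivisibleGroups.

Section Point.
Variable R : realType.

Definition pt : topologicalType := 'rV[R]_0.

Lemma pt_eq (x y : pt) : x = y. Proof. by apply/rowP => -[]. Qed.

Lemma rV00_eq (x y : 'rV[R]_(0 + 0)) : x = y. Proof. by apply/rowP => -[]. Qed.

Lemma rV00_open (U : set 'rV[R]_(0 + 0)) : U 0 -> open U.
Proof.
move=> U0; rewrite (_ : U = setT); first exact: openT.
by apply/seteqP; split=> // x _; rewrite (rV00_eq x 0).
Qed.

Lemma pt_cst_continuous (S : topologicalType) (g : pt -> S) : continuous g.
Proof. by rewrite (_ : g = fun=> g 0); [exact: cst_continuous|apply/funext => x; congr g; exact: pt_eq]. Qed.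

Lemma rV00_continuous (S : topologicalType) (g : 'rV[R]_(0 + 0) -> S) : continuous g.
Proof.
by rewrite (_ : g = fun=> g 0); [exact: cst_continuous|apply/funext => x; congr g; exact: rV00_eq].
Qed.

Lemma pt_img_open : open ((fun _ : pt => 0 : 'rV[R]_(0 + 0)) @` setT).
Proof. by apply: rV00_open; exists 0. Qed.

Definition pt_chart : chart R 0 pt :=
  @Chart R 0 pt setT (fun=> 0) (fun=> 0) openT pt_img_open
    (fun x _ => pt_eq _ _) (fun x _ => @pt_cst_continuous _ _ x)
    (fun r _ => @rV00_continuous _ _ r).

Lemma pt_second_countable : second_countable (T := pt).
Proof.
exists [set setT]; first exact: countable1.
split=> [_ ->|x U /= xU]; first exact: openT.
exists setT; first by [].
by move=> y _; rewrite /= (pt_eq y x); exact: nbhs_singleton.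
Qed.

Lemma rV0_differentiable (g : 'rV[CC R]_0 -> 'rV[CC R]_0) z : differentiable g z.
Proof.
rewrite (_ : g = cst 0); first exact: differentiable_cst.
by apply/funext => x; apply/rowP => -[].
Qed.

Definition pt_manifold : complex_manifold R :=
  @ComplexManifold R pt 0 [set pt_chart] (fun p q _ => pt_eq p q) pt_second_countable
    (fun x => ex_intro _ pt_chart (conj erefl I)) 
    (fun c c' _ _ r _ _ => rV0_differentiable _ _).

Lemma id_smooth : @smooth_map R pt_manifold id.
Proof. by split=> [x|c c' -> -> []]. Qed.

End Point.

(** * Resolutions by coinduced sheaves over a one-point space *)

Section CoinducedResolution.
Variables (X : topologicalType) (f : X -> X) (cf : continuous f).
Hypothesis X1 : forall x y : X, x = y.
Variable x0 : X.
Variables (N : zmodType) (P : funpred cf N) (M : nat -> zmodType).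
Variables (phi : N -> M 0) (a : forall n, M n -> M n -> M n.+1).
Hypotheses (phiB : {morph phi : x y / x - y}) (phi_inj : injective phi).
Hypothesis aB : forall n x x' y y', a (n := n) (x - x') (y - y') = a x y - a x' y'.
Hypothesis P_cst : forall (U : opens X) (z : N), P U (fun _ _ => z).
Hypothesis M_div : forall n, divisible (M n).
Hypothesis aug_ex : forall v : nat -> M 0,
  rec_map (@a 0) v = 0 <-> exists z, (fun=> phi z) = v.
Hypothesis dif_ex : forall n (v : nat -> M n.+1),
  rec_map (@a n.+1) v = 0 <-> exists u, rec_map (@a n) u = v.

Lemma coind_aug_inj : sheaf_inj (sub_val (coind_aug P phiB)).
Proof.
apply: fun_tw_inj => x y e; apply: phi_inj.
by have := congr1 (fun u : nat -> M 0 => u 0%N) e.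
Qed.

Lemma coind_aug_exact :
  sheaf_exact (sub_val (coind_aug P phiB)) (sub_val (coind_hom cf (@aB 0))).
Proof. by apply: (fun_tw_exact X1 _ _ _ _ _ P_cst); exact: aug_ex. Qed.

Lemma coind_dif_exact n :
  sheaf_exact (sub_val (coind_hom cf (@aB n))) (sub_val (coind_hom cf (@aB n.+1))).
Proof. by apply: tw_exact; exact: dif_ex. Qed.

Definition coind_resolution : inj_resolution (fun_fsheaf P) :=
  InjResolution (fun n => coind_injective X1 x0 (@M_div n))
    coind_aug_inj coind_aug_exact coind_dif_exact.

End CoinducedResolution.

(** * The exponential sequence of resolutions over the point *)

Section ExponentialResolution.
Variable R : realType.
Let X := pt_manifold R.
Let sf := id_smooth R.
Let cf := smooth_map_continuous sf.
Let C : zmodType := R[i].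
Let Cs : zmodType := cstar R.
Let O : zmodType := 'rV[int]_0.

Let O0 (x y : O) : x = y. Proof. by apply/rowP => -[]. Qed.

(* C^nat and (C^* )^nat, with d = shift - 1, resolve C and C^*.  MZ is the mapping
   cone of exp between these two complexes, and resolves Z(1); MB is the horseshoe
   resolution of C assembled from MZ and MC, with MBtwist as connecting term. *)
Definition MZ (n : nat) : zmodType :=
  match n with 0 => C | 1 => (C * Cs)%type | 2 => Cs | _ => O end.

Definition MZdif (n : nat) : MZ n -> MZ n -> MZ n.+1 :=
  match n return MZ n -> MZ n -> MZ n.+1 with
  | 0 => fun x y => (y - x, cexp_star x)
  | 1 => fun x y => cexp_star x.1 - (y.2 - x.2)
  | 2 => fun _ _ => 0
  | _ => fun _ _ => 0
  end.

Definition MC (n : nat) : zmodType := match n with 0 | 1 => Cs | _ => O end.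

Definition MCdif (n : nat) : MC n -> MC n -> MC n.+1 :=
  match n return MC n -> MC n -> MC n.+1 with
  | 0 => fun x y => y - x
  | _ => fun _ _ => 0
  end.

Definition MBtwist (n : nat) : MC n -> MZ n.+1 :=
  match n return MC n -> MZ n.+1 with
  | 0 => fun x => (0, - x)
  | 1 => fun x => - x
  | _ => fun _ => 0
  end.

Definition MB (n : nat) : zmodType := (MZ n * MC n)%type.

Definition MBdif (n : nat) (x y : MB n) : MB n.+1 :=
  (MZdif x.1 y.1 + MBtwist x.2, MCdif x.2 y.2).

Let subrBB (V : zmodType) (x y z t : V) : x - y - (z - t) = (x - z) - (y - t).
Proof. by rewrite !opprD !opprK addrACA. Qed.

Lemma MZdifB n (x x' y y' : MZ n) : MZdif (x - x') (y - y') = MZdif x y - MZdif x' y'.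
Proof.
case: n x x' y y' => [|[|[|n]]] /= x x' y y'; rewrite ?subr0 //.
  by congr pair; [rewrite subrBB|exact: cexp_starB].
by rewrite cexp_starB subrBB [in RHS]subrBB.
Qed.

Lemma MCdifB n (x x' y y' : MC n) : MCdif (x - x') (y - y') = MCdif x y - MCdif x' y'.
Proof. by case: n x x' y y' => [|n] x x' y y'; rewrite /= ?subr0 // subrBB. Qed.

Lemma MBtwistB n : {morph @MBtwist n : x y / x - y}.
Proof.
case: n => [|[|n]] x y /=; rewrite ?subr0 ?opprD //.
by congr pair; rewrite ?subr0 //= opprD.
Qed.

Lemma MBdifB n (x x' y y' : MB n) : MBdif (x - x') (y - y') = MBdif x y - MBdif x' y'.
Proof.
rewrite /MBdif /= MZdifB MCdifB MBtwistB; congr pair.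
by rewrite addrACA -opprD.
Qed.

Lemma MZ_div n : divisible (MZ n).
Proof.
case: n => [|[|[|n]]] /=; [exact: divisible_C| |exact: divisible_cstar|].
  by apply: divisible_pair; [exact: divisible_C|exact: divisible_cstar].
by apply: divisible_trivial => x; exact: O0.
Qed.

Lemma MC_div n : divisible (MC n).
Proof.
case: n => [|[|n]] /=; [exact: divisible_cstar|exact: divisible_cstar|].
by apply: divisible_trivial => x; exact: O0.
Qed.

Lemma MB_div n : divisible (MB n).
Proof. by apply: divisible_pair; [exact: MZ_div|exact: MC_div]. Qed.

(** The discrete primitive of [u] with initial value [c]; it shows that shift minus identity is onto
    on sequences. *)
Definition psum (V : zmodType) (c : V) (u : nat -> V) (n : nat) : V := c + \sum_(k < n) u k.

Lemma psumS (V : zmodType) (c : V) u n : psum c u n.+1 = psum c u n + u n.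
Proof. by rewrite /psum big_ord_recr addrA. Qed.

Lemma psum0 (V : zmodType) (c : V) u : psum c u 0 = c.
Proof. by rewrite /psum big_ord0 addr0. Qed.

Lemma dif_eq0_cst (V : zmodType) (u : nat -> V) :
  (forall n, u n.+1 - u n = 0) -> forall n, u n = u 0%N.
Proof. by move=> h; elim=> // n <-; apply/eqP; rewrite -subr_eq0 h. Qed.

Lemma rec_map_eq0 (M N : zmodType) (a : M -> M -> N) (v : nat -> M) :
  rec_map a v = 0 <-> forall n, a (v n) (v n.+1) = 0.
Proof. by split=> [e n|e]; [exact: (congr1 (@^~ n) e)|apply/funext => n; exact: e]. Qed.

Lemma rec_map_im (M N : zmodType) (a : M -> M -> N) (v : nat -> N) :
  (exists u, rec_map a u = v) <-> exists u : nat -> M, forall n, a (u n) (u n.+1) = v n.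
Proof.
split=> -[u e]; exists u; first by move=> n; rewrite -e.
by apply/funext => n; exact: e.
Qed.

Lemma MZ_aug_ex (v : nat -> MZ 0) :
  rec_map (@MZdif 0) v = 0 <-> exists z : Z1 R, (fun=> sub_val z) = v.
Proof.
rewrite rec_map_eq0; split=> [e|[z <-] n].
  have vc : forall n, v n = v 0%N by apply: dif_eq0_cst => n; exact: (congr1 fst (e n)).
  have z0 : cexp_star (v 0%N) = 0 := congr1 snd (e 0%N).
  by exists (sub_mk (proj1 (cexp_star_eq0 _) z0)); apply/funext => n; rewrite vc.
by rewrite /= subrr (proj2 (cexp_star_eq0 _) (subgroupV z)).
Qed.

Lemma MZ_dif_ex n (v : nat -> MZ n.+1) :
  rec_map (@MZdif n.+1) v = 0 <-> exists u, rec_map (@MZdif n) u = v.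
Proof.
rewrite rec_map_eq0 rec_map_im; case: n v => [|[|n]] v; last first.
- split=> _; last by case: n v.
  by exists (fun=> 0) => k; exact: O0.
- split=> _ //; exists (fun k => (0, - psum 0 v k)) => k /=.
  by rewrite (raddf0 (@cexp_star R)) sub0r psumS opprB opprK addKr.
split=> [e|[u uE] k].
  (* Only the initial term of the second component has to be lifted through the exponential; the
     cocycle condition propagates the equality to later terms. *)
  have [c cE] := cexp_star_surj (v 0%N).2.
  exists (psum c (fun k => (v k).1)) => k; rewrite [RHS]surjective_pairing /=.
  congr pair; first by rewrite psumS addrC addKr.
  elim: k => [|k IH]; first by rewrite psum0.
  rewrite psumS (raddfD (@cexp_star R)) /= IH.
  by have /eqP := e k; rewrite /= subr_eq0 => /eqP ->; rewrite addrC subrK.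
by rewrite -!uE /= cexp_starB subrr.
Qed.

Lemma MC_aug_ex (v : nat -> MC 0) :
  rec_map (@MCdif 0) v = 0 <-> exists z : Cs, (fun=> z) = v.
Proof.
rewrite rec_map_eq0; split=> [e|[z <-] n]; last by rewrite /= subrr.
by exists (v 0%N); apply/funext => n; rewrite (dif_eq0_cst e n).
Qed.

Lemma MC_dif_ex n (v : nat -> MC n.+1) :
  rec_map (@MCdif n.+1) v = 0 <-> exists u, rec_map (@MCdif n) u = v.
Proof.
rewrite rec_map_eq0 rec_map_im; case: n v => [|n] v; split=> _ //.
  by exists (psum 0 v) => k /=; rewrite psumS addrC addKr.
by exists (fun=> 0) => k; exact: O0.
Qed.

(** The term [MBtwist] turns one component of the differential into [exp x.1 - x.2], so on cocycles
    the second entry is the exponential of the first; hence the embedding [z |-> (z, exp z)]. *)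
Lemma MB_aug_ex (v : nat -> MB 0) :
  rec_map (@MBdif 0) v = 0 <-> exists z : C, (fun=> (z, cexp_star z)) = v.
Proof.
rewrite rec_map_eq0; split=> [e|[z <-] n]; last first.
  by rewrite /MBdif /= !subrr; congr (_, _); congr pair; rewrite /= ?addr0 ?subrr.
have e1 n : (v n.+1).1 - (v n).1 = 0 by have := congr1 (fun x : MB 1 => x.1.1) (e n); rewrite /= addr0.
have e2 n : cexp_star (v n).1 = (v n).2.
  by have /eqP := congr1 (fun x : MB 1 => x.1.2) (e n); rewrite /= subr_eq0 => /eqP.
exists (v 0%N).1; apply/funext => n; rewrite -(dif_eq0_cst e1 n) e2.
by rewrite -surjective_pairing.
Qed.

Lemma MB_dif_ex n (v : nat -> MB n.+1) :
  rec_map (@MBdif n.+1) v = 0 <-> exists u, rec_map (@MBdif n) u = v.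
Proof.
rewrite rec_map_eq0 rec_map_im; case: n v => [|[|n]] v; last first.
- split=> _; last by move=> k; congr pair; exact: O0.
  by exists (fun=> 0) => k; rewrite [RHS]surjective_pairing; congr pair; exact: O0.
- split=> _; last by move=> k; congr pair; exact: O0.
  exists (fun k => ((0, - psum 0 (fun k => (v k).1) k), 0)) => k.
  rewrite [RHS]surjective_pairing; congr pair; last exact: O0.
  by rewrite /= (raddf0 (@cexp_star R)) sub0r psumS subr0 opprB opprK addKr.
split=> [e|[u uE] k].
  pose u := psum 0 (fun k => (v k).1.1).
  (* [w] solves the component [exp u - w] of the differential; the cocycle condition then yields the
     last component. *)
  pose w k := cexp_star (u k) - (v k).1.2.
  have uS k : u k.+1 = u k + (v k).1.1 by exact: psumS.
  exists (fun k => (u k, w k)) => k; rewrite [RHS]surjective_pairing [(v k).1]surjective_pairing.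
  have ek : cexp_star (v k).1.1 - ((v k.+1).1.2 - (v k).1.2) = (v k).2.
    by have /eqP := congr1 (fun x : MB 2 => x.1) (e k); rewrite /= subr_eq0 => /eqP.
  congr pair; first congr pair.
  - by rewrite /= addr0 uS addrC addKr.
  - by rewrite /= /w opprB addrC subrK.
  - by rewrite /= /w uS (raddfD (@cexp_star R)) /= subrBB [_ + cexp_star _]addrC addrK.
rewrite -!uE; congr pair; rewrite /= addr0 cexp_starB.
rewrite [X in _ - X - _]subrBB.
set p := cexp_star _ - cexp_star _; set q := (u k.+1).2 - (u k).2.
by rewrite opprB [p + _]addrC subrK subrr.
Qed.

Lemma cst_locally_constant (N : zmodType) (U : opens X) (z : N) :
  locally_constant (fun x (_ : U x) => z).
Proof. by move=> x Ux; exists U, (@subset_refl _ U). Qed.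

Definition Z1_res : inj_resolution (Z1_bullet sf) :=
  coind_resolution (P := const_funpred cf (Z1 R)) (@pt_eq R) 0 (@Z1_valB R) val_inj MZdifB
    (@cst_locally_constant _) MZ_div MZ_aug_ex MZ_dif_ex.

Definition pair_exp (z : C) : MB 0 := (z, cexp_star z).

Lemma pair_expB : {morph pair_exp : x y / x - y}.
Proof. by move=> x y; congr pair; exact: cexp_starB. Qed.

Lemma pair_exp_inj : injective pair_exp.
Proof. by move=> x y []. Qed.

Definition A_res : inj_resolution (A_bullet sf) :=
  coind_resolution (P := A_funpred sf) (@pt_eq R) 0 pair_expB pair_exp_inj MBdifB
    (fun U z => @smooth_fun_cst R X U z) MB_div MB_aug_ex MB_dif_ex.

Definition Astar_res : inj_resolution (Astar_bullet sf) :=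
  coind_resolution (P := Astar_funpred sf) (M := MC) (phi := id) (@pt_eq R) 0
    (fun _ _ => erefl) (fun _ _ e => e) MCdifB
    (fun U z => @smooth_fun_cst R X U (cval z)) MC_div MC_aug_ex MC_dif_ex.

Lemma in1B (M N : zmodType) (x x' : M) : ((x - x', 0) : M * N) = (x, 0) - (x', 0).
Proof. by congr pair; rewrite /= subr0. Qed.

Definition exp_i n : fhom (Z1_res n) (A_res n) :=
  coind_hom cf (a := fun x _ => (x, 0) : MB n) (fun x x' _ _ => in1B _ x x').

Definition exp_p n : fhom (A_res n) (Astar_res n) :=
  coind_hom cf (a := fun (x : MB n) _ => x.2) (fun _ _ _ _ => erefl).

Lemma exp_ses n : short_exact (exp_i n) (exp_p n).
Proof.
split.
- apply: tw_hom_inj => u v e; apply/funext => k.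
  by have := congr1 (fun w : nat -> MB n => (w k).1) e.
- apply: tw_exact => v; rewrite rec_map_eq0 rec_map_im; split=> [e|[u uE] k].
    by exists (fun k => (v k).1) => k; rewrite [RHS]surjective_pairing e.
  by rewrite -uE.
- apply: tw_hom_surj => w; exists (fun k => (0, w k)); exact/funext.
Qed.

Lemma coind_fhom_eq (F : fsheaf id) (M : zmodType) (a b : fhom F (coind cf M)) :
  (forall (U : opens X) (s : F U) x (Ux : U x) n,
     sub_val (sub_val a U s) x Ux n = sub_val (sub_val b U s) x Ux n) -> a = b.
Proof.
move=> e; apply: val_inj; apply: shom_eqP => U s; apply: val_inj.
by apply: dsec_eqP => x Ux; apply/funext => n; exact: e.
Qed.

Lemma exp_i_aug : fcomp (exp_i 0) (iaug Z1_res) = fcomp (iaug A_res) (Z1_to_A sf).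
Proof.
apply: coind_fhom_eq => U s x Ux n; congr pair.
(* The second entry of [pair_exp] is the exponential of an element of [2 pi i Z], hence trivial. *)
by apply/esym/cexp_star_eq0; exact: subgroupV.
Qed.

Lemma exp_p_aug : fcomp (exp_p 0) (iaug A_res) = fcomp (iaug Astar_res) (exp_A sf).
Proof. by apply: coind_fhom_eq. Qed.

Lemma exp_i_dif n : fcomp (exp_i n.+1) (idif Z1_res n) = fcomp (idif A_res n) (exp_i n).
Proof.
apply: coind_fhom_eq => U s x Ux k.
rewrite /= /rec_map /MBdif /=; congr pair.
  by case: n s => [|[|n]] s; rewrite /= ?oppr0 ?addr0 //; congr pair; rewrite /= addr0.
by case: n s => [|n] s; rewrite /= ?subr0.
Qed.

Lemma exp_p_dif n : fcomp (exp_p n.+1) (idif A_res n) = fcomp (idif Astar_res n) (exp_p n).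
Proof. by apply: coind_fhom_eq. Qed.

Definition exp_ses_resolution : ses_resolution (Z1_to_A sf) (exp_A sf) :=
  SesResolution exp_ses exp_i_aug exp_p_aug exp_i_dif exp_p_dif.

End ExponentialResolution.

Theorem fact3 (R : realType) :
  ~ (forall (X : complex_manifold R) (f : X -> X) (sf : smooth_map f)
       (S : ses_resolution (Z1_to_A sf) (exp_A sf)),
       bijective (coh_connecting (smooth_map_continuous sf) S 1))
  /\
  (forall (X : complex_manifold R), compact [set: X] ->
     simply_connected R X -> kahler X ->
   forall (f : X -> X) (sf : smooth_map f)
     (S : ses_resolution (Z1_to_A sf) (exp_A sf)),
     exists iota : {additive cstar R ->
         cohomology (smooth_map_continuous sf) (sesC S) 1},
       injective iota /\
       forall c : cstar R,
         coh_connecting (smooth_map_continuous sf) S 1 (iota c) = 0).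
Proof.
split=> [bij|X cX sc _ f sf S]; last first.
  pose iota : {additive cstar R -> cohomology (smooth_map_continuous sf) (sesC S) 1} :=
    HB.pack (@multiplier_class R X f sf (sesC S))
      (GRing.isZmodMorphism.Build _ _ _ (@multiplier_classB R X f sf (sesC S))).
  exists iota; split; first exact: multiplier_class_inj.
  by move=> c; exact: connecting_multiplier_class.
have inj := bij_inj (bij _ _ _ (exp_ses_resolution R)).
(* The constant 2 stands for any element of [C^*] other than 1. *)
pose c := @CStar R 2 (lt0r_neq0 (ltr0Sn _ 1)).
have c0 : multiplier_class (sesC (exp_ses_resolution R)) c = 0.
  (* Writing 0 as the class of the trivial constant lets the same vanishing lemma evaluate the
     connecting map at 0. *)
  have := multiplier_classB (sesC (exp_ses_resolution R)) c c; rewrite !subrr => <-.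
  by apply: inj; rewrite !connecting_multiplier_class.
(* With [f] the identity, [G (f x) = c + G x] makes [c] trivial, that is [2 = 1]. *)
have [G [_ _ /(_ 0) /eqP]] := multiplier_class_eq0 c0.
rewrite -[X in X == _]add0r (inj_eq (addIr _)) => /eqP/(congr1 (@cval R))/= /eqP.
by rewrite (eqr_nat _ 1 2).
Qed.
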